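(* Let $p_1\equiv p_2\equiv1\pmod4$ be primes such that at least two of $\left(\frac{p_1}{p_2}\right),\left(\frac{2}{p_1}\right),\left(\frac{2}{p_2}\right)$ equal $-1$ (equivalently, $\mathbf{C}_{k,2}$ is of type $(2,2,2)$ for $k=\mathbb{Q}(\sqrt{2p_1p_2},i)$). Let $\mathbb{K}_3=k(\sqrt2)=\mathbb{Q}(\sqrt2,\sqrt{p_1p_2},i)$. (1) If $q(\mathbb{K}_3^+/\mathbb{Q})=1$, then exactly four classes capitulate in $\mathbb{K}_3$ and $\ker J_{\mathbb{K}_3}=\langle[\mathcal{H}_0],[\mathcal{H}_1\mathcal{H}_2]\rangle$. (2) If $q(\mathbb{K}_3^+/\mathbb{Q})=2$, then $\ker J_{\mathbb{K}_3}=\langle[\mathcal{H}_0]\rangle$.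
   Context: $i=\sqrt{-1}$; $\left(\frac{\cdot}{\cdot}\right)$ is the Legendre symbol. $\mathbb{K}_3^+=\mathbb{Q}(\sqrt2,\sqrt{p_1p_2})$ and $q(\mathbb{K}_3^+/\mathbb{Q})=[E_{\mathbb{K}_3^+}:E_{\mathbb{Q}(\sqrt2)}E_{\mathbb{Q}(\sqrt{p_1p_2})}E_{\mathbb{Q}(\sqrt{2p_1p_2})}]$, $E$ denoting unit groups. Write $p_1=e^2+4f^2$, $p_2=g^2+4h^2$ with integers $e,f,g,h$, and $\pi_1=e+2if$, $\pi_2=e-2if$. $\mathcal{H}_1,\mathcal{H}_2$ are the prime ideals of $k$ above $\pi_1,\pi_2$ ($\mathcal{H}_j^2=\pi_j\mathcal{O}_k$), and $\mathcal{H}_0$ the prime of $k$ above $1+i$ ($\mathcal{H}_0^2=(1+i)\mathcal{O}_k$). $J_L:\mathbf{C}_k\to\mathbf{C}_L$ is the map on class groups induced by extension of ideals. *)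

(* Defs.v *)
(* Number fields are realised as subfields of algC
   (algebraic complex numbers); rings of integers via algnum's Aint. *)
From HB Require Import structures.
From mathcomp Require Import all_boot all_order all_algebra all_field.
Set Implicit Arguments. Unset Strict Implicit. Unset Printing Implicit Defensive.
Import Order.TTheory GRing.Theory Num.Theory.
Local Open Scope ring_scope.

Definition qres (a p : nat) : bool := [exists x : 'I_p, (x * x == a %[mod p])%N].
Definition legendre (a p : nat) : int :=
  if (p %| a)%N then 0 else if qres a p then 1 else -1.

(* The subfield Q(B) = Q-span of a sequence B of elements of algC
   (we only use it with B a Q-basis of the field, closed under products). *)
Definition inField (B : seq algC) (x : algC) : Prop :=
  exists c : 'I_(size B) -> rat, x = \sum_(j < size B) ratr (c j) * B`_j.

Definition sq (n : nat) : algC := sqrtC n%:R.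

Definition fld_k (p1 p2 : nat) := [:: 1; 'i; sq (2 * p1 * p2); 'i * sq (2 * p1 * p2)].
Definition fld_K3 (p1 p2 : nat) :=
  let t := sq (p1 * p2) in
  [:: 1; sq 2; t; sq 2 * t; 'i; 'i * sq 2; 'i * t; 'i * sq 2 * t].
Definition fld_K3p (p1 p2 : nat) := [:: 1; sq 2; sq (p1 * p2); sq 2 * sq (p1 * p2)].
Definition fld_quad (d : nat) := [:: 1; sq d].

Definition Oint (B : seq algC) (x : algC) : Prop := inField B x /\ x \in Aint.
Definition Units (B : seq algC) (x : algC) : Prop :=
  Oint B x /\ x != 0 /\ Oint B x^-1.

Definition mul_index (G H : algC -> Prop) (n : nat) : Prop :=
  exists r : 'I_n -> algC,
    [/\ forall j, G (r j),
        forall j j', H (r j / r j') -> j = j'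
      & forall x, G x -> exists j, H (x / r j)].

Definition unit_index_K3p (p1 p2 : nat) (n : nat) : Prop :=
  mul_index (Units (fld_K3p p1 p2))
    (fun x => exists u1 u2 u3, [/\ Units (fld_quad 2) u1, Units (fld_quad (p1 * p2)) u2,
                                  Units (fld_quad (2 * p1 * p2)) u3 & x = u1 * u2 * u3])
    n.

Definition submod (O : algC -> Prop) (J : algC -> Prop) : Prop :=
  [/\ forall x, J x -> O x, J 0,
      forall x y, J x -> J y -> J (x + y)
    & forall a x, O a -> J x -> J (a * x)].
Definition is_ideal (O : algC -> Prop) (I : algC -> Prop) : Prop :=
  submod O I /\ exists x, x != 0 /\ I x.
Definition gen (O : algC -> Prop) (S : algC -> Prop) (x : algC) : Prop :=
  forall J, submod O J -> (forall s, S s -> J s) -> J x.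
Definition idmul (O : algC -> Prop) (I J : algC -> Prop) : algC -> Prop :=
  gen O (fun z => exists x y, [/\ I x, J y & z = x * y]).
Definition idexp (O : algC -> Prop) (I : algC -> Prop) (n : nat) : algC -> Prop :=
  iter n (idmul O I) O.
Definition princ (O : algC -> Prop) (a : algC) (x : algC) : Prop :=
  exists b, O b /\ x = a * b.
Definition ideal_eq (I J : algC -> Prop) : Prop := forall x, I x <-> J x.
Definition is_principal (O : algC -> Prop) (I : algC -> Prop) : Prop :=
  exists a, ideal_eq I (princ O a).
Definition same_class (O : algC -> Prop) (I J : algC -> Prop) : Prop :=
  exists a b, [/\ O a, O b, a != 0, b != 0 &
    forall x, (exists y, I y /\ x = a * y) <-> (exists y, J y /\ x = b * y)].
Definition capitulates (OL : algC -> Prop) (I : algC -> Prop) : Prop :=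
  is_principal OL (gen OL I).

(* Main.v *)
Require Import Defs.
From HB Require Import structures.
From mathcomp Require Import all_boot all_order all_algebra all_field.
From mathcomp Require Import cyclic realalg zify ring lra.
From Stdlib Require Import Classical FunctionalExtensionality PropExtensionality.
Import Order.TTheory GRing.Theory Num.Theory.
Local Open Scope ring_scope.

(** Write L for K3, F for its maximal real subfield and [sg] for the generator of Gal(L/k). If an
    ideal I of k becomes (a) in L, then (a) is stable under [sg], so a / sg a is a unit of relative
    norm 1 ([cap_unit]). Every unit of L is a power of the eighth root of unity [zeta] times a unit
    of F ([EL]). The element 1 + zeta generates the extension of H0, and 1 + zeta = 'i (1 + sqrt 2)
    sg(1 + zeta) ([sg_zeta1]); multiplying a by 1 + zeta if necessary, one may assume a = ± v sg(a)
    with v a unit of F and v sg(v) = 1 ([alpha_red]). An explicit form of Hilbert 90 ([core]) gives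
    v = ± g / sg(g), where g in F satisfies g^2 = ± c x with x a unit of F and c = 1 or p1. Then a/g
    or a/(zeta g) lies in k, and contraction from L to k ([contract]) puts I in the class of H0^l (c
    = 1) or of H0^l H1H2 (c = p1). This is [cap_bound]. Conversely, if g^2 = ± p1 x then H1H2, whose
    square is (p1), becomes (g) in L ([ext_H12]).

    So the question is whether ± p1 times some unit of F is a square in F. If q = 1, it is
    ([q1_sqc]): take a unit of Q(sqrt(p1p2)) that is not ± a square, multiplied, when its norm is
    -1, by units of norm -1 of the other two quadratic fields. [sqc_rat] shows that this unit, or p1
    times it, is ± a square in F, and the first alternative is impossible. If q = 2, it is not
    ([q2_not_sqc]): a unit of F outside the product of the three quadratic unit groups has norm -1
    over Q, so all three quadratic fields have units of norm -1, and a relation g^2 = ± p1 x could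
    be reduced to ± p1 being a square in F.

    The Legendre conditions enter through the norm equations X^2 - d Y^2 = ±8, ±4p1, ±4p2, which
    they make unsolvable. Hence 2, p1, p2 and 2p1 times a unit are never ± a square in
    Q(sqrt(2p1p2)). This yields a unit of norm -1 in that field ([ed_exists]), the description of
    the units of L ([no_zeta_unit]), and the independence of the classes of H0 and H1H2 in k
    ([not_principal]), hence exactly four classes when q = 1. *)

(** * Subfields of [algC], quadratic adjunctions and their conjugations *)

Record subfield (K : algC -> Prop) : Prop := Subfield {
  sf1 : K 1;
  sfB : forall x y, K x -> K y -> K (x - y);
  sfM : forall x y, K x -> K y -> K (x * y);
  sfV : forall x, K x -> K x^-1 }.

Section Subfield.
Context {K : algC -> Prop} (sfK : subfield K).

Lemma sf0 : K 0. Proof. by rewrite -(subrr 1); apply: sfB => //; apply: sf1. Qed.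

Lemma sfN x : K x -> K (- x).
Proof. by move=> Kx; rewrite -sub0r; apply: sfB => //; apply: sf0. Qed.

Lemma sfD x y : K x -> K y -> K (x + y).
Proof. by move=> Kx Ky; rewrite -[y]opprK; apply: sfB => //; apply: sfN. Qed.

Lemma sf_div x y : K x -> K y -> K (x / y).
Proof. by move=> Kx Ky; apply: sfM => //; apply: sfV. Qed.

Lemma sfX x n : K x -> K (x ^+ n).
Proof.
move=> Kx; elim: n => [|n IHn]; first by rewrite expr0; apply: sf1.
by rewrite exprS; apply: sfM.
Qed.

Lemma sf_nat n : K n%:R.
Proof.
elim: n => [|n IHn]; first exact: sf0.
by rewrite -addn1 natrD; apply: sfD => //; apply: sf1.
Qed.

Lemma sf_int (z : int) : K z%:~R.
Proof. by case: z => n; [exact: sf_nat | rewrite NegzE mulrNz; apply/sfN/sf_nat]. Qed.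

Lemma sf_rat (r : rat) : K (ratr r).
Proof. by apply: sf_div; apply: sf_int. Qed.

Lemma sf_sum (I : Type) (s : seq I) (F : I -> algC) :
  (forall i, K (F i)) -> K (\sum_(i <- s) F i).
Proof. by move=> KF; apply: big_ind => [|x y Kx Ky|//]; [exact: sf0 | exact: sfD]. Qed.

End Subfield.

Definition QQ (x : algC) : Prop := exists r : rat, x = ratr r.

Lemma QQ_subfield : subfield QQ.
Proof.
split=> [|_ _ [r ->] [s ->]|_ _ [r ->] [s ->]|_ [r ->]].
- by exists 1; rewrite rmorph1.
- by exists (r - s); rewrite rmorphB.
- by exists (r * s); rewrite rmorphM.
- by exists r^-1; rewrite fmorphV.
Qed.

Definition adj (K : algC -> Prop) (a x : algC) : Prop :=
  exists u v, [/\ K u, K v & x = u + v * a].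

Section Adj.
Context {K : algC -> Prop} (sfK : subfield K).
Implicit Types a x : algC.

Lemma adjS a x : K x -> adj K a x.
Proof. by move=> Kx; exists x, 0; split=> //; [exact: sf0 | rewrite mul0r addr0]. Qed.

Lemma adj_gen a : adj K a a.
Proof. by exists 0, 1; split; [exact: sf0 | exact: sf1 | rewrite mul1r add0r]. Qed.

Lemma adj_min (M : algC -> Prop) a x :
  subfield M -> (forall y, K y -> M y) -> M a -> adj K a x -> M x.
Proof.
move=> sfM' KM Ma [u [v [Ku Kv ->]]].
by apply: (sfD sfM') (KM _ Ku) (sfM _ sfM' _ _ (KM _ Kv) Ma).
Qed.

Lemma adj_subfield a : K (a * a) -> subfield (adj K a).
Proof.
move=> Kaa; split.
- by apply: adjS; apply: sf1.
- move=> _ _ [u [v [Ku Kv ->]]] [u' [v' [Ku' Kv' ->]]].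
  by exists (u - u'), (v - v'); split; [exact: sfB|exact: sfB|ring].
- move=> _ _ [u [v [Ku Kv ->]]] [u' [v' [Ku' Kv' ->]]].
  exists (u * u' + v * v' * (a * a)), (u * v' + v * u'); split; last by ring.
    by apply: sfD => //; apply: sfM => //; apply: sfM.
  by apply: sfD => //; apply: sfM.
move=> _ [u [v [Ku Kv ->]]].
(* The norm can vanish when [a] already lies in [K]; then [u + v * a] is 0 or [u + u]. *)
have [n0|nz] := eqVneq (u ^+ 2 - v ^+ 2 * (a * a)) 0.
  have /eqP : (u + v * a) * (u - v * a) = 0 by rewrite -n0; ring.
  rewrite mulf_eq0 => /orP[/eqP->|]; first by rewrite invr0; apply/adjS/sf0.
  rewrite subr_eq0 => /eqP <-; apply: adjS; apply: (sfV _ sfK); exact: (sfD sfK).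
exists (u / (u ^+ 2 - v ^+ 2 * (a * a))), (- v / (u ^+ 2 - v ^+ 2 * (a * a))).
have Kn : K (u ^+ 2 - v ^+ 2 * (a * a)).
  by apply: (sfB _ sfK) (sfX sfK _ _ Ku) (sfM _ sfK _ _ (sfX sfK _ _ Kv) Kaa).
split; [exact: sf_div| by apply: (sf_div sfK) => //; exact: sfN|].
have nz1 : u + v * a != 0.
  have E : u ^+ 2 - v ^+ 2 * (a * a) = (u + v * a) * (u - v * a) by ring.
  by move: nz; rewrite E mulf_eq0 negb_or => /andP[].
apply: (mulfI nz1); rewrite mulfV //; apply: (mulfI nz); rewrite mulr1.
have -> : (u ^+ 2 - v ^+ 2 * (a * a)) * ((u + v * a) *
 (u / (u ^+ 2 - v ^+ 2 * (a * a)) + - v / (u ^+ 2 - v ^+ 2 * (a * a)) * a)) =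
 ((u ^+ 2 - v ^+ 2 * (a * a)) / (u ^+ 2 - v ^+ 2 * (a * a))) * (u ^+ 2 - v ^+ 2 * (a * a)).
  by ring.
by rewrite divff // mul1r.
Qed.

Lemma adj_fixed (nu : {rmorphism algC -> algC}) a x :
  (forall y, K y -> nu y = y) -> nu a = - a -> adj K a x -> nu x = x -> K x.
Proof.
move=> fixK nua [u [v [Ku Kv ->]]]; rewrite rmorphD rmorphM /= nua !fixK // => /eqP.
rewrite -subr_eq0 -oppr_eq0 => /eqP H.
suff -> : u + v * a = u by [].
have : 2 * (v * a) = 0 by rewrite -[RHS]H; ring.
by move/eqP; rewrite mulf_eq0 pnatr_eq0 /= => /eqP->; rewrite addr0.
Qed.

Lemma adj_stable (nu : {rmorphism algC -> algC}) a x :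
  (forall y, K y -> K (nu y)) -> (nu a = a \/ nu a = - a) -> adj K a x -> adj K a (nu x).
Proof.
move=> Knu nua [u [v [Ku Kv ->]]]; rewrite rmorphD rmorphM /=.
case: nua => ->; first by exists (nu u), (nu v); split=> //; apply: Knu.
exists (nu u), (- nu v); split; [exact: Knu|exact/sfN/Knu|by rewrite mulrN mulNr].
Qed.

Lemma adj_sqrt a x : K (a * a) -> adj K a x -> K (x * x) -> ~ K a ->
  K x \/ K (x * a).
Proof.
move=> Kaa [u [v [Ku Kv ->]]] Kxx nKa.
have [v0|nzv] := eqVneq v 0; first by left; rewrite v0 mul0r addr0.
have [u0|nzu] := eqVneq u 0.
  by right; rewrite u0 add0r -mulrA; apply: sfM.
case: nKa; have -> : a = ((u + v * a) * (u + v * a) - u * u - v * v * (a * a)) / (2 * u * v).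
  by field; rewrite nzu nzv.
apply: (sf_div sfK); last by apply: sfM=> //; apply: sfM => //; exact: sf_nat.
by apply: (sfB _ sfK); [apply: sfB => //; apply: sfM | do 2! [apply: sfM => //]].
Qed.

End Adj.

(** The conjugation is built on a number field containing [a], [b], [c], where the minimal
    polynomial of [a] over Q(b, c) is X^2 - a^2, and is then extended to all of [algC]. *)
Lemma quad_conj (a b c : algC) : QQ (a * a) -> QQ (b * b) -> QQ (c * c) ->
  ~ adj (adj QQ b) c a ->
  exists nu : {rmorphism algC -> algC}, [/\ nu a = - a, nu b = b & nu c = c].
Proof.
move=> Qaa Qbb Qcc notin.
have [Qs [QsC [s1 Ds1 gen]]] := num_field_exists [:: b; c; a].
case: s1 Ds1 gen => [|b' [|c' [|a' [|? ?]]]] //= [Db Dc Da] gen.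
have step (K : {subfield Qs}) (x : Qs) (P : algC -> Prop) : subfield P ->
    P (QsC x * QsC x) -> (forall y, y \in K -> P (QsC y)) ->
    forall y, y \in <<K; x>>%VS -> adj P (QsC x) (QsC y).
  move=> sfP Pxx KP y /Fadjoin_polyP[p Kp ->].
  rewrite horner_coef rmorph_sum /=; apply: (sf_sum (adj_subfield sfP _ Pxx)) => i.
  rewrite rmorphM rmorphXn /=; apply: (sfM _ (adj_subfield sfP _ Pxx)).
    by apply: (adjS sfP); apply: KP; apply: (polyOverP Kp).
  by apply: (sfX (adj_subfield sfP _ Pxx)); apply: adj_gen.
pose K1 := <<1; b'>>%AS; pose K := <<K1; c'>>%AS.
have sfb : subfield (adj QQ b) by apply: adj_subfield; [exact: QQ_subfield|].
have K1P y : y \in K1 -> adj QQ b (QsC y).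
  rewrite -Db; apply: step; rewrite ?Db //; first exact: QQ_subfield.
  move=> z /vlineP[r ->]; exists r; by rewrite rmorphZ_num rmorph1 mulr1.
have KP y : y \in K -> adj (adj QQ b) c (QsC y).
  rewrite -Dc; apply: step; rewrite ?Dc //.
  by apply: (adjS QQ_subfield).
have a'K : a' \notin K by apply/negP=> /KP; rewrite Da.
have fullE : (<<K; a'>>%VS = fullv).
  by rewrite -gen /K /K1 /= !adjoin_cons adjoin_nil agenv_id.
have K1a : a' * a' \in K.
  case: Qaa => r Dr; apply: (subvP (sub1v _)); apply/vlineP; exists r.
  apply: (fmorph_inj QsC); rewrite rmorphM /= Da Dr rmorphZ_num rmorph1 mulr1 //.
pose q : {poly Qs} := ('X - a'%:P) * ('X - (- a')%:P).
have qE : q = 'X^2 - (a' * a')%:P.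
  by rewrite /q polyCN opprK -subr_sqr !expr2 polyCM.
have qK : q \is a polyOver K by rewrite qE rpredB ?rpredX ?polyOverX ?polyOverC.
have dv : minPoly K a' %| q.
  by apply: minPoly_dvdp => //; rewrite rootM root_XsubC eqxx.
have szq : size q = 3 by rewrite /q size_Mmonic ?monicXsubC ?polyXsubC_eq0 // !size_XsubC.
have eqq : minPoly K a' %= q.
  rewrite -(dvdp_size_eqp dv) szq size_minPoly eqn_leq; apply/andP; split.
    by rewrite -szq -size_minPoly; apply: dvdp_leq => //; rewrite -size_poly_gt0 szq.
  rewrite ltnS; case: (adjoin_degree K a') (adjoin_deg_eq1 K a') (size_minPoly K a').
  - by move=> _ s1; have := root_minPoly K a'; move/eqP: s1; case/size_poly1P=> z nz ->; rewrite rootC (negPf nz).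
  - by case=> //; rewrite eqxx (negPf a'K).
have rt : root (minPoly K a') (- a') by rewrite (eqp_root eqq) rootM !root_XsubC eqxx orbT.
pose f := kHomExtend K \1 a' (- a').
have hf : kHom K <<K; a'>> f.
  by apply: kHomExtendP; rewrite ?subvv ?kHom1 // lfun1_poly.
have hf1 : kHom 1 fullv f by move: hf; rewrite fullE; apply: kHomSl; rewrite sub1v.
have fM : monoid_morphism f by apply/kHom_monoid_morphism.
pose fM' := GRing.isMonoidMorphism.Build Qs Qs f fM.
pose fA' := GRing.isZmodMorphism.Build Qs Qs f (raddfB f).
pose fR : {rmorphism Qs -> Qs} := HB.pack (f : Qs -> Qs) fA' fM'.
have [nu Dnu] := extend_algC_subfield_aut QsC fR.
exists nu; split.
- rewrite -Da -Dnu /= /f (kHomExtend_val (kHom1 K K)) ?rmorphN //.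
  by rewrite lfun1_poly.
- rewrite -Db -Dnu /= /f kHomExtend_id ?lfunE //.
  by rewrite /K /= (subvP (subv_adjoin _ _)) // memv_adjoin.
- rewrite -Dc -Dnu /= /f kHomExtend_id ?lfunE //.
  by rewrite /K /= memv_adjoin.
Qed.

Lemma QQ_sqrt_adj (a b : algC) : QQ (a * a) -> QQ (b * b) ->
  adj QQ b a -> QQ a \/ QQ (a * b).
Proof.
move=> Qaa Qbb h; have [Qb|nQb] : QQ b \/ ~ QQ b.
- case Cb: (b \in Crat); first by left; case/CratP: Cb => r ->; exists r.
  by right=> -[r Dr]; move: Cb; rewrite Dr Crat_rat.
- left; apply: (adj_min _ _ _ QQ_subfield _ Qb h) => //.
- exact: (adj_sqrt QQ_subfield b a Qbb h Qaa nQb).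
Qed.

(** Kummer theory of exponent 2, one quadratic step at a time: if [a] lies in Q(b, c) then one of
    [a], [a * b], [a * c], [a * b * c] is rational. *)
Lemma notin_biquad (a b c : algC) : QQ (a * a) -> QQ (b * b) -> QQ (c * c) ->
  ~ QQ a -> ~ QQ (a * b) -> ~ QQ (a * c) -> ~ QQ (a * b * c) ->
  ~ adj (adj QQ b) c a.
Proof.
move=> Qaa Qbb Qcc na nab nac nabc h.
have nQba : ~ adj QQ b a by move/(QQ_sqrt_adj _ _ Qaa Qbb) => [].
have sfb := adj_subfield QQ_subfield b Qbb.
have adjQ x : QQ x -> adj QQ b x by apply: adjS QQ_subfield _ _.
have Qacc : QQ (a * c * (a * c)) by rewrite mulrACA; apply: (sfM _ QQ_subfield).
have nb : ~ adj QQ b c.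
  move=> bc; apply: nQba.
  by apply: (adj_min _ _ _ sfb _ bc h).
case: (adj_sqrt sfb c a (adjQ _ Qcc) h (adjQ _ Qaa) nb) => // hac.
case: (QQ_sqrt_adj _ _ Qacc Qbb hac) => //.
by rewrite mulrAC.
Qed.

(** * Pell's equation by Dirichlet approximation *)

Section Pell.
Variables (R : archiRcfType) (n : nat).
Hypothesis nonsq : forall x y : int, x ^+ 2 = n%:Z * y ^+ 2 -> y = 0.

Let w : R := Num.sqrt n%:R.
Let ww : w ^+ 2 = n%:R. Proof. by rewrite sqr_sqrtr ?ler0n. Qed.
Let w_ge0 : 0 <= w. Proof. exact: sqrtr_ge0. Qed.
Let ev (p : int * int) : R := p.1%:~R - p.2%:~R * w.
Let nm (p : int * int) : int := p.1 ^+ 2 - n%:Z * p.2 ^+ 2.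

Let nmE p : (nm p)%:~R = ev p * (p.1%:~R + p.2%:~R * w).
Proof.
rewrite /nm /ev rmorphB /= intrM !rmorphXn /= -[n%:~R]/(n%:R) -ww; ring.
Qed.

Let nm_neq0 p : p.2 != 0 -> nm p != 0.
Proof. by apply: contraNneq => /eqP; rewrite subr_eq0 => /eqP /nonsq ->. Qed.

Let ev_neq0 p : p.2 != 0 -> ev p != 0.
Proof.
move=> /nm_neq0; apply: contraNneq => e0.
by have /eqP := nmE p; rewrite e0 mul0r intr_eq0.
Qed.

(** Good approximations x - y w have norm bounded by 1 + 2w, so only finitely many norms occur. *)
Let M := (Num.truncn (1 + 2 * w)).+1.

Lemma dirichlet (N : nat) : (0 < N)%N ->
  exists p, [/\ 0 < p.2, p.2 <= N%:Z & `|ev p| * N%:R < 1].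
Proof.
move=> N0; pose a (j : nat) := Num.truncn (j%:R * w).
pose fr (j : nat) : R := j%:R * w - (a j)%:R.
have frP j : 0 <= fr j < 1.
  have /andP[h1 h2] : (a j)%:R <= j%:R * w < (a j).+1%:R.
    by apply: truncn_itv; apply: mulr_ge0.
  by rewrite /fr subr_ge0 h1 ltrBlDr addrC natr1.
have bP j : (Num.truncn (N%:R * fr j) < N)%N.
  have /andP[h1 h2] := frP j.
  rewrite truncn_lt_nat ?mulr_ge0 //.
  by rewrite -[ltRHS]mulr1 ltr_pM2l ?ltr0n.
pose b (j : 'I_N.+1) : 'I_N := Ordinal (bP j).
have /injectivePn[j [k njk ebjk]] : ~~ injectiveb b.
  apply/negP=> /injectiveP /leq_card; rewrite !card_ord ltnn //.
wlog ltjk : j k njk ebjk / (j < k)%N.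
  move=> th; have [||e] := ltngtP j k; [exact: th|apply: th => //; by rewrite eq_sym|].
  by case/eqP: njk; apply: val_inj.
exists ((a k)%:Z - (a j)%:Z, k%:Z - j%:Z); rewrite /ev /=; split.
- by rewrite subr_gt0 ltz_nat.
- by have := ltn_ord k; lia.
have -> : ((a k)%:Z - (a j)%:Z)%:~R - (k%:Z - j%:Z)%:~R * w = fr j - fr k.
  by rewrite /fr !rmorphB /= -![_%:~R]/(_%:R); ring.
have := congr1 val ebjk; rewrite /= => e.
have h x : 0 <= fr x -> (Num.truncn (N%:R * fr x))%:R <= N%:R * fr x < (Num.truncn (N%:R * fr x)).+1%:R.
  by move=> fx; apply: truncn_itv; apply: mulr_ge0.
have /andP[/h hj _] := frP j; have /andP[/h hk _] := frP k.
move: hj hk; rewrite e -natr1; set T := (_%:R : R) => /andP[h1 h2] /andP[h3 h4].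
rewrite -[X in _ * X < _](ger0_norm (ler0n R N)) -normrM mulrC mulrBr ltr_norml.
by apply/andP; split; lra.
Qed.

Let good (p : int * int) := [&& p.2 != 0, 0 < `|ev p| & `|nm p| < M%:Z].

Lemma pell_step (d : R) : 0 < d -> exists p, good p && (`|ev p| < d).
Proof.
move=> d0; pose N := (Num.truncn d^-1).+1.
have Nd : 1 < N%:R * d.
  rewrite -ltr_pdivrMr // div1r.
  have /andP[] // : (Num.truncn d^-1)%:R <= d^-1 < N%:R.
  by apply: truncn_itv; rewrite invr_ge0 ltW.
have [p [p0 pN eN]] := dirichlet N isT.
have p20 : p.2 != 0 by rewrite gt_eqF.
have N1 : 1 <= N%:R :> R by rewrite ler1n.
have e1 : `|ev p| < d.
  rewrite -(ltr_pM2r (lt_le_trans ltr01 N1)); apply: lt_trans eN _.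
  by rewrite mulrC.
exists p; rewrite e1 andbT /good p20 normr_gt0 ev_neq0 //=.
have pM : 1 + 2 * w < M%:R.
  have w0 := w_ge0; have /andP[] : (Num.truncn (1 + 2 * w))%:R <= 1 + 2 * w < M%:R.
    by apply: truncn_itv; lra.
  by [].
rewrite -(ltr_int R) intr_norm nmE normrM.
have -> : p.1%:~R + p.2%:~R * w = ev p + 2 * p.2%:~R * w by rewrite /ev; ring.
apply: le_lt_trans (_ : `|ev p| * (`|ev p| + 2 * N%:R * w) < _).
  apply: ler_wpM2l; first exact: normr_ge0.
  apply: (le_trans (ler_normD _ _)); rewrite lerD2l.
  have pp : 0 <= p.2%:~R :> R by rewrite ler0z ltW.
  rewrite ger0_norm; last by apply: mulr_ge0 => //; lra.
  apply: ler_wpM2r => //; rewrite ler_pM2l ?ltr0n //.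
  by rewrite -[N%:R]/(N%:~R) ler_int.
rewrite mulrDr; apply: le_lt_trans pM; apply: lerD.
  have e11 : `|ev p| < 1.
    apply: le_lt_trans eN; rewrite -[leLHS]mulr1; apply: ler_wpM2l => //.
  by rewrite -[leRHS]mulr1; apply: ler_pM => //; apply: ltW.
have -> : `|ev p| * (2 * N%:R * w) = (`|ev p| * N%:R) * (2 * w) by ring.
rewrite -[leRHS]mul1r; apply: ler_wpM2r; last exact: ltW.
by have := w_ge0; lra.
Qed.

(** An infinite sequence of strictly better approximations of bounded norm is coloured by the norm
    and by both residues modulo it; two terms share a colour. *)
Lemma pell_pair : exists p q, [/\ good p, good q, `|ev q| < `|ev p|,
  nm p = nm q & (nm p %| p.1 - q.1)%Z /\ (nm p %| p.2 - q.2)%Z].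
Proof.
have next (s : {p | good p}) : {t : {p | good p} | `|ev (val t)| < `|ev (val s)|}.
  have /sigW[q /andP[gq lq]] : exists p, good p && (`|ev p| < `|ev (val s)|).
    by apply: pell_step; case: s => p /= /and3P[].
  by exists (exist _ q gq).
have [p0 gp0] : {p | good p}.
  have /sigW[p /andP[gp _]] := pell_step 1 ltr01; by exists p.
pose f k := iter k (fun s => sval (next s)) (exist _ p0 gp0).
have dec i j : (i < j)%N -> `|ev (val (f j))| < `|ev (val (f i))|.
  elim: j => // j IHj; rewrite ltnS leq_eqVlt => /orP[/eqP->|/IHj lt].
    by rewrite /f /=; case: (next _).
  by apply: lt_trans lt; rewrite {1}/f /=; case: (next _).
pose col (i : nat) : 'I_(2 * M).+1 * 'I_M.+1 * 'I_M.+1 :=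
  let p := val (f i) in
  (inord (absz (nm p + M%:Z)), inord (absz (p.1 %% nm p)%Z), inord (absz (p.2 %% nm p)%Z)).
pose C := #|{: 'I_(2 * M).+1 * 'I_M.+1 * 'I_M.+1}|.
have /injectivePn[i [j nij eij]] : ~~ injectiveb (fun i : 'I_C.+1 => col i).
  by apply/negP=> /injectiveP /leq_card; rewrite card_ord -/C ltnn.
wlog ltij : i j nij eij / (i < j)%N.
  move=> th; have [||e] := ltngtP i j; [exact: th|apply: th => //; by rewrite eq_sym|].
  by case/eqP: nij; apply: val_inj.
exists (val (f i)), (val (f j)).
have gi := valP (f i); have gj := valP (f j).
have lt := dec _ _ ltij; move: eij.
rewrite /col; set P := val (f i); set Q := val (f j).
move: gi gj lt; rewrite -/P -/Q => gP gQ lt [] e1 e2 e3.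
have [P0 _ MP] := and3P gP; have [Q0 _ MQ] := and3P gQ.
have nP0 := nm_neq0 P P0; have nQ0 := nm_neq0 Q Q0.
have inj k (x y : nat) : (x < k.+1)%N -> (y < k.+1)%N ->
    (inord x : 'I_k.+1) = inord y -> x = y.
  by move=> lx ly /(congr1 val); rewrite /= !inordK.
have E1 : nm P = nm Q.
  have l (z : int) : `|z| < M%:Z -> (absz (z + M%:Z)%R < (2 * M).+1)%N by lia.
  by move/(inj _ _ _ (l _ MP) (l _ MQ)): e1; lia.
have md (x c : int) : c != 0 -> `|c| < M%:Z -> (absz (x %% c)%Z < M.+1)%N.
  by move=> c0 cM; have := modz_ge0 x c0; have := ltz_mod x c0; lia.
have E (x y c : int) : c != 0 -> `|c| < M%:Z ->
    (inord (absz (x %% c)%Z) : 'I_M.+1) = inord (absz (y %% c)%Z) -> (c %| x - y)%Z.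
  move=> c0 cM /(inj _ _ _ (md x c c0 cM) (md y c c0 cM)) h.
  have {}h : (x %% c)%Z = (y %% c)%Z.
    by have := modz_ge0 x c0; have := modz_ge0 y c0; lia.
  by rewrite -eqz_mod_dvd; apply/eqP.
split=> //; split; apply: E => //; [by rewrite {2}E1|by rewrite {2}E1].
Qed.

Lemma pell_sol : exists x y : int, y != 0 /\ x ^+ 2 - n%:Z * y ^+ 2 = 1.
Proof.
have [[x y] [[x' y'] [/and3P[/= y0 _ _] /and3P[/= y0' _ _] lt En [d1 d2]]]] := pell_pair.
have := nm_neq0 (x, y) y0; move: d1 d2 lt En; rewrite /=; set c := nm (x, y).
move=> /dvdzP[k1 h1] /dvdzP[k2 h2] lt En c0.
(* [X + Y * w] is the quotient [ev (x, y) / ev (x', y')]; the congruences make [X] and [Y] integers,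
   and [Y = 0] would make the two approximations equally good. *)
pose X := k1 * x' - n%:Z * k2 * y' + 1; pose Y := k1 * y' - k2 * x'.
have ec : c = x ^+ 2 - n%:Z * y ^+ 2 by [].
have ec' : c = x' ^+ 2 - n%:Z * y' ^+ 2 by [].
have eX : X * c = x * x' - n%:Z * y * y'.
  have -> : x = k1 * c + x' by rewrite -h1; ring.
  have -> : y = k2 * c + y' by rewrite -h2; ring.
  by rewrite /X mulrDl mul1r [X in _ + X]ec'; ring.
have eY : Y * c = x * y' - x' * y.
  have -> : x = k1 * c + x' by rewrite -h1; ring.
  have -> : y = k2 * c + y' by rewrite -h2; ring.
  by rewrite /Y; ring.
exists X, Y; have E : X ^+ 2 - n%:Z * Y ^+ 2 = 1.
  have cc : c ^+ 2 != 0 by rewrite expf_neq0.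
  apply: (mulIf cc); rewrite mul1r.
  have -> : (X ^+ 2 - n%:Z * Y ^+ 2) * c ^+ 2 = (X * c) ^+ 2 - n%:Z * (Y * c) ^+ 2 by ring.
  by rewrite eX eY [in RHS]expr2 {1}ec ec'; ring.
split=> //; apply: contraTneq lt => Y0.
have X1 : X ^+ 2 = 1 by rewrite -E Y0; ring.
have eq0 : ev (x', y') * (x'%:~R + y'%:~R * w) = c%:~R.
  by rewrite En -nmE.
have q0 : x'%:~R + y'%:~R * w != 0.
  by apply: contra_neq c0 => q0; apply/eqP; rewrite -(intr_eq0 R) -eq0 q0 mulr0.
have : ev (x, y) * (x'%:~R + y'%:~R * w) = X%:~R * c%:~R.
  have Y0' : (x * y' - x' * y)%:~R = 0 :> R by rewrite -eY Y0 mul0r.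
  rewrite -intrM eX -[RHS]addr0 -(mul0r w) -Y0'.
  rewrite /ev /= !rmorphB /= !intrM -[n%:~R]/(n%:R) -ww; ring.
rewrite -eq0 mulrA => /(mulIf q0) ->.
have /eqP := X1; rewrite sqrf_eq1 => /orP[] /eqP -> ;
  by rewrite ?mulrN1z ?mulN1r ?normrN ?mul1r ltxx.
Qed.

End Pell.

(** * Integrality, relative traces and norms, unit groups *)

Lemma Aint_sqrt (x : algC) : x * x \in Aint -> x \in Aint.
Proof.
move=> Ax; apply: (@root_monic_Aint (minCpoly (x * x) \Po 'X^2)).
- by rewrite /root horner_comp hornerXn expr2 -/(root _ _) root_minCpoly.
- rewrite monicE lead_coef_comp ?size_polyXn // lead_coefXn expr1n mulr1.
  by rewrite -monicE minCpoly_monic.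
- by rewrite polyOver_comp ?rpredX ?polyOverX.
Qed.

Lemma QQ_Aint (x : algC) : QQ x -> x \in Aint -> exists z : int, x = z%:~R.
Proof. by move=> [r ->] /(Cint_rat_Aint (Crat_rat r))/intrP. Qed.

Lemma fmorph_QQ (nu : {rmorphism algC -> algC}) x : QQ x -> nu x = x.
Proof. by move=> [r ->]; rewrite fmorph_rat. Qed.

Lemma adj_trace_norm (K : algC -> Prop) (a x : algC) (nu : {rmorphism algC -> algC}) :
  subfield K -> K (a * a) -> (forall y, K y -> nu y = y) -> nu a = - a ->
  adj K a x -> K (x + nu x) /\ K (x * nu x).
Proof.
move=> sfK Kaa fixK nua [u [v [Ku Kv ->]]]; rewrite rmorphD rmorphM /= nua !fixK //.
have -> : u + v * a + (u + v * - a) = u + u by ring.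
have -> : (u + v * a) * (u + v * - a) = u * u - v * v * (a * a) by ring.
by split; [exact: (sfD sfK) | apply: (sfB _ sfK); do 2?[apply: (sfM _ sfK) => //]].
Qed.

Definition isU (K : algC -> Prop) (u : algC) : Prop :=
  [/\ K u, u \in Aint, u != 0 & u^-1 \in Aint].

Lemma isU_sub (K M : algC -> Prop) u : (forall x, K x -> M x) -> isU K u -> isU M u.
Proof. by move=> KM [/KM]. Qed.

Section UnitGroup.
Context {K : algC -> Prop} (sfK : subfield K).
Implicit Types u v : algC.

Lemma isU1 : isU K 1.
Proof. by split; rewrite ?invr1 ?oner_eq0 ?Aint1 //; apply: sf1. Qed.

Lemma isUV u : isU K u -> isU K u^-1.
Proof. by case=> Ku Au u0 Av; split; rewrite ?invrK ?invr_eq0 //; apply: sfV. Qed.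

Lemma isUM u v : isU K u -> isU K v -> isU K (u * v).
Proof.
move=> [Ku Au u0 Au'] [Kv Av v0 Av']; split; rewrite ?invfM ?mulf_neq0 ?rpredM //.
exact: sfM.
Qed.

Lemma isU_div u v : isU K u -> isU K v -> isU K (u / v).
Proof. by move=> Uu /isUV; apply: isUM. Qed.

Lemma isUN u : isU K u -> isU K (- u).
Proof. by case=> Ku Au u0 Av; split; rewrite ?invrN ?oppr_eq0 ?rpredN //; apply: sfN. Qed.

Lemma isUX u n : isU K u -> isU K (u ^+ n).
Proof. by move=> Uu; elim: n => [|n IHn]; rewrite ?expr0 ?exprS; [exact: isU1|exact: isUM]. Qed.

Lemma isU_aut (nu : {rmorphism algC -> algC}) u :
  (forall x, K x -> K (nu x)) -> isU K u -> isU K (nu u).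
Proof. by move=> st [Ku Au u0 Av]; split; rewrite -?fmorphV ?fmorph_eq0 ?Aint_aut //; apply: st. Qed.

Lemma isU_sqrt u : K u -> isU K (u * u) -> isU K u.
Proof.
move=> Ku [_ A nz A']; move: nz; rewrite mulf_eq0 orbb => nz.
by split=> //; [exact: Aint_sqrt | apply: Aint_sqrt; rewrite -invfM].
Qed.

End UnitGroup.

Lemma isU_QQ u : isU QQ u -> u = 1 \/ u = -1.
Proof.
case=> Qu Au u0 Av; have [z Dz] := QQ_Aint _ Qu Au.
have [z' Dz'] := QQ_Aint _ (sfV _ QQ_subfield _ Qu) Av.
have : z * z' = 1 by apply/eqP; rewrite -(eqr_int algC) rmorphM /= -Dz -Dz' divff.
move/(congr1 absz)/eqP; rewrite abszM muln_eq1 => /andP[/eqP h _].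
have : z = 1 \/ z = -1 by lia.
by rewrite Dz; case=> ->; [left | right; rewrite mulrN1z].
Qed.

Lemma lt_sq_inv_sq (a b : algC) : 1 < a -> a < b -> a ^+ 2 + a ^- 2 < b ^+ 2 + b ^- 2.
Proof.
move=> a1 ab; have a0 : 0 < a := lt_trans ltr01 a1.
have b0 := lt_trans a0 ab; have b1 := lt_trans a1 ab.
rewrite -subr_gt0.
have -> : b ^+ 2 + b ^- 2 - (a ^+ 2 + a ^- 2) = (b ^+ 2 - a ^+ 2) * (1 - (a ^+ 2 * b ^+ 2)^-1).
  by field; rewrite !gt_eqF.
apply: mulr_gt0; rewrite subr_gt0; first by rewrite ltr_pXn2r ?nnegrE ?ltW.
rewrite invf_lt1 ?mulr_gt0 ?exprn_gt0 //.
rewrite -[1]mulr1; apply: ltr_pM; rewrite ?ler01 ?exprn_egt1 //.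
Qed.

(** * Units of real quadratic fields *)

Section FundamentalUnit.
Variables (n : nat) (w : algC) (tau : {rmorphism algC -> algC}).
Hypotheses (ww : w * w = n%:R) (w0 : 0 < w) (nQw : ~ QQ w) (tauw : tau w = - w).
Let K := adj QQ w.

Let Qww : QQ (w * w). Proof. by rewrite ww; apply: sf_nat QQ_subfield _. Qed.
Let sfK : subfield K := adj_subfield QQ_subfield _ Qww.

Lemma quad_real x : K x -> x \is Num.real.
Proof.
move=> [_ [_ [[r ->] [s ->] ->]]].
have R (t : rat) : (ratr t : algC) \is Num.real by apply: Creal_Crat; apply: Crat_rat.
by apply: rpredD => //; apply: rpredM => //; apply: gtr0_real.
Qed.

Lemma quad_stable x : K x -> K (tau x).
Proof.
apply: (adj_stable QQ_subfield); last by right.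
by move=> y Qy; rewrite (fmorph_QQ _ _ Qy).
Qed.

Lemma quad_norm u : isU K u -> u * tau u = 1 \/ u * tau u = -1.
Proof.
move=> Uu; apply: isU_QQ; have [Ku _ _ _] := Uu.
have [_ Q] := adj_trace_norm _ _ _ tau QQ_subfield Qww (fmorph_QQ _) tauw Ku.
have := isUM sfK _ _ Uu (isU_aut _ _ quad_stable Uu).
by case=> _ A nz A'; split.
Qed.

Lemma exists_unit_gt1 : exists2 u, isU K u & 1 < u.
Proof.
have nsq (x y : int) : x ^+ 2 = n%:Z * y ^+ 2 -> y = 0.
  move=> e; apply/eqP; apply: contra_notT nQw => y0.
  have y0' : (y%:~R : algC) != 0 by rewrite intr_eq0.
  have : (x%:~R / y%:~R) ^+ 2 = w ^+ 2 :> algC.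
    by rewrite expr_div_n -rmorphXn /= e intrM rmorphXn /= mulfK ?expf_neq0 // expr2 ww.
  move/eqP; rewrite eqf_sqr => /orP[] /eqP E.
    by rewrite -E; apply: (sf_div QQ_subfield); apply: (sf_int QQ_subfield).
  rewrite -[w]opprK -E; apply/(sfN QQ_subfield)/(sf_div QQ_subfield); exact: (sf_int QQ_subfield).
have [x [y [y0 E]]] := pell_sol realalg n nsq.
pose u : algC := x%:~R + y%:~R * w.
pose u' : algC := x%:~R - y%:~R * w.
have Aw : w \in Aint by apply: Aint_sqrt; rewrite ww Aint_Cnat ?natr_nat.
have uu' : u * u' = 1.
  have -> : u * u' = x%:~R ^+ 2 - (w * w) * y%:~R ^+ 2 by rewrite /u /u'; ring.
  rewrite ww -[n%:R]/(n%:~R) -!rmorphXn /= -intrM -rmorphB /= E //.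
have nzu : u != 0 by apply: contra_eqN uu' => /eqP->; rewrite mul0r eq_sym oner_eq0.
have u'E : u^-1 = u' by rewrite -[u']mul1r -(mulVf nzu) -mulrA uu' mulr1.
have Uu : isU K u.
  split=> //; rewrite ?u'E /u /u' ?rpredD ?rpredN ?rpredM ?Aint_int //.
  by exists x%:~R, y%:~R; split=> //; apply: (sf_int QQ_subfield).
have ru := quad_real _ (let: And4 h _ _ _ := Uu in h).
have u1 : u != 1.
  apply/eqP=> u1; case: nQw; have -> : w = (1 - x%:~R) / y%:~R.
    by rewrite -[X in X - _]u1 /u addrAC subrr add0r mulrC mulKf ?intr_eq0.
  apply: (sf_div QQ_subfield); last exact: (sf_int QQ_subfield).
  apply: (sfB _ QQ_subfield); last exact: (sf_int QQ_subfield).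
  exact: (sf1 _ QQ_subfield).
have uN1 : u != -1.
  apply/eqP=> u1'; case: nQw; have -> : w = (- 1 - x%:~R) / y%:~R.
    by rewrite -[X in X - _]u1' /u addrAC subrr add0r mulrC mulKf ?intr_eq0.
  apply: (sf_div QQ_subfield); last exact: (sf_int QQ_subfield).
  apply: (sfB _ QQ_subfield); last exact: (sf_int QQ_subfield).
  exact/(sfN QQ_subfield)/(sf1 _ QQ_subfield).
have pos v : isU K v -> 0 < v -> v != 1 -> exists2 u, isU K u & 1 < u.
  move=> Uv v0 v1; have [lt|lt|e] := real_ltgtP (ger0_real ler01) (gtr0_real v0).
  - by exists v.
  - by exists v^-1; [exact: (isUV sfK) | rewrite invf_gt1].
  - by rewrite -e eqxx in v1.
have [u0|u0|u0] := real_ltgtP (ger0_real (lexx 0)) ru; last by rewrite -u0 eqxx in nzu.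
  exact: pos Uu u0 u1.
apply: (pos (- u)); [exact: (isUN sfK)|by rewrite oppr_gt0|].
by rewrite eqr_oppLR.
Qed.

(** Since u^2 has norm 1, this is the trace of u^2, a natural number; it increases with u > 1 and so
    serves as a measure for descent. *)
Let T (u : algC) : nat := Num.truncn (u ^+ 2 + u ^- 2).

Let TE u : isU K u -> (T u)%:R = u ^+ 2 + u ^- 2.
Proof.
move=> Uu; apply: truncnK; have [Ku Au u0 Av] := Uu.
have [Kt At _ _] := isU_aut _ _ quad_stable Uu.
have E : u ^- 2 = tau u ^+ 2.
  have : (u * tau u) ^+ 2 = 1.
    by case: (quad_norm _ Uu) => ->; rewrite ?sqrrN expr1n.
  have u2 : u ^+ 2 != 0 by rewrite expf_neq0.
  by rewrite exprMn => e; apply: (mulfI u2); rewrite e divff.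
rewrite natrEint; apply/andP; split; last first.
  rewrite addr_ge0 ?invr_ge0 //; by rewrite real_exprn_even_ge0 ?quad_real.
apply: Cint_rat_Aint; last by rewrite -exprVn rpredD ?rpredX.
rewrite E -rmorphXn /=.
have [[r ->] _] := adj_trace_norm _ _ _ tau QQ_subfield Qww (fmorph_QQ _) tauw (sfX sfK _ 2 Ku).
exact: Crat_rat.
Qed.

Let ltT u v : isU K u -> isU K v -> 1 < u -> u < v -> (T u < T v)%N.
Proof. by move=> Uu Uv u1 uv; rewrite -(ltr_nat algC) !TE //; apply: lt_sq_inv_sq. Qed.

(** A unit above 1 with least [T] exists; dividing a larger unit by it lowers [T], so every unit
    above 1 is one of its powers. *)
Lemma fund_unit : exists e, [/\ isU K e, 1 < e &
  forall u, isU K u -> exists k : int, u = e ^ k \/ u = - e ^ k].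
Proof.
have [e [Ue e1 emin]] : exists e, [/\ isU K e, 1 < e &
    forall u, isU K u -> 1 < u -> (T e <= T u)%N].
  have [u Uu u1] := exists_unit_gt1.
  have [m lem] : exists m, (T u <= m)%N by exists (T u).
  elim: m u Uu u1 lem => [|m IHm] u Uu u1 lem.
    by exists u; split=> // v _ _; apply: (leq_trans lem).
  have [[v [Uv v1 lv]]|no] := classic (exists v, [/\ isU K v, 1 < v & (T v < T u)%N]).
    by apply: (IHm v Uv v1); rewrite -ltnS; apply: leq_trans lv lem.
  exists u; split=> // v Uv v1; rewrite leqNgt; apply/negP=> lv.
  by apply: no; exists v.
have e0 : 0 < e := lt_trans ltr01 e1.
have eneq0 : e != 0 by rewrite gt_eqF.
have re := quad_real _ (let: And4 h _ _ _ := Ue in h).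
have big u : isU K u -> 1 < u -> exists k : nat, u = e ^+ k.
  have [m] : exists m, (T u <= m)%N by exists (T u).
  elim: m u => [|m IHm] u lem Uu u1.
    have ru := quad_real _ (let: And4 h _ _ _ := Uu in h).
    have [lt|lt|->] := real_ltgtP re ru; last by exists 1%N; rewrite expr1.
      by have := leq_trans (ltT _ _ Ue Uu e1 lt) lem.
    by have := leq_trans (ltT _ _ Uu Ue u1 lt) (leq_trans (emin _ Uu u1) lem).
  have ru := quad_real _ (let: And4 h _ _ _ := Uu in h).
  have [lt|lt|->] := real_ltgtP re ru; last by exists 1%N; rewrite expr1.
    have Uv := isU_div sfK _ _ Uu Ue.
    have v1 : 1 < u / e by rewrite ltr_pdivlMr // mul1r.
    have vu : u / e < u by rewrite ltr_pdivrMr // -[ltLHS]mulr1 ltr_pM2l // (lt_trans ltr01).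
    have [k Dk] := IHm (u / e) (leq_trans (ltT _ _ Uv Uu v1 vu) lem) Uv v1.
    by exists k.+1; rewrite exprSr -Dk divfK.
  by have := leq_trans (ltT _ _ Uu Ue u1 lt) (emin _ Uu u1); rewrite ltnn.
have pos u : isU K u -> 0 < u -> exists k : int, u = e ^ k.
  move=> Uu u0; have ru := gtr0_real u0.
  have [lt|lt|<-] := real_ltgtP (ger0_real ler01) ru; last by exists 0.
    by have [k ->] := big _ Uu lt; exists k.
  have [|k Dk] := big _ (isUV sfK _ Uu); first by rewrite invf_gt1.
  by exists (- k%:Z); rewrite -[u]invrK Dk exprnN.
exists e; split=> // u Uu; have [Ku _ nzu _] := Uu.
have [u0|u0|u0] := real_ltgtP (ger0_real (lexx 0)) (quad_real _ Ku); last by rewrite -u0 eqxx in nzu.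
  by have [k] := pos _ Uu u0; exists k; left.
have [|k Dk] := pos _ (isUN sfK _ Uu); first by rewrite oppr_gt0.
by exists k; right; rewrite -Dk opprK.
Qed.

Let norm_expz e (k : int) : e != 0 -> (e ^ k) * tau (e ^ k) = (e * tau e) ^ k.
Proof. by move=> e0; rewrite rmorphXz ?unitfE // exprzMl ?unitfE ?fmorph_eq0. Qed.

Lemma unit_not_square : exists2 e, isU K e &
  forall v, isU K v -> e <> v * v /\ e <> - (v * v).
Proof.
have [e [Ue e1 gen]] := fund_unit; exists e => // v Uv.
have e0 : 0 < e := lt_trans ltr01 e1.
have [k Dk] := gen _ Uv; have -> : v * v = e ^ (k + k).
  by rewrite expfzDr ?gt_eqF //; case: Dk => ->; rewrite ?mulrNN.
split=> E.
  have P (j : nat) : e ^+ j.+1 != 1 by rewrite gt_eqF // exprn_egt1.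
  have N (z : int) : z != 0 -> e ^ z != 1.
    case: z => [[|j]|j] // _; first exact: P.
    by rewrite NegzE -exprnN invr_eq1; apply: P.
  have /N/eqP[] : k + k - 1 != 0 by lia.
  by rewrite expfzDr ?gt_eqF // -E -exprnN expr1 divff // gt_eqF.
by have := e0; rewrite E oppr_gt0 lt_gtF // exprz_gt0.
Qed.

(** If some unit has norm -1, so has the fundamental one, and then a unit of norm 1 is ± an even
    power of it. *)
Lemma norm1_square u0 : isU K u0 -> u0 * tau u0 = -1 ->
  forall u, isU K u -> u * tau u = 1 ->
  exists2 v, isU K v & u = v * v \/ u = - (v * v).
Proof.
have [e [Ue e1 gen]] := fund_unit; have e0 : e != 0 by rewrite gt_eqF // (lt_trans ltr01).
have par (k : int) : exists h, k = h + h \/ k = h + h + 1.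
  by exists (k %/ 2)%Z; have := divz_eq k 2; have := modz_ge0 k (isT : 2 != 0 :> int);
     have := ltz_mod k (isT : 2 != 0 :> int); lia.
have N1 : -1 != 1 :> algC by rewrite lt_eqF // (lt_trans (ltrN10 _)) ?ltr01.
have nmE u k : u = e ^ k \/ u = - e ^ k -> u * tau u = (e * tau e) ^ k.
  by case=> ->; rewrite ?rmorphN ?mulrNN norm_expz.
move=> U0 n0; have Ne : e * tau e = -1.
  have [k /nmE Dk] := gen _ U0; move: Dk; rewrite n0.
  by case: (quad_norm _ Ue) => -> //; rewrite exp1rz => /eqP; rewrite (negPf N1).
move=> u Uu nu; have [k Dk] := gen _ Uu; have := nmE _ _ Dk; rewrite nu Ne.
have [h [kE|kE]] := par k; last first.
  have nz : -1 != 0 :> algC by rewrite oppr_eq0 oner_eq0.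
  rewrite kE !expfzDr // expr1z -exprzMl ?unitfE // mulrNN mulr1 exp1rz mul1r.
  by move/eqP; rewrite eq_sym (negPf N1).
have Uh : isU K (e ^ h).
  case: (h) => j; first exact: (isUX sfK).
  by rewrite NegzE -exprnN; apply/(isUV sfK)/(isUX sfK).
by move=> _; exists (e ^ h) => //; rewrite -expfzDr // -kE.
Qed.

End FundamentalUnit.

(** * Quadratic residues modulo a prime *)

Lemma Fp_prim_root (p k : nat) : prime p -> (k %| p.-1)%N ->
  exists z : 'F_p, k.-primitive_root z.
Proof.
move=> pp kp; pose rs := [seq x <- enum 'F_p | x != 0].
have p0 : (0 < p.-1)%N by have := prime_gt1 pp; lia.
have rsE : size rs = p.-1.
  have -> : rs = rem 0 (enum 'F_p) by rewrite rem_filter ?enum_uniq //.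
  by rewrite size_rem ?mem_enum // -cardE card_Fp.
have /hasP[z _ pz] : has (p.-1).-primitive_root rs.
  apply: has_prim_root; rewrite ?rsE //; last by rewrite /rs filter_uniq ?enum_uniq.
  apply/allP=> x; rewrite mem_filter => /andP[x0 _].
  apply/unity_rootP; apply: (mulfI x0); rewrite mulr1 -exprS prednK ?prime_gt0 //.
  by have := expf_card x; rewrite card_Fp.
by exists (z ^+ (p.-1 %/ k)); apply: dvdn_prim_root.
Qed.

Lemma Fp_int_eq0 (p : nat) (x : int) : prime p -> ((x%:~R : 'F_p) == 0) = (p%:Z %| x)%Z.
Proof.
move=> pp; have h (n : nat) : ((n%:R : 'F_p) == 0) = (p %| n)%N.
  by rewrite (dvdn_pcharf (pchar_Fp pp)).
case: x => n; first exact: h.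
by rewrite NegzE mulrNz oppr_eq0 dvdzE abszN; exact: h.
Qed.

Lemma Fp_eq_int (p : nat) (x : 'F_p) : x = (val x)%:Z%:~R.
Proof. by rewrite -[RHS]/((val x)%:R); rewrite natr_Zp. Qed.

Lemma sqrt_m1 (p : nat) : prime p -> (p %% 4 = 1)%N ->
  exists z : int, (p%:Z %| z ^+ 2 + 1)%Z.
Proof.
move=> pp p4; have [|z pz] := Fp_prim_root p 4 pp; first by lia.
exists (val z)%:Z; rewrite -Fp_int_eq0 // rmorphD rmorphXn /= -Fp_eq_int.
have z2 : z ^+ 2 != 1 by rewrite -(prim_order_dvd pz).
have : (z ^+ 2 - 1) * (z ^+ 2 + 1) = 0.
  have -> : (z ^+ 2 - 1) * (z ^+ 2 + 1) = z ^+ 4 - 1 by ring.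
  by rewrite (prim_expr_order pz) subrr.
move/eqP; rewrite mulf_eq0 subr_eq0 (negPf z2) => /eqP <-.
by rewrite -[1%:~R]/(1%:R).
Qed.

Lemma sqrt_2 (p : nat) : prime p -> (p %% 8 = 1)%N ->
  exists z : int, (p%:Z %| z ^+ 2 - 2)%Z.
Proof.
move=> pp p8; have [|z pz] := Fp_prim_root p 8 pp; first by lia.
have z4 : z ^+ 4 != 1 by rewrite -(prim_order_dvd pz).
have e4 : z ^+ 4 = -1.
  have : (z ^+ 4 - 1) * (z ^+ 4 + 1) = 0.
    have -> : (z ^+ 4 - 1) * (z ^+ 4 + 1) = z ^+ 8 - 1 by ring.
    by rewrite (prim_expr_order pz) subrr.
  by move/eqP; rewrite mulf_eq0 subr_eq0 (negPf z4) /= addr_eq0 => /eqP.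
(* As z^4 = -1, the element z - z^3 is z + z^-1, the usual square root of 2 in the eighth cyclotomic
   field. *)
have [u uE] : exists u, u = z - z ^+ 3 by exists (z - z ^+ 3).
exists (val u)%:Z; rewrite -Fp_int_eq0 // rmorphB rmorphXn /= -Fp_eq_int.
apply/eqP; rewrite -[2%:~R]/(2%:R) uE.
have -> : (z - z ^+ 3) ^+ 2 - 2 = z ^+ 2 * (1 + z ^+ 4) - 2 * (1 + z ^+ 4) by ring.
by rewrite e4 subrr !mulr0 subrr.
Qed.

Lemma legendre_aniso (a p : nat) (x y : int) : prime p -> legendre a p = -1 ->
  (p%:Z %| x ^+ 2 - a%:Z * y ^+ 2)%Z -> (p%:Z %| y)%Z.
Proof.
move=> pp la; apply: contraTT; rewrite -!Fp_int_eq0 // => y0.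
rewrite rmorphB /= intrM !rmorphXn /= subr_eq0; apply/eqP => e.
move: la; rewrite /legendre; suff -> : qres a p = true by case: ifP.
rewrite /qres.
pose t : 'F_p := x%:~R / y%:~R.
have ltp : (val t < p)%N by apply: (leq_trans (ltn_ord t)); rewrite Fp_cast.
apply/existsP; exists (Ordinal ltp) => /=.
have : t * t = a%:R.
  rewrite -expr2 expr_div_n e mulfK ?expf_neq0 //.
rewrite -[t in LHS]natr_Zp -natrM => /(congr1 (@nat_of_ord _)).
by rewrite !val_Fp_nat // => ->.
Qed.

Lemma legendre_2_1mod8 (p : nat) : prime p -> (p %% 8 = 1)%N -> legendre 2 p <> -1.
Proof.
move=> pp p8 l; have [z hz] := sqrt_2 p pp p8.
have := legendre_aniso 2 p z 1 pp l; rewrite expr1n mulr1 => /(_ hz).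
by rewrite dvdzE /= dvdn1 => /eqP p1; rewrite p1 in pp.
Qed.

(** Scaling [x] by a square root of -1 modulo [p] reduces to [legendre_aniso]. *)
Lemma legendre_aniso_neg (a p : nat) (x y : int) : prime p -> (p %% 4 = 1)%N ->
  legendre a p = -1 -> (p%:Z %| x ^+ 2 + a%:Z * y ^+ 2)%Z -> (p%:Z %| y)%Z.
Proof.
move=> pp p4 la /dvdzP[k hk]; have [z /dvdzP[l hl]] := sqrt_m1 p pp p4.
apply: (legendre_aniso a p (z * x) y pp la); apply/dvdzP.
exists (l * x ^+ 2 - k); rewrite mulrBl -hk.
have -> : l * x ^+ 2 * p = (z ^+ 2 + 1) * x ^+ 2 by rewrite hl; ring.
by ring.
Qed.

Lemma oddz_sqr (x : int) : (x %% 2)%Z = 1 -> exists t : int, x ^+ 2 = 8 * t + 1.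
Proof.
move=> x1; have [h ->] : exists h : int, x = 2 * h + 1 by exists (x %/ 2)%Z; lia.
have [t ht] : exists t : int, h * (h + 1) = 2 * t.
  have [[u ->]|[u ->]] : (exists u : int, h = 2 * u) \/ (exists u : int, h = 2 * u + 1).
  - have : (h %% 2)%Z = 0 \/ (h %% 2)%Z = 1 by lia.
    by case=> ?; [left|right]; exists (h %/ 2)%Z; lia.
  - by exists (u * (2 * u + 1)); ring.
  - by exists ((2 * u + 1) * (u + 1)); ring.
exists t; have -> : (2 * h + 1) ^+ 2 = 4 * (h * (h + 1)) + 1 by ring.
by rewrite ht; ring.
Qed.

(* No solution of [X^2 - d Y^2 = 4 s p] with [d = 2 p q] unless [p = 1 mod 8]. *)
Lemma norm_4p_mod8 (p q : nat) (s X Y : int) : prime p -> prime q -> (p %% 4 = 1)%N ->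
  (q %% 4 = 1)%N -> s = 1 \/ s = -1 ->
  X ^+ 2 - (2 * p * q)%:Z * Y ^+ 2 = 4 * s * p%:Z ->
  (p %% 8 = 1)%N /\ exists x y : int, p%:Z * x ^+ 2 - 2 * q%:Z * y ^+ 2 = s.
Proof.
move=> pp pq p4 q4 s1 E; have p0 : p%:Z != 0 by rewrite eqz_nat; have := prime_gt0 pp; lia.
have /dvdzP[X1 eX] : (p%:Z %| X)%Z.
  have : (p%:Z %| X * X)%Z.
    apply/dvdzP; exists (4 * s + (2 * q)%:Z * Y ^+ 2).
    have -> : X * X = (X ^+ 2 - (2 * p * q)%:Z * Y ^+ 2) + (2 * p * q)%:Z * Y ^+ 2 by ring.
    by rewrite E !PoszM; ring.
  by rewrite !dvdzE abszM /= Euclid_dvdM // orbb.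
have E1 : p%:Z * X1 ^+ 2 - 2 * q%:Z * Y ^+ 2 = 4 * s.
  apply: (mulIf p0); rewrite -E eX !PoszM; ring.
have par (h : int) : (exists u : int, h = 2 * u) \/ (exists u : int, h = 2 * u + 1).
  have : (h %% 2)%Z = 0 \/ (h %% 2)%Z = 1 by lia.
  by case=> ?; [left|right]; exists (h %/ 2)%Z; lia.
have sq8 (u : int) : exists t : int, (2 * u + 1) ^+ 2 = 8 * t + 1 by apply: oddz_sqr; lia.
have [[x ex]|[x ex]] := par X1; last first.
  have [t ht] := sq8 x; move: E1; rewrite ex ht.
  move: (Y ^+ 2) => Y2 E1; exfalso.
  have : p%:Z * (8 * t + 1) = 8 * (p%:Z * t) + p%:Z by ring.
  have : 2 * q%:Z * Y2 = 2 * (q%:Z * Y2) by ring.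
  by move: E1 (p%:Z * t) (q%:Z * Y2); lia.
have [[y ey]|[y ey]] := par Y; last first.
  have [t ht] := sq8 y; move: E1; rewrite ex ey ht exprMn.
  move: (x ^+ 2) => x2 E1; exfalso.
  have : 2 * q%:Z * (8 * t + 1) = 16 * (q%:Z * t) + 2 * q%:Z by ring.
  have : p%:Z * (2 ^+ 2 * x2) = 4 * (p%:Z * x2) by ring.
  by move: E1 (q%:Z * t) (p%:Z * x2); lia.
have E2 : p%:Z * x ^+ 2 - 2 * q%:Z * y ^+ 2 = s.
  by apply: (@mulfI _ (4 : int)) => //; rewrite -E1 ex ey; ring.
split; last by exists x, y.
have [[u eu]|[u eu]] := par x.
  exfalso; move: E2; rewrite eu exprMn.
  have : p%:Z * (2 ^+ 2 * u ^+ 2) = 4 * (p%:Z * u ^+ 2) by ring.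
  have : 2 * q%:Z * y ^+ 2 = 2 * (q%:Z * y ^+ 2) by ring.
  by case: s1 => ->; move: (p%:Z * u ^+ 2) (q%:Z * y ^+ 2); lia.
have [t ht] := sq8 u; move: E2; rewrite eu ht.
have : p%:Z * (8 * t + 1) = 8 * (p%:Z * t) + p%:Z by ring.
have [[v ev]|[v ev]] := par y.
  rewrite ev; have : 2 * q%:Z * (2 * v) ^+ 2 = 8 * (q%:Z * v ^+ 2) by ring.
  by case: s1 => ->; move: (p%:Z * t) (q%:Z * v ^+ 2); lia.
have [t' ht'] := sq8 v; rewrite ev ht'.
have : 2 * q%:Z * (8 * t' + 1) = 16 * (q%:Z * t') + 2 * q%:Z by ring.
by case: s1 => ->; move: (p%:Z * t) (q%:Z * t'); lia.
Qed.

(** * Norm equations excluded by the Legendre conditions *)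

Section Legendre.
Variables p1 p2 : nat.
Hypotheses (pp1 : prime p1) (pp2 : prime p2) (p14 : (p1 %% 4 = 1)%N) (p24 : (p2 %% 4 = 1)%N).
Hypothesis leg : let A := legendre p1 p2 == -1 in
   let B := legendre 2 p1 == -1 in
   let C := legendre 2 p2 == -1 in [|| A && B, A && C | B && C].

(** Among the three symbols two are -1, so 2 is a non-residue modulo p1 or p2. Modulo that prime X^2
    would be ± 2 * 2^2, while -1 is a square. *)
Lemma no_norm_8 (c : nat) (s X Y : int) : s = 1 \/ s = -1 ->
  X ^+ 2 - (c * p1 * p2)%:Z * Y ^+ 2 <> 8 * s.
Proof.
move=> s1 E.
have th p : prime p -> (p %% 4 = 1)%N -> legendre 2 p = -1 ->
    (p%:Z %| (c * p1 * p2)%:Z * Y ^+ 2)%Z -> False.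
  move=> pp p4 l2 /dvdzP[k hk].
  have EX : X ^+ 2 = k * p%:Z + 8 * s by rewrite -E hk; ring.
  have : (p%:Z %| 2)%Z.
    case: s1 => es.
      apply: (legendre_aniso 2 p X 2 pp l2); apply/dvdzP; exists k.
      by rewrite EX es; ring.
    apply: (legendre_aniso_neg 2 p X 2 pp p4 l2); apply/dvdzP; exists k.
    by rewrite EX es; ring.
  by rewrite dvdzE /= => /(dvdn_leq (isT : (0 < 2)%N)); have := prime_gt1 pp; lia.
have d1 : (p1%:Z %| (c * p1 * p2)%:Z * Y ^+ 2)%Z.
  by apply/dvdzP; exists (c%:Z * p2%:Z * Y ^+ 2); rewrite !PoszM; ring.
have d2 : (p2%:Z %| (c * p1 * p2)%:Z * Y ^+ 2)%Z.
  by apply/dvdzP; exists (c%:Z * p1%:Z * Y ^+ 2); rewrite !PoszM; ring.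
by case/or3P: leg => /andP[/eqP l1 /eqP l2]; [apply: (th p1)|apply: (th p2)|apply: (th p1)].
Qed.

(** A solution forces p1 = 1 mod 8, so (2/p1) is not -1 and hence (p1/p2) = -1; but p1 x^2 - 2 p2
    y^2 = ±1 read modulo p2 makes ± p1 a square. *)
Lemma no_norm_4p1 (s X Y : int) : s = 1 \/ s = -1 ->
  X ^+ 2 - (2 * p1 * p2)%:Z * Y ^+ 2 <> 4 * s * p1%:Z.
Proof.
move=> s1 E; have [p8 [x [y e]]] := norm_4p_mod8 _ _ _ _ _ pp1 pp2 p14 p24 s1 E.
have nB := legendre_2_1mod8 _ pp1 p8.
have lA : legendre p1 p2 = -1 by case/or3P: leg => /andP[/eqP l1 /eqP l2].
have : (p2%:Z %| 1)%Z.
  have key : (p1%:Z * x) ^+ 2 - p1%:Z * s = (2 * p1%:Z * y ^+ 2) * p2%:Z by rewrite -e; ring.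
  case: s1 => es.
    apply: (legendre_aniso p1 p2 (p1%:Z * x) 1 pp2 lA); apply/dvdzP.
    by exists (2 * p1%:Z * y ^+ 2); rewrite -key es; ring.
  apply: (legendre_aniso_neg p1 p2 (p1%:Z * x) 1 pp2 p24 lA); apply/dvdzP.
  by exists (2 * p1%:Z * y ^+ 2); rewrite -key es; ring.
by rewrite dvdzE /= dvdn1 => /eqP p1'; move: pp2; rewrite p1'.
Qed.

(** As for p1, with p2 x^2 - 2 p1 y^2 = ±1. Using a square root [z] of 2 modulo p2, the equation
    again makes ± p1 a square modulo p2, so (p1/p2) is used as given and quadratic reciprocity is
    avoided. *)
Lemma no_norm_4p2 (s X Y : int) : s = 1 \/ s = -1 ->
  X ^+ 2 - (2 * p1 * p2)%:Z * Y ^+ 2 <> 4 * s * p2%:Z.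
Proof.
move=> s1; rewrite mulnAC => E.
have [p8 [x [y e]]] := norm_4p_mod8 _ _ _ _ _ pp2 pp1 p24 p14 s1 E.
have nC := legendre_2_1mod8 _ pp2 p8.
have lA : legendre p1 p2 = -1 by case/or3P: leg => /andP[/eqP l1 /eqP l2].
have [z /dvdzP[k hz]] := sqrt_2 _ pp2 p8.
have : (p2%:Z %| 1)%Z.
  have key : (p1%:Z * z * y) ^+ 2 + p1%:Z * s = (p1%:Z ^+ 2 * y ^+ 2 * k + p1%:Z * x ^+ 2) * p2%:Z.
    have -> : (p1%:Z * z * y) ^+ 2 = p1%:Z ^+ 2 * y ^+ 2 * (z ^+ 2 - 2) + 2 * p1%:Z ^+ 2 * y ^+ 2 by ring.
    by rewrite hz -e; ring.
  case: s1 => es.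
    apply: (legendre_aniso_neg p1 p2 (p1%:Z * z * y) 1 pp2 p24 lA); apply/dvdzP.
    by exists (p1%:Z ^+ 2 * y ^+ 2 * k + p1%:Z * x ^+ 2); rewrite -key es; ring.
  apply: (legendre_aniso p1 p2 (p1%:Z * z * y) 1 pp2 lA); apply/dvdzP.
  by exists (p1%:Z ^+ 2 * y ^+ 2 * k + p1%:Z * x ^+ 2); rewrite -key es; ring.
by rewrite dvdzE /= dvdn1 => /eqP p1'; move: pp2; rewrite p1'.
Qed.

End Legendre.

Ltac sf_mem H := repeat first [ assumption | apply (sfX H) | apply (sf_nat H)
  | apply (sf_int H) | apply (sf1 _ H) | apply (sf0 H) | apply (sfM _ H)
  | apply (sfD H) | apply (sfN H) | apply (sfV _ H) ].

(** * Square-free integers and irrationality criteria *)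

(** Square-freeness phrased as radicality, the form in which it passes from a square to its root. *)
Definition sqfree (n : nat) : Prop := forall z : int, (n%:Z %| z * z)%Z -> (n%:Z %| z)%Z.

Lemma sqfree_prime p : prime p -> sqfree p.
Proof. by move=> pp z; rewrite !dvdzE abszM /= Euclid_dvdM // orbb. Qed.

Lemma sqfreeM p n : prime p -> ~~ (p %| n)%N -> sqfree n -> sqfree (p * n).
Proof.
move=> pp pn sn z; rewrite dvdzE /= => h.
have cop : coprime p n by rewrite prime_coprime.
move: h; rewrite dvdzE /= !Gauss_dvd // => /andP[h1 h2].
have /= := sqfree_prime _ pp z; rewrite !dvdzE /= => -> //.
by have /= := sn z; rewrite !dvdzE /= => ->.
Qed.

Lemma nat_square_part (z : nat) : (0 < z)%N ->
  exists q k, [/\ z = (q * (k * k))%N, (0 < k)%N, (0 < q)%N & sqfree q].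
Proof.
elim/ltn_ind: z => z IH z0.
have [[d [d1 dz]]|no] := classic (exists d, (1 < d)%N /\ (d * d %| z)%N).
  have d0 : (0 < d)%N by lia.
  have [w zE] := dvdnP dz.
  have w0 : (0 < w)%N by rewrite zE muln_gt0 in z0; case/andP: z0.
  have [|q [k [wE k0 q0 sq]]] := IH w _ w0.
    by rewrite zE ltn_Pmulr //; nia.
  exists q, (k * d)%N; rewrite muln_gt0 k0 d0; split=> //.
  by rewrite zE wE; ring.
exists z, 1%N; split=> //; first by rewrite !muln1.
move=> x; rewrite !dvdzE abszM /=; set n := absz x => h.
have [n0|n0] := posnP n; first by rewrite n0 dvdn0.
(* With z = a g and n = b g for the gcd g, the divisibility z | n^2 forces a | g, so a^2 | z and a =
   1. *)
have g0 : (0 < gcdn z n)%N by rewrite gcdn_gt0 z0.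
have [/dvdnP[a ea] /dvdnP[b eb]] := (dvdn_gcdl z n, dvdn_gcdr z n).
have cab : coprime a b.
  by rewrite /coprime -(eqn_pmul2r g0) muln_gcdl -ea -eb mul1n.
set g := gcdn z n in g0 ea eb cab.
have ag : (a %| g)%N.
  have : (g * a %| g * (g * (b * b)))%N.
    by have -> : (g * a = z)%N; [lia|have -> : (g * (g * (b * b)) = n * n)%N by rewrite eb; ring].
  by rewrite dvdn_pmul2l // Gauss_dvdl // coprimeMr cab.
have a1 : a = 1%N.
  apply/eqP; apply: contra_notT no => a1; exists a; split.
    by rewrite ltn_neqAle eq_sym a1 /=; case: (a) ea z0 => // ->.
  by rewrite ea dvdn_mul.
have -> : z = g by rewrite ea a1 mul1n.
exact: dvdn_gcdr.
Qed.

Lemma prime_dvd_split (p n q : nat) : prime p -> (q %| p * n)%N ->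
  (q %| n)%N \/ exists2 q', q = (p * q')%N & (q' %| n)%N.
Proof.
move=> pp h; have [pq|pq] := boolP (p %| q)%N; last first.
  by left; rewrite -(@Gauss_dvdr q p) // coprime_sym prime_coprime.
right; have [q' qE] := dvdnP pq; exists q'; first by rewrite qE mulnC.
by move: h; rewrite qE mulnC dvdn_pmul2l ?prime_gt0.
Qed.

Lemma dvdz_Aint (q : nat) (z : int) : (0 < q)%N -> (z%:~R / q%:R : algC) \in Aint ->
  (q%:Z %| z)%Z.
Proof.
move=> q0 A; have [|y] := QQ_Aint _ _ A.
  by apply: (sf_div QQ_subfield); [apply: (sf_int QQ_subfield)|apply: (sf_nat QQ_subfield)].
have nz : (q%:R : algC) != 0 by rewrite pnatr_eq0; lia.
move/(canRL (divfK nz)); rewrite -[q%:R]/(q%:~R) -intrM => /eqP.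
by rewrite eqr_int => /eqP ->; rewrite dvdz_mull.
Qed.

Lemma nQQ_prime (a : algC) (z : int) (p : nat) : a * a = z%:~R -> prime p ->
  (p%:Z %| z)%Z -> ~~ (p%:Z * p%:Z %| z)%Z -> ~ QQ a.
Proof.
move=> aa pp pz ppz Qa; have [|k ak] := QQ_Aint a Qa.
  by apply: Aint_sqrt; rewrite aa Aint_int.
have zE : z = k * k by apply/eqP; rewrite -(eqr_int algC) intrM -ak aa.
case/negP: ppz; have : (p%:Z %| k)%Z by apply: (sqfree_prime p pp); rewrite -zE.
by move=> pk; rewrite zE dvdz_mul.
Qed.

Lemma nQQ_neg (a : algC) : a * a < 0 -> ~ QQ a.
Proof.
by move=> a0 [r ar]; move: a0; rewrite ar -expr2 -rmorphXn /= ltrq0 ltNge sqr_ge0.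
Qed.

(** * Complex conjugation and the Galois setting *)

Notation cj := (Num.conj : {rmorphism algC -> algC}).

Lemma cjE x : cj x = x^*. Proof. by []. Qed.
Lemma ii : 'i * 'i = -1 :> algC. Proof. by rewrite -expr2 sqrCi. Qed.
Lemma cj_i : cj 'i = - 'i. Proof. exact: conjCi. Qed.
Lemma i_neq0 : 'i != 0 :> algC. Proof. exact: neq0Ci. Qed.
Lemma sq_sq n : sq n * sq n = n%:R. Proof. by rewrite -expr2 sqrtCK. Qed.
Lemma sq_ge0 n : 0 <= sq n. Proof. by rewrite sqrtC_ge0 ler0n. Qed.
Lemma cj_sq n : cj (sq n) = sq n.
Proof. by rewrite cjE conj_Creal // ger0_real // sq_ge0. Qed.
Lemma sqM a b : sq (a * b) = sq a * sq b.
Proof. by rewrite /sq natrM sqrtCM // nnegrE ler0n. Qed.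

(** [s] and [t] act on all of [algC]; on K3 they generate the Galois group over Q('i), and together
    with complex conjugation the one over Q. *)
Record setting (p1 p2 : nat) (s t : {rmorphism algC -> algC}) : Prop := Setting {
  pr1 : prime p1; pr2 : prime p2;
  p14 : (p1 %% 4 = 1)%N; p24 : (p2 %% 4 = 1)%N; p12 : p1 != p2;
  leg : let A := legendre p1 p2 == -1 in
   let B := legendre 2 p1 == -1 in
   let C := legendre 2 p2 == -1 in [|| A && B, A && C | B && C];
  s_r2 : s (sq 2) = - sq 2; s_rm : s (sq (p1 * p2)) = sq (p1 * p2); s_i : s 'i = 'i;
  t_r2 : t (sq 2) = sq 2; t_rm : t (sq (p1 * p2)) = - sq (p1 * p2); t_i : t 'i = 'i }.

Lemma nQQ_2 (a : algC) (c : nat) : a * a = (2 * c)%:R -> odd c -> ~ QQ a.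
Proof.
move=> aa oc; apply: (nQQ_prime a (2 * c)%N 2) => //; rewrite dvdzE /=; lia.
Qed.

Section NonSquare.
Variables p1 p2 : nat.
Hypotheses (pp1 : prime p1) (pp2 : prime p2) (p14 : (p1 %% 4 = 1)%N)
  (p24 : (p2 %% 4 = 1)%N) (p12 : p1 != p2).

Lemma nQQ_p1 (a : algC) (c : nat) : a * a = (c * (p1 * p2))%:R -> ~~ (p1 %| c)%N -> ~ QQ a.
Proof.
move=> aa pc; apply: (nQQ_prime a (c * (p1 * p2))%N p1) => //.
  by rewrite dvdzE /=; apply/dvdnP; exists (c * p2)%N; ring.
rewrite dvdzE abszM /= mulnCA dvdn_pmul2l ?prime_gt0 // Euclid_dvdM // (negPf pc) /=.
by rewrite dvdn_prime2.
Qed.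

Lemma setting_exists : (let A := legendre p1 p2 == -1 in
   let B := legendre 2 p1 == -1 in
   let C := legendre 2 p2 == -1 in [|| A && B, A && C | B && C]) ->
  exists s t, setting p1 p2 s t.
Proof.
move=> leg; have odd12 : odd (p1 * p2) by rewrite oddM; lia.
have n1 : ~~ (p1 %| 1)%N by rewrite dvdn1; apply: contraTneq pp1 => ->.
have n2 : ~~ (p1 %| 2)%N by rewrite gtnNdvd //; have := prime_gt1 pp1; lia.
have m0 : (0 < p1 * p2)%N by rewrite muln_gt0 !prime_gt0.
have Q x n : x * x = n%:R -> QQ (x * x) by move=> ->; apply: (sf_nat QQ_subfield).
have Qi : QQ ('i * 'i) by rewrite ii; apply: (sfN QQ_subfield); apply: (sf1 _ QQ_subfield).
have neg (a : algC) n : a * a = n%:R -> (0 < n)%N -> ~ QQ (a * 'i).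
  by move=> aa n0; apply: nQQ_neg; rewrite mulrACA aa ii mulrN1 oppr_lt0 ltr0n.
have h2 := sq_sq 2; have hm := sq_sq (p1 * p2).
have hd : sq 2 * sq (p1 * p2) * (sq 2 * sq (p1 * p2)) = (2 * (p1 * p2))%:R.
  by rewrite mulrACA h2 hm -natrM.
have hd' : sq (p1 * p2) * sq 2 * (sq (p1 * p2) * sq 2) = (2 * (p1 * p2))%:R.
  by rewrite mulrACA h2 hm -natrM mulnC.
have nm : ~ QQ (sq (p1 * p2)) by apply: (nQQ_p1 _ 1) n1; rewrite mul1n.
have nr2 : ~ QQ (sq 2) by apply: (nQQ_2 _ 1).
have [|s [s1 s2 s3]] := quad_conj (sq 2) (sq (p1 * p2)) 'i (Q _ _ h2) (Q _ _ hm) Qi.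
  apply: notin_biquad => //; try exact: Q _ h2; try exact: Q _ hm.
  - exact: nQQ_2 _ _ hd odd12.
  - exact: neg _ _ h2 _.
  - by apply: (neg _ _ hd); rewrite muln_gt0.
have [|t [t1 t2 t3]] := quad_conj (sq (p1 * p2)) (sq 2) 'i (Q _ _ hm) (Q _ _ h2) Qi.
  apply: notin_biquad => //; try exact: Q _ h2; try exact: Q _ hm.
  - exact: nQQ_2 _ _ hd' odd12.
  - exact: neg _ _ hm _.
  - by apply: (neg _ _ hd'); rewrite muln_gt0.
by exists s, t; split.
Qed.

End NonSquare.

(** * Ideal arithmetic in a subring of [algC] *)

Lemma ideal_ext (I J : algC -> Prop) : ideal_eq I J -> I = J.
Proof. by move=> e; apply: functional_extensionality => x; apply: propositional_extensionality; apply: e. Qed.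

Record subring (O : algC -> Prop) : Prop := Subring {
  sr1 : O 1; srB : forall x y, O x -> O y -> O (x - y);
  srM : forall x y, O x -> O y -> O (x * y) }.

Section Ideals.
Variable O : algC -> Prop.
Hypothesis sO : subring O.
Implicit Types I J K : algC -> Prop.

Lemma sr0 : O 0. Proof. by rewrite -(subrr 1); apply: (srB _ sO); apply: (sr1 _ sO). Qed.
Lemma srN x : O x -> O (- x).
Proof. by move=> Ox; rewrite -sub0r; apply: (srB _ sO) => //; apply: sr0. Qed.
Lemma srD x y : O x -> O y -> O (x + y).
Proof. by move=> Ox Oy; rewrite -[y]opprK; apply: (srB _ sO) => //; apply: srN. Qed.

Lemma submod_self : submod O O.
Proof. by split=> //; [exact: sr0|exact: srD|exact: (srM _ sO)]. Qed.

Lemma gen_in S x : S x -> gen O S x. Proof. by move=> Sx J _; apply. Qed.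

Lemma gen_min S J x : submod O J -> (forall s, S s -> J s) -> gen O S x -> J x.
Proof. by move=> sJ SJ; apply. Qed.

Lemma gen_submod S : (forall x, S x -> O x) -> submod O (gen O S).
Proof.
move=> SO; split.
- by move=> x; apply: gen_min submod_self SO.
- by move=> J [].
- by move=> x y gx gy J sJ SJ; have [_ _ h _] := sJ; apply: h; [exact: gx|exact: gy].
- by move=> a x Oa gx J sJ SJ; have [_ _ _ h] := sJ; apply: h => //; exact: gx.
Qed.

Lemma idmul_in I J x y : I x -> J y -> idmul O I J (x * y).
Proof. by move=> Ix Jy; apply: gen_in; exists x, y. Qed.

Lemma idmul_min I J K z : submod O K -> (forall x y, I x -> J y -> K (x * y)) ->
  idmul O I J z -> K z.
Proof. by move=> sK h; apply: gen_min => // _ [x [y [Ix Jy ->]]]; apply: h. Qed.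

Lemma idmul_submod I J : submod O I -> submod O J -> submod O (idmul O I J).
Proof.
move=> [IO _ _ _] [JO _ _ _]; apply: gen_submod => _ [x [y [Ix Jy ->]]].
by apply: (srM _ sO); [apply: IO|apply: JO].
Qed.

Lemma idmulC I J : idmul O I J = idmul O J I.
Proof.
apply: ideal_ext => x; split=> h K sK SK; apply: h => // _ [y [z [Iy Jz ->]]];
by apply: SK; exists z, y; split=> //; rewrite mulrC.
Qed.

(** Since [gen] is defined by minimality, a statement about products is proved one factor at a time;
    the colon module holds the other factor [y] fixed. *)
Lemma colon_submod K y : submod O K -> O y -> submod O (fun x => O x /\ K (x * y)).
Proof.
move=> [_ K0 KD KM] Oy; split.
- by move=> x [].
- by split; [exact: sr0|rewrite mul0r].
- by move=> x z [Ox Kx] [Oz Kz]; split; [exact: srD|rewrite mulrDl; apply: KD].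
- by move=> a x Oa [Ox Kx]; split; [apply: (srM _ sO)|rewrite -mulrA; apply: KM].
Qed.

Lemma idmulA I J K : submod O I -> submod O J -> submod O K ->
  idmul O (idmul O I J) K = idmul O I (idmul O J K).
Proof.
move=> sI sJ sK.
have half A B C : submod O A -> submod O B -> submod O C ->
    forall z, idmul O (idmul O A B) C z -> idmul O A (idmul O B C) z.
  move=> sA sB sC z; have sBC := idmul_submod _ _ sB sC.
  apply: idmul_min; first exact: idmul_submod.
  move=> x y ABx Cy; have Oy : O y by case: sC => h _ _ _; apply: h.
  have [] // : O x /\ idmul O A (idmul O B C) (x * y).
  apply: (idmul_min A B (fun x => O x /\ idmul O A (idmul O B C) (x * y))) ABx.
    by apply: colon_submod => //; apply: idmul_submod.
  move=> a b Aa Bb; split.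
    by case: sA sB => hA _ _ _ [hB _ _ _]; apply: (srM _ sO); [exact: hA|exact: hB].
  by rewrite -mulrA; apply: idmul_in => //; apply: idmul_in.
apply: ideal_ext => z; split; first exact: half.
rewrite (idmulC I (idmul O J K)) (idmulC J K) (idmulC (idmul O I J) K) (idmulC I J).
exact: half.
Qed.

Lemma idmul1 I : submod O I -> idmul O O I = I.
Proof.
move=> sI; have [_ _ _ IM] := sI; apply: ideal_ext => z; split.
  by apply: idmul_min => // x y; apply: IM.
by move=> Iz; rewrite -[z]mul1r; apply: idmul_in => //; apply: (sr1 _ sO).
Qed.

Lemma idmulI1 I : submod O I -> idmul O I O = I.
Proof. by rewrite idmulC; apply: idmul1. Qed.

Lemma idexp_submod I n : submod O I -> submod O (idexp O I n).
Proof. by move=> sI; elim: n => [|n IHn]; [exact: submod_self|exact: idmul_submod]. Qed.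

Lemma princ_submod a : O a -> submod O (princ O a).
Proof.
move=> Oa; split.
- by move=> _ [b [Ob ->]]; apply: (srM _ sO).
- by exists 0; split; [exact: sr0|rewrite mulr0].
- by move=> _ _ [b [Ob ->]] [c [Oc ->]]; exists (b + c); split; [exact: srD|rewrite mulrDr].
- by move=> c _ Oc [b [Ob ->]]; exists (c * b); split; [exact: (srM _ sO)|rewrite mulrCA].
Qed.

Lemma princ_self a : princ O a a.
Proof. by exists 1; split; [exact: (sr1 _ sO)|rewrite mulr1]. Qed.

Lemma princ1 : princ O 1 = O.
Proof.
apply: ideal_ext => x; split=> [[b [Ob ->]]|Ox]; first by rewrite mul1r.
by exists x; rewrite mul1r.
Qed.

Lemma idmul_princ a I x : O a -> submod O I ->
  idmul O (princ O a) I x <-> exists y, I y /\ x = a * y.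
Proof.
move=> Oa [IO I0 ID IM]; split; last first.
  by case=> y [Iy ->]; apply: idmul_in => //; apply: princ_self.
apply: (idmul_min _ _ (fun x => exists y, I y /\ x = a * y)).
  split.
  - by move=> _ [y [Iy ->]]; apply: (srM _ sO) => //; apply: IO.
  - by exists 0; rewrite mulr0.
  - by move=> _ _ [y [Iy ->]] [z [Iz ->]]; exists (y + z); rewrite mulrDr; split=> //; apply: ID.
  - by move=> c _ Oc [y [Iy ->]]; exists (c * y); rewrite mulrCA; split=> //; apply: IM.
move=> _ z [b [Ob ->]] Iz; exists (b * z); rewrite mulrA; split=> //; exact: IM.
Qed.

Lemma princM a b : O a -> O b -> idmul O (princ O a) (princ O b) = princ O (a * b).
Proof.
move=> Oa Ob; apply: ideal_ext => x; rewrite idmul_princ //; last exact: princ_submod.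
split=> [[_ [[c [Oc ->]] ->]]|[c [Oc ->]]]; first by exists c; rewrite mulrA.
by exists (b * c); rewrite mulrA; split=> //; exists c.
Qed.

Lemma princ_unit a u : O u -> O u^-1 -> u != 0 -> princ O (a * u) = princ O a.
Proof.
move=> Ou Ov u0; apply: ideal_ext => x; split=> -[b [Ob ->]].
  by exists (u * b); rewrite mulrA; split=> //; apply: (srM _ sO).
by exists (u^-1 * b); rewrite -mulrA mulVKf //; split=> //; apply: (srM _ sO).
Qed.

Lemma scale_princ a d J : O a -> a != 0 -> submod O J ->
  idmul O (princ O a) J = princ O d -> exists2 y, J y & d = a * y /\ J = princ O y.
Proof.
move=> Oa a0 sJ e; have [_ _ _ JM] := sJ.
have : idmul O (princ O a) J d by rewrite e; apply: princ_self.
rewrite idmul_princ // => -[y [Jy dE]]; exists y => //; split=> //.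
apply: ideal_ext => x; split=> [Jx|[b [Ob ->]]]; last by rewrite mulrC; apply: JM.
have : idmul O (princ O a) J (a * x) by apply/idmul_princ => //; exists x.
rewrite e => -[b [Ob h]]; exists b; split=> //.
by apply: (mulfI a0); rewrite h dE mulrA.
Qed.

Lemma same_classP I J : submod O I -> submod O J -> same_class O I J <->
  exists a b, [/\ O a, O b, a != 0, b != 0 & idmul O (princ O a) I = idmul O (princ O b) J].
Proof.
move=> sI sJ; split=> -[a [b [Oa Ob a0 b0 e]]]; exists a, b; split=> //.
  by apply: ideal_ext => x; rewrite !idmul_princ.
by move=> x; rewrite -!idmul_princ // e.
Qed.

End Ideals.

(** * Rings of integers; extension and contraction of ideals in a quadratic extension *)

Definition OO (K : algC -> Prop) (x : algC) : Prop := K x /\ x \in Aint.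

Lemma OO_subring K : subfield K -> subring (OO K).
Proof.
move=> sK; split.
- by split; [exact: (sf1 _ sK)|exact: Aint1].
- by move=> x y [Kx Ax] [Ky Ay]; split; [exact: (sfB _ sK)|exact: rpredB].
- by move=> x y [Kx Ax] [Ky Ay]; split; [exact: (sfM _ sK)|exact: rpredM].
Qed.

Lemma isU_OO K u : isU K u -> [/\ OO K u, u != 0 & K u^-1 -> OO K u^-1].
Proof. by case=> *; split. Qed.

Lemma princ_isU K a u : subfield K -> isU K u -> princ (OO K) (a * u) = princ (OO K) a.
Proof.
move=> sK Uu; have [Ku Au u0 Av] := Uu; have [Kv _ _ _] := isUV sK _ Uu.
by apply: princ_unit => //; exact: OO_subring.
Qed.

Section Extension.
Variables (k L : algC -> Prop) (sg : {rmorphism algC -> algC}).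
Hypotheses (sk : subfield k) (sL : subfield L) (kL : forall x, k x -> L x).
Hypotheses (sgk : forall x, k x -> sg x = x) (Lsg : forall x, L x -> L (sg x))
  (sgsg : forall x, L x -> sg (sg x) = x) (fixk : forall x, L x -> sg x = x -> k x).
Let Ok := OO k.
Let OL := OO L.
Let rk : subring Ok := OO_subring _ sk.
Let rL : subring OL := OO_subring _ sL.
Let OkL x : Ok x -> OL x. Proof. by move=> [kx Ax]; split=> //; apply: kL. Qed.
Implicit Types I J M : algC -> Prop.

Let inter_submod K : submod OL K -> submod Ok (fun x => Ok x /\ K x).
Proof.
move=> [KO K0 KD KM]; split.
- by move=> x [].
- by split; [exact: (sr0 _ rk)|].
- by move=> x y [Ox Kx] [Oy Ky]; split; [exact: (srD _ rk)|exact: KD].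
- by move=> a x Oa [Ox Kx]; split; [exact: (srM _ rk)|apply: KM => //; exact: OkL].
Qed.

Lemma ext_submod I : submod Ok I -> submod OL (gen OL I).
Proof. by move=> [IO _ _ _]; apply: (gen_submod _ rL) => x /IO; apply: OkL. Qed.

Lemma extM I J : submod Ok I -> submod Ok J ->
  gen OL (idmul Ok I J) = idmul OL (gen OL I) (gen OL J).
Proof.
move=> sI sJ; have sEI := ext_submod _ sI; have sEJ := ext_submod _ sJ.
have sIJ := idmul_submod _ rk _ _ sI sJ.
have sR := idmul_submod _ rL _ _ sEI sEJ.
have [IO _ _ _] := sI; have [JO _ _ _] := sJ; have [EIO _ _ _] := sEI.
apply: ideal_ext => z; split.
  apply: gen_min => // x IJx; have [] // : Ok x /\ idmul OL (gen OL I) (gen OL J) x.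
  apply: (idmul_min Ok I J (fun x => Ok x /\ idmul OL (gen OL I) (gen OL J) x)) IJx.
    exact: inter_submod.
  move=> a b Ia Jb; split; first by apply: (srM _ rk); [exact: IO|exact: JO].
  by apply: idmul_in; apply: gen_in.
apply: idmul_min; first exact: ext_submod.
have sE := ext_submod _ sIJ.
move=> x y EIx EJy; have Oy : OL y by case: sEJ => h _ _ _; apply: h.
have [] // : OL x /\ gen OL (idmul Ok I J) (x * y).
apply: (gen_min OL I (fun x => OL x /\ gen OL (idmul Ok I J) (x * y))) EIx.
  exact: (colon_submod _ rL).
move=> a Ia; split; first by apply/OkL/IO.
have [] // : OL y /\ gen OL (idmul Ok I J) (y * a).
  apply: (gen_min OL J (fun y => OL y /\ gen OL (idmul Ok I J) (y * a))) EJy.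
    by apply: (colon_submod _ rL) => //; apply/OkL/IO.
  move=> b Jb; split; first by apply/OkL/JO.
  by rewrite mulrC; apply: gen_in; apply: idmul_in.
by rewrite mulrC.
Qed.

Lemma ext_princ a : Ok a -> gen OL (princ Ok a) = princ OL a.
Proof.
move=> Oa; have sP := princ_submod _ rL a (OkL _ Oa); have [_ _ _ PM] := sP.
apply: ideal_ext => z; split.
  by apply: gen_min => // _ [b [Ob ->]]; exists b; split=> //; apply: OkL.
have [_ _ _ GM] := ext_submod _ (princ_submod _ rk a Oa).
move=> [b [Ob ->]]; rewrite mulrC; apply: GM => //.
by apply: gen_in; apply: (princ_self _ rk).
Qed.

Lemma ext_O : gen OL Ok = OL.
Proof. by rewrite -{1}(princ1 Ok) ext_princ ?(princ1 OL) //; exact: (sr1 _ rk). Qed.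

(** For x in [J] the square of x/g is integral, so [J] lies in (g). Conversely, in each product x y
    of elements of [J] one factor can be divided by g, which shows that g^2 lies in g J. *)
Lemma princ_sqrt J g : submod OL J -> L g -> g != 0 ->
  idmul OL J J = princ OL (g * g) -> J = princ OL g.
Proof.
move=> sJ Lg g0 e; have [JO J0 JD JM] := sJ.
have dv x : J x -> OL (x / g).
  move=> Jx; have [Lx Ax] := JO _ Jx.
  split; first exact: (sf_div sL).
  have : idmul OL J J (x * x) by apply: idmul_in.
  rewrite e => -[b [[Lb Ab] xx]]; apply: Aint_sqrt.
  have -> : x / g * (x / g) = x * x / (g * g) by field.
  by rewrite xx mulrC mulKf ?mulf_neq0.
have Jg : J g.
  have sK : submod OL (fun w => exists2 z, J z & OL (z * g) /\ w = g * z).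
    split.
    - by move=> _ [z Jz [Oz ->]]; rewrite mulrC.
    - by exists 0 => //; rewrite mul0r mulr0; split=> //; exact: (sr0 _ rL).
    - move=> _ _ [z Jz [Oz ->]] [w Jw [Ow ->]]; exists (z + w); first exact: JD.
      by rewrite mulrDl mulrDr; split=> //; apply: (srD _ rL).
    - move=> a _ Oa [z Jz [Oz ->]]; exists (a * z); first exact: JM.
      by rewrite mulrCA -mulrA; split=> //; apply: (srM _ rL).
  have : exists2 z, J z & OL (z * g) /\ g * g = g * z.
    apply: (idmul_min OL J J _ _ sK); last by rewrite e; apply: (princ_self _ rL).
    move=> x y Jx Jy; exists (x * (y / g)).
      by rewrite mulrC; apply: JM => //; apply: dv.
    split; last by field.
    have -> : x * (y / g) * g = x * y by field.
    by apply: (srM _ rL); apply: JO.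
  by case=> z Jz [_ /(mulfI g0) ->].
apply: ideal_ext => x; split=> [Jx|[b [Ob ->]]].
  by exists (x / g); split; [exact: dv|rewrite mulrC divfK].
by rewrite mulrC; apply: JM.
Qed.

Lemma Ok_trace y : OL y -> Ok (y + sg y).
Proof.
move=> [Ly Ay]; split; last by rewrite rpredD // Aint_aut.
apply: fixk; first by apply: (sfD sL) => //; apply: Lsg.
by rewrite rmorphD /= sgsg // addrC.
Qed.

Lemma Ok_norm y : OL y -> Ok (y * sg y).
Proof.
move=> [Ly Ay]; split; last by rewrite rpredM // Aint_aut.
apply: fixk; first by apply: (sfM _ sL) => //; apply: Lsg.
by rewrite rmorphM /= sgsg // mulrC.
Qed.

Lemma OL_sg y : OL y -> OL (sg y).
Proof. by move=> [Ly Ay]; split; [exact: Lsg|rewrite Aint_aut]. Qed.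

(* Contraction: writing [c] as a combination of elements of [M] with
   coefficients in [OL], its relative norm is quadratic in those elements. *)
Lemma contract M c : submod Ok M -> k c -> c != 0 -> gen OL M = princ OL c -> M = princ Ok c.
Proof.
move=> sM kc c0 e; have [MO M0 MD MM] := sM.
have sub x : M x -> Ok (x / c).
  move=> Mx; have : gen OL M x by apply: gen_in.
  rewrite e => -[b [[Lb Ab] xE]]; have [kx Ax] := MO _ Mx.
  split; first exact: (sf_div sk).
  by rewrite xE mulrC mulKf.
(* The norm of a sum differs from the sum of the norms by a trace, which the last clause controls,
   so [J] is an [OL]-module. It contains [M], hence [c], and the third clause at [c] says that [c]
   is in [M]. *)
pose J x := [/\ OL x, OL (x / c), M (x * sg x / c) & forall y, OL y -> M (x * y + sg (x * y))].
have sJ : submod OL J.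
  split.
  - by move=> x [].
  - split; rewrite ?mul0r //; try exact: (sr0 _ rL).
    by move=> y _; rewrite mul0r rmorph0 addr0.
  - move=> x y [Ox Oxc Nx Tx] [Oy Oyc Ny Ty]; split.
    + exact: (srD _ rL).
    + by rewrite mulrDl; apply: (srD _ rL).
    + have -> : (x + y) * sg (x + y) / c =
        x * sg x / c + y * sg y / c + (x * sg (y / c) + sg (x * sg (y / c))).
        have sc := sgk _ kc; have sy : sg (sg y) = y by apply: sgsg; case: Oy.
        have e1 : sg (y / c) = sg y / c by rewrite rmorphM fmorphV /= sc.
        rewrite e1 (rmorphM sg x) (rmorphM sg (sg y)) (fmorphV sg) sc sy (rmorphD sg).
        by field.
      by apply: (MD); [exact: MD|apply: Tx; apply: OL_sg].
    + move=> z Oz; have -> : (x + y) * z + sg ((x + y) * z) = (x * z + sg (x * z)) + (y * z + sg (y * z)).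
        by rewrite !mulrDl rmorphD /=; ring.
      by apply: MD; [exact: Tx|exact: Ty].
  - move=> a x Oa [Ox Oxc Nx Tx]; split.
    + exact: (srM _ rL).
    + by rewrite -mulrA; apply: (srM _ rL).
    + have -> : a * x * sg (a * x) / c = (a * sg a) * (x * sg x / c) by rewrite rmorphM /=; ring.
      by apply: MM => //; apply: Ok_norm.
    + move=> z Oz; rewrite -mulrA mulrCA; apply: Tx; exact: (srM _ rL).
have [] : J c.
  apply: (gen_min OL M J c sJ); last by rewrite e; apply: (princ_self _ rL).
  move=> x Mx; have Okx := MO _ Mx; have sgx : sg x = x by apply: sgk; case: Okx.
  split; [exact: OkL|by apply/OkL/sub| |].
    by rewrite sgx -mulrA mulrC; apply: MM => //; apply: sub.
  move=> y Oy; rewrite rmorphM /= sgx -mulrDr mulrC; apply: MM => //; exact: Ok_trace.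
move=> _ _; rewrite sgk // mulfK // => Mc _.
apply: ideal_ext => x; split=> [Mx|[b [Ob ->]]].
  by exists (x / c); split; [exact: sub|rewrite mulrC divfK].
by rewrite mulrC; apply: MM.
Qed.

(** The extended ideal is stable under [sg], so [sg a = a * b] with [b] integral; applying [sg]
    again gives [b * sg b = 1]. *)
Lemma cap_unit I a : submod Ok I -> a != 0 -> gen OL I = princ OL a -> L a /\ isU L (a / sg a).
Proof.
move=> sI a0 e; have sE := ext_submod _ sI; have [EO E0 ED EM] := sE.
have Ea : gen OL I a by rewrite e; apply: (princ_self _ rL).
have [La Aa] := EO _ Ea; split=> //.
have stable x : gen OL I x -> gen OL I (sg x).
  move=> Ex; have [] // : OL x /\ gen OL I (sg x).
  apply: (gen_min OL I (fun x => OL x /\ gen OL I (sg x))) Ex.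
    split.
    - by move=> y [].
    - by rewrite rmorph0; split=> //; exact: (sr0 _ rL).
    - by move=> y z [Oy gy] [Oz gz]; rewrite rmorphD; split; [exact: (srD _ rL)|exact: ED].
    - move=> b y Ob [Oy gy]; rewrite rmorphM; split; first exact: (srM _ rL).
      by apply: EM => //; apply: OL_sg.
  move=> y Iy; have [IO _ _ _] := sI; have Oy := IO _ Iy.
  split; first exact: OkL.
  by rewrite sgk; [exact: gen_in|case: Oy].
have := stable _ Ea; rewrite e => -[b [[Lb Ab] sE']].
have s0 : sg a != 0 by rewrite fmorph_eq0.
have bb : b * sg b = 1.
  apply: (mulfI a0); rewrite mulr1 mulrA -sE' -rmorphM /= -sE'; exact: sgsg.
have b0 : b != 0 by apply: contra_eqN bb => /eqP ->; rewrite mul0r eq_sym oner_eq0.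
have -> : a / sg a = sg b.
  by rewrite sE'; apply: (mulfI (mulf_neq0 a0 b0)); rewrite mulrC divfK ?mulf_neq0 // -mulrA bb mulr1.
split; [exact: Lsg|by rewrite Aint_aut|by rewrite fmorph_eq0|].
have -> : (sg b)^-1 = b.
  by apply: (mulIf (_ : sg b != 0)); rewrite ?mulVf ?fmorph_eq0.
by [].
Qed.

End Extension.

Lemma sqr_pm (x y : algC) : x * x = y * y -> x = y \/ x = - y.
Proof. by rewrite -!expr2 => /eqP; rewrite eqf_sqr => /orP[]/eqP; [left|right]. Qed.

(** * The subfields of K3 *)

Section Fields.
Variables (p1 p2 : nat) (s t : {rmorphism algC -> algC}).
Hypothesis S : setting p1 p2 s t.

Notation m := (p1 * p2)%N.
Notation r2 := (sq 2).
Notation rm := (sq (p1 * p2)).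
Notation rd := (sq 2 * sq (p1 * p2)).
Notation Q2 := (adj QQ r2).
Notation Qm := (adj QQ rm).
Notation Qd := (adj QQ rd).
Notation Qi := (adj QQ 'i).
Notation F := (adj (adj QQ r2) rm).
Notation L := (adj (adj (adj QQ r2) rm) 'i).
Notation k := (adj (adj QQ 'i) rd).

Let pp1 := pr1 _ _ _ _ S.
Let pp2 := pr2 _ _ _ _ S.

Lemma s_rd : s rd = - rd. Proof. by rewrite rmorphM /= (s_r2 _ _ _ _ S) (s_rm _ _ _ _ S) mulNr. Qed.
Lemma t_rd : t rd = - rd. Proof. by rewrite rmorphM /= (t_r2 _ _ _ _ S) (t_rm _ _ _ _ S) mulrN. Qed.
Lemma rd_rd : rd * rd = (2 * m)%:R. Proof. by rewrite mulrACA !sq_sq -natrM. Qed.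

Lemma m_gt0 : (0 < m)%N. Proof. by rewrite muln_gt0 !prime_gt0. Qed.
Lemma r2_gt0 : 0 < r2. Proof. by rewrite sqrtC_gt0 ltr0n. Qed.
Lemma rm_gt0 : 0 < rm. Proof. by rewrite sqrtC_gt0 ltr0n m_gt0. Qed.
Lemma rd_gt0 : 0 < rd. Proof. by rewrite mulr_gt0 ?r2_gt0 ?rm_gt0. Qed.
Lemma r2_neq0 : r2 != 0. Proof. by rewrite gt_eqF ?r2_gt0. Qed.
Lemma rm_neq0 : rm != 0. Proof. by rewrite gt_eqF ?rm_gt0. Qed.
Lemma rd_neq0 : rd != 0. Proof. by rewrite gt_eqF ?rd_gt0. Qed.

Lemma odd_m : odd m. 
Proof. by rewrite oddM; have := p14 _ _ _ _ S; have := p24 _ _ _ _ S; lia. Qed.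

Lemma nQ_r2 : ~ QQ r2.
Proof. by apply: (nQQ_2 _ 1) => //; rewrite sq_sq muln1. Qed.
Lemma nQ_rd : ~ QQ rd.
Proof. by apply: (nQQ_2 _ m) => //; [exact: rd_rd|exact: odd_m]. Qed.
Lemma nQ_rm : ~ QQ rm.
Proof.
apply: (nQQ_p1 _ _ pp1 pp2 (p12 _ _ _ _ S) _ 1); first by rewrite sq_sq mul1n.
by rewrite dvdn1; apply: contraTneq pp1 => ->.
Qed.

Lemma Q_r2 : QQ (r2 * r2). Proof. by rewrite sq_sq; sf_mem QQ_subfield. Qed.
Lemma Q_rm : QQ (rm * rm). Proof. by rewrite sq_sq; sf_mem QQ_subfield. Qed.
Lemma Q_rd : QQ (rd * rd). Proof. by rewrite rd_rd; sf_mem QQ_subfield. Qed.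
Lemma Q_i : QQ ('i * 'i). Proof. by rewrite ii; sf_mem QQ_subfield. Qed.

Lemma sfQ2 : subfield Q2. Proof. exact: (adj_subfield QQ_subfield _ Q_r2). Qed.
Lemma sfQm : subfield Qm. Proof. exact: (adj_subfield QQ_subfield _ Q_rm). Qed.
Lemma sfQd : subfield Qd. Proof. exact: (adj_subfield QQ_subfield _ Q_rd). Qed.
Lemma sfQi : subfield Qi. Proof. exact: (adj_subfield QQ_subfield _ Q_i). Qed.
Lemma sfF : subfield F.
Proof. by apply: (adj_subfield sfQ2); apply: (adjS QQ_subfield); exact: Q_rm. Qed.
Lemma sfL : subfield L.
Proof. by apply: (adj_subfield sfF); apply: (adjS sfQ2); apply: (adjS QQ_subfield); exact: Q_i. Qed.
Lemma sfk : subfield k.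
Proof. by apply: (adj_subfield sfQi); apply: (adjS QQ_subfield); exact: Q_rd. Qed.

Lemma F_r2 : F r2. Proof. apply: (adjS sfQ2); exact: (adj_gen QQ_subfield). Qed.
Lemma F_rm : F rm. Proof. exact: (adj_gen sfQ2). Qed.
Lemma F_rd : F rd. Proof. by apply: (sfM _ sfF); [exact: F_r2|exact: F_rm]. Qed.
Lemma L_i : L 'i. Proof. exact: (adj_gen sfF). Qed.
Lemma F_L x : F x -> L x. Proof. exact: (adjS sfF). Qed.
Lemma L_r2 : L r2. Proof. exact: F_L F_r2. Qed.
Lemma L_rm : L rm. Proof. exact: F_L F_rm. Qed.
Lemma L_rd : L rd. Proof. exact: F_L F_rd. Qed.
Lemma k_i : k 'i. Proof. by apply: (adjS sfQi); exact: (adj_gen QQ_subfield). Qed.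
Lemma k_rd : k rd. Proof. exact: (adj_gen sfQi). Qed.
Lemma QQ_sub (M : algC -> Prop) x : subfield M -> QQ x -> M x.
Proof. by move=> sM [r ->]; apply: sf_rat. Qed.
Lemma Q2_F x : Q2 x -> F x. Proof. exact: (adjS sfQ2). Qed.
Lemma Qm_F x : Qm x -> F x.
Proof. by apply: (adj_min _ _ _ sfF); [move=> y; apply: QQ_sub sfF|exact: F_rm]. Qed.
Lemma Qd_F x : Qd x -> F x.
Proof. by apply: (adj_min _ _ _ sfF); [move=> y; apply: QQ_sub sfF|exact: F_rd]. Qed.
Lemma Qd_k x : Qd x -> k x.
Proof. by apply: (adj_min _ _ _ sfk); [move=> y; apply: QQ_sub sfk|exact: k_rd]. Qed.
Lemma Qi_k x : Qi x -> k x. Proof. exact: (adjS sfQi). Qed.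
Lemma k_L x : k x -> L x.
Proof.
apply: (adj_min _ _ _ sfL); last exact: L_rd.
move=> y; apply: (adj_min _ _ _ sfL); last exact: L_i.
by move=> z; apply: QQ_sub sfL.
Qed.

(** Here and in the sibling lemmas below, F, L and k are rewritten as quadratic extensions of other
    subfields, so that [adj_fixed] can read off fixed fields and [adj_trace_norm] relative norms. *)
Lemma F_as_d x : F x -> adj Qd r2 x.
Proof.
have sM : subfield (adj Qd r2).
  by apply: (adj_subfield sfQd); apply: (QQ_sub _ _ sfQd Q_r2).
have Mr2 : adj Qd r2 r2 by apply: (adj_gen sfQd).
apply: (adj_min _ _ _ sM).
  by move=> y; apply: (adj_min _ _ _ sM) => // z; apply: QQ_sub sM.
have E : rm = rd / r2 by rewrite mulrC mulKf ?r2_neq0.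
rewrite [X in adj _ _ X]E.
by apply: (sf_div sM) => //; apply: (adjS sfQd); exact: (adj_gen QQ_subfield).
Qed.

Lemma F_as_m x : F x -> adj Qm r2 x.
Proof.
have sM : subfield (adj Qm r2).
  by apply: (adj_subfield sfQm); apply: (QQ_sub _ _ sfQm Q_r2).
apply: (adj_min _ _ _ sM).
  move=> y; apply: (adj_min _ _ _ sM); last exact: (adj_gen sfQm).
  by move=> z; apply: QQ_sub sM.
by apply: (adjS sfQm); exact: (adj_gen QQ_subfield).
Qed.

Lemma L_as_k x : L x -> adj k r2 x.
Proof.
have sM : subfield (adj k r2).
  by apply: (adj_subfield sfk); apply: (QQ_sub _ _ sfk Q_r2).
apply: (adj_min _ _ _ sM); last by apply: (adjS sfk); exact: k_i.
move=> y /F_as_d; apply: (adj_min _ _ _ sM); last exact: (adj_gen sfk).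
by move=> z /Qd_k; apply: (adjS sfk).
Qed.

Definition Bm := adj Qi rm.
Definition B2 := adj Qi r2.

Lemma sfBm : subfield Bm.
Proof. by apply: (adj_subfield sfQi); apply: (QQ_sub _ _ sfQi Q_rm). Qed.
Lemma sfB2 : subfield B2.
Proof. by apply: (adj_subfield sfQi); apply: (QQ_sub _ _ sfQi Q_r2). Qed.

Lemma L_as_Bm x : L x -> adj Bm r2 x.
Proof.
have sM : subfield (adj Bm r2).
  by apply: (adj_subfield sfBm); apply: (QQ_sub _ _ sfBm Q_r2).
apply: (adj_min _ _ _ sM).
  move=> y /F_as_m; apply: (adj_min _ _ _ sM); last exact: (adj_gen sfBm).
  move=> z; apply: (adj_min _ _ _ sM); first by move=> ?; apply: QQ_sub sM.
  by apply: (adjS sfBm); exact: (adj_gen sfQi).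
by apply: (adjS sfBm); apply: (adjS sfQi); exact: (adj_gen QQ_subfield).
Qed.

Lemma L_as_B2 x : L x -> adj B2 rm x.
Proof.
have sM : subfield (adj B2 rm).
  by apply: (adj_subfield sfB2); apply: (QQ_sub _ _ sfB2 Q_rm).
apply: (adj_min _ _ _ sM).
  move=> y; apply: (adj_min _ _ _ sM); last exact: (adj_gen sfB2).
  move=> z; apply: (adj_min _ _ _ sM); first by move=> ?; apply: QQ_sub sM.
  by apply: (adjS sfB2); exact: (adj_gen sfQi).
by apply: (adjS sfB2); apply: (adjS sfQi); exact: (adj_gen QQ_subfield).
Qed.

Lemma k_as_id x : k x -> adj (adj QQ ('i * rd)) 'i x.
Proof.
have Qid : QQ ('i * rd * ('i * rd)).
  by rewrite mulrACA ii rd_rd; sf_mem QQ_subfield.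
have sA := adj_subfield QQ_subfield _ Qid.
have sM : subfield (adj (adj QQ ('i * rd)) 'i).
  by apply: (adj_subfield sA); apply: (QQ_sub _ _ sA Q_i).
have Mi : adj (adj QQ ('i * rd)) 'i 'i by apply: (adj_gen sA).
apply: (adj_min _ _ _ sM).
  by move=> y; apply: (adj_min _ _ _ sM) => // z; apply: QQ_sub sM.
have E : rd = ('i * rd) / 'i by rewrite [RHS]mulrC mulKf ?i_neq0.
rewrite [X in adj _ _ X]E.
by apply: (sf_div sM) => //; apply: (adjS sA); exact: (adj_gen QQ_subfield).
Qed.

(** * Galois action and fixed fields *)

(** The nontrivial automorphism of K3 over k: it changes the sign of both [r2] and [rm] and so fixes
    [rd]. *)
Definition sg : {rmorphism algC -> algC} := s \o t.
Lemma sgE x : sg x = s (t x). Proof. by []. Qed.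
Lemma sg_r2 : sg r2 = - r2. Proof. by rewrite sgE (t_r2 _ _ _ _ S) (s_r2 _ _ _ _ S). Qed.
Lemma sg_rm : sg rm = - rm. Proof. by rewrite sgE (t_rm _ _ _ _ S) rmorphN /= (s_rm _ _ _ _ S). Qed.
Lemma sg_rd : sg rd = rd. Proof. by rewrite rmorphM /= -!sgE sg_r2 sg_rm mulrNN. Qed.
Lemma sg_i : sg 'i = 'i. Proof. by rewrite sgE (t_i _ _ _ _ S) (s_i _ _ _ _ S). Qed.
Lemma cj_r2 : cj r2 = r2. Proof. exact: cj_sq. Qed.
Lemma cj_rm : cj rm = rm. Proof. exact: cj_sq. Qed.
Lemma cj_rd : cj rd = rd. Proof. by rewrite rmorphM /= !cj_sq. Qed.

Lemma adj_id (K : algC -> Prop) a (nu mu : {rmorphism algC -> algC}) x :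
  (forall y, K y -> nu y = mu y) -> nu a = mu a -> adj K a x -> nu x = mu x.
Proof. by move=> H e [u [v [Ku Kv ->]]]; rewrite !rmorphD !rmorphM /= (H _ Ku) (H _ Kv) e. Qed.

Lemma QQ_id (nu mu : {rmorphism algC -> algC}) x : QQ x -> nu x = mu x.
Proof. by move=> Qx; rewrite !fmorph_QQ. Qed.

Lemma L_eq (nu mu : {rmorphism algC -> algC}) x : nu r2 = mu r2 -> nu rm = mu rm ->
  nu 'i = mu 'i -> L x -> nu x = mu x.
Proof.
move=> h1 h2 h3; apply: (adj_id _ _ nu mu) h3 => y; apply: (adj_id _ _ nu mu) h2 => z.
by apply: (adj_id _ _ nu mu) h1 => w; apply: QQ_id.
Qed.

Lemma F_eq (nu mu : {rmorphism algC -> algC}) x : nu r2 = mu r2 -> nu rm = mu rm ->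
  F x -> nu x = mu x.
Proof.
move=> h1 h2; apply: (adj_id _ _ nu mu) h2 => z.
by apply: (adj_id _ _ nu mu) h1 => w; apply: QQ_id.
Qed.

Lemma ss x : L x -> s (s x) = x.
Proof.
by move=> Lx; apply: (L_eq (s \o s : {rmorphism algC -> algC}) (idfun : {rmorphism algC -> algC})) Lx;
  rewrite /= ?(s_r2 _ _ _ _ S) ?(s_rm _ _ _ _ S) ?(s_i _ _ _ _ S) ?rmorphN /= ?(s_r2 _ _ _ _ S) ?opprK ?(s_rm _ _ _ _ S) ?(s_i _ _ _ _ S).
Qed.

Lemma tt x : L x -> t (t x) = x.
Proof.
by move=> Lx; apply: (L_eq (t \o t : {rmorphism algC -> algC}) (idfun : {rmorphism algC -> algC})) Lx;
  rewrite /= ?(t_r2 _ _ _ _ S) ?(t_rm _ _ _ _ S) ?(t_i _ _ _ _ S) ?rmorphN /= ?(t_r2 _ _ _ _ S) ?(t_rm _ _ _ _ S) ?opprK ?(t_i _ _ _ _ S).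
Qed.

Lemma ts x : L x -> t (s x) = s (t x).
Proof.
by move=> Lx; apply: (L_eq (t \o s : {rmorphism algC -> algC}) (s \o t : {rmorphism algC -> algC})) Lx;
  rewrite /= ?(s_r2 _ _ _ _ S) ?(s_rm _ _ _ _ S) ?(s_i _ _ _ _ S) ?(t_r2 _ _ _ _ S) ?(t_rm _ _ _ _ S) ?(t_i _ _ _ _ S) ?rmorphN /= ?(s_r2 _ _ _ _ S) ?(s_rm _ _ _ _ S) ?(s_i _ _ _ _ S) ?(t_r2 _ _ _ _ S) ?(t_rm _ _ _ _ S) ?(t_i _ _ _ _ S).
Qed.

Lemma cj_s x : L x -> cj (s x) = s (cj x).
Proof.
by move=> Lx; apply: (L_eq (cj \o s : {rmorphism algC -> algC}) (s \o cj : {rmorphism algC -> algC})) Lx;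
  rewrite /= ?(s_r2 _ _ _ _ S) ?(s_rm _ _ _ _ S) ?(s_i _ _ _ _ S) ?cj_r2 ?cj_rm ?cj_i ?rmorphN /= ?(s_r2 _ _ _ _ S) ?(s_rm _ _ _ _ S) ?(s_i _ _ _ _ S) ?cj_r2.
Qed.

Lemma cj_t x : L x -> cj (t x) = t (cj x).
Proof.
by move=> Lx; apply: (L_eq (cj \o t : {rmorphism algC -> algC}) (t \o cj : {rmorphism algC -> algC})) Lx;
  rewrite /= ?(t_r2 _ _ _ _ S) ?(t_rm _ _ _ _ S) ?(t_i _ _ _ _ S) ?cj_r2 ?cj_rm ?cj_i ?rmorphN /= ?(t_r2 _ _ _ _ S) ?(t_rm _ _ _ _ S) ?(t_i _ _ _ _ S) ?cj_rm.
Qed.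

Lemma cj_F x : F x -> cj x = x.
Proof.
move=> Fx; apply: (F_eq cj (idfun : {rmorphism algC -> algC})) Fx; [exact: cj_r2 | exact: cj_rm].
Qed.

Let Q_stab (nu : {rmorphism algC -> algC}) y : QQ y -> QQ (nu y).
Proof. by move=> Qy; rewrite fmorph_QQ. Qed.

Lemma F_stab (nu : {rmorphism algC -> algC}) x : (nu r2 = r2 \/ nu r2 = - r2) ->
  (nu rm = rm \/ nu rm = - rm) -> F x -> F (nu x).
Proof. by move=> h1 h2; apply: (adj_stable sfQ2) => // y; apply: (adj_stable QQ_subfield) => // z; apply: Q_stab. Qed.

Lemma L_stab (nu : {rmorphism algC -> algC}) x : (nu r2 = r2 \/ nu r2 = - r2) ->
  (nu rm = rm \/ nu rm = - rm) -> (nu 'i = 'i \/ nu 'i = - 'i) -> L x -> L (nu x).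
Proof. by move=> h1 h2 h3; apply: (adj_stable sfF) => // y; apply: F_stab. Qed.

Lemma F_s x : F x -> F (s x).
Proof. by apply: F_stab; rewrite ?(s_r2 _ _ _ _ S) ?(s_rm _ _ _ _ S); auto. Qed.
Lemma F_t x : F x -> F (t x).
Proof. by apply: F_stab; rewrite ?(t_r2 _ _ _ _ S) ?(t_rm _ _ _ _ S); auto. Qed.
Lemma F_sg x : F x -> F (sg x). Proof. by move=> Fx; apply/F_s/F_t. Qed.
Lemma L_s x : L x -> L (s x).
Proof. by apply: L_stab; rewrite ?(s_r2 _ _ _ _ S) ?(s_rm _ _ _ _ S) ?(s_i _ _ _ _ S); auto. Qed.
Lemma L_t x : L x -> L (t x).
Proof. by apply: L_stab; rewrite ?(t_r2 _ _ _ _ S) ?(t_rm _ _ _ _ S) ?(t_i _ _ _ _ S); auto. Qed.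
Lemma L_sg x : L x -> L (sg x). Proof. by move=> Lx; apply/L_s/L_t. Qed.
Lemma L_cj x : L x -> L (cj x).
Proof. by apply: L_stab; rewrite ?cj_r2 ?cj_rm ?cj_i; auto. Qed.
Lemma sgsg x : L x -> sg (sg x) = x.
Proof. by move=> Lx; rewrite !sgE ts ?tt ?ss //; apply: L_t. Qed.
Lemma k_stab (nu : {rmorphism algC -> algC}) x : (nu rd = rd \/ nu rd = - rd) ->
  (nu 'i = 'i \/ nu 'i = - 'i) -> k x -> k (nu x).
Proof. by move=> h1 h2; apply: (adj_stable sfQi) => // y; apply: (adj_stable QQ_subfield) => // z; apply: Q_stab. Qed.

Lemma Qd_s x : Qd x -> Qd (s x).
Proof. by apply: (adj_stable QQ_subfield); [exact: Q_stab|right; exact: s_rd]. Qed.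
Lemma Qm_t x : Qm x -> Qm (t x).
Proof. by apply: (adj_stable QQ_subfield); [exact: Q_stab|right; exact: (t_rm _ _ _ _ S)]. Qed.
Lemma Q2_s x : Q2 x -> Q2 (s x).
Proof. by apply: (adj_stable QQ_subfield); [exact: Q_stab|right; exact: (s_r2 _ _ _ _ S)]. Qed.

Lemma fix_adj (K : algC -> Prop) (nu : {rmorphism algC -> algC}) a y : 
  (forall z, K z -> nu z = z) -> nu a = a -> adj K a y -> nu y = y.
Proof. by move=> h ha; apply: (adj_id _ _ nu idfun). Qed.
Lemma fix_QQ (nu : {rmorphism algC -> algC}) a y : nu a = a -> adj QQ a y -> nu y = y.
Proof. by move=> h; apply: fix_adj => // z; apply: fmorph_QQ. Qed.
Lemma fix_Q2 (nu : {rmorphism algC -> algC}) y : nu r2 = r2 -> Q2 y -> nu y = y.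
Proof. exact: fix_QQ. Qed.
Lemma fix_Qm (nu : {rmorphism algC -> algC}) y : nu rm = rm -> Qm y -> nu y = y.
Proof. exact: fix_QQ. Qed.
Lemma fix_Qd (nu : {rmorphism algC -> algC}) y : nu rd = rd -> Qd y -> nu y = y.
Proof. exact: fix_QQ. Qed.
Lemma fix_Qi (nu : {rmorphism algC -> algC}) y : nu 'i = 'i -> Qi y -> nu y = y.
Proof. exact: fix_QQ. Qed.
Lemma fix_k (nu : {rmorphism algC -> algC}) y : nu rd = rd -> nu 'i = 'i -> k y -> nu y = y.
Proof. by move=> h1 h2; apply: fix_adj => // z; apply: fix_Qi. Qed.
Lemma fix_F (nu : {rmorphism algC -> algC}) y : nu r2 = r2 -> nu rm = rm -> F y -> nu y = y.
Proof. by move=> h1 h2; apply: fix_adj => // z; apply: fix_QQ. Qed.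

Lemma in_F x : L x -> cj x = x -> F x.
Proof. by apply: adj_fixed cj_i => y; apply: cj_F. Qed.
Lemma in_Qm x : F x -> s x = x -> Qm x.
Proof.
move/F_as_m; apply: adj_fixed (s_r2 _ _ _ _ S) => y; apply: fix_Qm (s_rm _ _ _ _ S).
Qed.
Lemma in_Q2 x : F x -> t x = x -> Q2 x.
Proof. by apply: adj_fixed (t_rm _ _ _ _ S) => y; apply: fix_Q2 (t_r2 _ _ _ _ S). Qed.
Lemma in_Qd x : F x -> sg x = x -> Qd x.
Proof. by move/F_as_d; apply: adj_fixed sg_r2 => y; apply: fix_Qd sg_rd. Qed.
Lemma in_k x : L x -> sg x = x -> k x.
Proof. by move/L_as_k; apply: adj_fixed sg_r2 => y; apply: (fix_k _ _ sg_rd sg_i). Qed.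
Lemma in_Bm x : L x -> s x = x -> Bm x.
Proof.
move/L_as_Bm; apply: adj_fixed (s_r2 _ _ _ _ S) => y; apply: fix_adj; last exact: (s_rm _ _ _ _ S).
by move=> z; apply: fix_Qi (s_i _ _ _ _ S).
Qed.
Lemma in_B2 x : L x -> t x = x -> B2 x.
Proof.
move/L_as_B2; apply: adj_fixed (t_rm _ _ _ _ S) => y; apply: fix_adj; last exact: (t_r2 _ _ _ _ S).
by move=> z; apply: fix_Qi (t_i _ _ _ _ S).
Qed.

(** * Norm equations and squares up to units *)

Lemma Aint_sq n : sq n \in Aint.
Proof. by apply: Aint_sqrt; rewrite sq_sq Aint_Cnat ?natr_nat. Qed.
Lemma Aint_i : 'i \in Aint.
Proof. by apply: Aint_sqrt; rewrite ii rpredN Aint1. Qed.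
Lemma Aint_rd : rd \in Aint. Proof. by rewrite rpredM ?Aint_sq. Qed.

Lemma sqf_m : sqfree m.
Proof.
apply: sqfreeM => //; last exact: sqfree_prime.
by rewrite dvdn_prime2 ?(p12 _ _ _ _ S).
Qed.
Lemma sqf_2m : sqfree (2 * m).
Proof. by apply: sqfreeM => //; [rewrite dvdn2 negbK odd_m|exact: sqf_m]. Qed.

(** For x = a + b v take X = 2a, the trace, and Y = 2b. Integrality of Y comes from (2bn)^2 = n (X^2
    - 4N), N being the norm, as n is square-free. *)
Lemma quad_norm_int (v : algC) (n : nat) (tau : {rmorphism algC -> algC}) x :
  v * v = n%:R -> (0 < n)%N -> sqfree n -> tau v = - v -> adj QQ v x -> x \in Aint ->
  exists X Y : int, 4 * (x * tau x) = (X ^+ 2 - n%:Z * Y ^+ 2)%:~R.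
Proof.
move=> vv n0 sn tv Kx Ax.
have Qvv : QQ (v * v) by rewrite vv; sf_mem QQ_subfield.
have [Qt Qn] := adj_trace_norm _ _ _ tau QQ_subfield Qvv (fmorph_QQ tau) tv Kx.
have At : tau x \in Aint by rewrite Aint_aut.
have [X eX] := QQ_Aint _ Qt (rpredD Ax At); have [N eN] := QQ_Aint _ Qn (rpredM Ax At).
have [a [b [Qa Qb ex]]] := Kx.
have et : tau x = a - b * v by rewrite ex rmorphD rmorphM /= tv !fmorph_QQ // mulrN.
have E1 : n%:R * (2 * b) ^+ 2 = (X ^+ 2 - 4 * N)%:~R.
  by rewrite rmorphB /= intrM rmorphXn /= -eX -eN et ex -vv -[4%:~R]/(4%:R); ring.
have [||Z eZ] := QQ_Aint (2 * b * n%:R).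
- by sf_mem QQ_subfield.
- apply: Aint_sqrt.
  have -> : 2 * b * n%:R * (2 * b * n%:R) = n%:R * (n%:R * (2 * b) ^+ 2) by ring.
  by rewrite E1 rpredM ?Aint_int // Aint_Cnat ?natr_nat.
have ZZ : Z * Z = n%:Z * (X ^+ 2 - 4 * N).
  apply/eqP; rewrite -(eqr_int algC) !intrM -E1 -eZ -[n%:~R]/(n%:R); apply/eqP; ring.
have /dvdzP[Y eY] : (n%:Z %| Z)%Z by apply: sn; rewrite ZZ dvdz_mulr.
exists X, Y; rewrite eN -[4]/(4%:~R) -intrM; congr (_%:~R).
have n0' : n%:Z != 0 by rewrite eqz_nat; lia.
by apply: (mulfI n0'); rewrite mulrBr -[n%:Z * X ^+ 2](subrK (n%:Z * (4 * N))) -mulrBr -ZZ eY; ring.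
Qed.

(** The norm of [y] is an integer whose square is c^2 times the norm of the unit [e]; so [e] has
    norm 1, [y] has norm ±c, and [quad_norm_int] applies. *)
Lemma quad_norm_eq (v : algC) (n : nat) (tau : {rmorphism algC -> algC}) y e (c : nat) :
  v * v = n%:R -> 0 < v -> ~ QQ v -> sqfree n -> tau v = - v -> adj QQ v y ->
  isU (adj QQ v) e -> y * y = c%:R * e \/ y * y = - (c%:R * e) -> (0 < c)%N ->
  exists sn X Y : int, (sn = 1 \/ sn = -1) /\ X ^+ 2 - n%:Z * Y ^+ 2 = 4 * sn * c%:Z.
Proof.
move=> vv v0 nQv sn tv Ky Ue yy c0; have [Ke Ae e0 _] := Ue.
have n0 : (0 < n)%N by rewrite -(ltr_nat algC) -vv mulr_gt0.
have Ay : y \in Aint.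
  by apply: Aint_sqrt; case: yy => ->; rewrite ?rpredN rpredM // Aint_Cnat ?natr_nat.
have Qvv : QQ (v * v) by rewrite vv; sf_mem QQ_subfield.
have [_ Qn] := adj_trace_norm _ _ _ tau QQ_subfield Qvv (fmorph_QQ tau) tv Ky.
have At : tau y \in Aint by rewrite Aint_aut.
have [N eN] := QQ_Aint _ Qn (rpredM Ay At).
have [X [Y E]] := quad_norm_int v n tau y vv n0 sn tv Ky Ay.
have NN : (y * tau y) * (y * tau y) = c%:R ^+ 2 * (e * tau e).
  rewrite mulrACA -rmorphM /=; case: yy => ->; rewrite ?rmorphN rmorphM /= rmorph_nat; ring.
have N2 : N * N = c%:Z ^+ 2.
  apply/eqP; rewrite -(eqr_int algC) intrM -eN NN rmorphXn /= -[c%:~R]/(c%:R).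
  case: (quad_norm n v tau vv tv e Ue) => ne; first by rewrite ne mulr1.
  have : (N * N)%:~R = - c%:R ^+ 2 :> algC by rewrite intrM -eN NN ne mulrN1.
  move=> h; have : (N * N)%:~R < 0 :> algC by rewrite h oppr_lt0 exprn_gt0 ?ltr0n.
  by rewrite ltrz0 -expr2 ltNge sqr_ge0.
have [h|h] : N = c%:Z \/ N = - c%:Z by nia.
  exists 1, X, Y; split; first by left.
  by apply/eqP; rewrite -(eqr_int algC) -E eN h mulr1 intrM.
exists (-1), X, Y; split; first by right.
by apply/eqP; rewrite -(eqr_int algC) -E eN h !intrM !rmorphN /= mulrN1 mulNr mulrN.
Qed.

Lemma no_sq_d y e (c : nat) : Qd y -> isU Qd e -> [\/ c = 2, c = p1 | c = p2] ->
  y * y = c%:R * e \/ y * y = - (c%:R * e) -> False.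
Proof.
move=> Ky Ue hc yy.
have c0 : (0 < c)%N by case: hc => ->; rewrite ?prime_gt0.
have [sn [X [Y [s1 E]]]] := quad_norm_eq _ _ s _ _ _ rd_rd rd_gt0 nQ_rd sqf_2m s_rd Ky Ue yy c0.
rewrite mulnA in E; case: hc => ec; rewrite ec in E.
- apply: (no_norm_8 p1 p2 pp1 pp2 (p14 _ _ _ _ S) (p24 _ _ _ _ S) (leg _ _ _ _ S) 2 sn X Y s1).
  by rewrite E; ring.
- exact: (no_norm_4p1 p1 p2 pp1 pp2 (p14 _ _ _ _ S) (p24 _ _ _ _ S) (leg _ _ _ _ S) sn X Y s1 E).
- exact: (no_norm_4p2 p1 p2 pp1 pp2 (p14 _ _ _ _ S) (p24 _ _ _ _ S) (leg _ _ _ _ S) sn X Y s1 E).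
Qed.

Lemma no_sq_m y e : Qm y -> isU Qm e -> y * y = 2 * e \/ y * y = - (2 * e) -> False.
Proof.
move=> Ky Ue yy.
have [sn [X [Y [s1 E]]]] := quad_norm_eq _ _ t _ _ 2 (sq_sq m) rm_gt0 nQ_rm sqf_m (t_rm _ _ _ _ S) Ky Ue yy isT.
apply: (no_norm_8 p1 p2 pp1 pp2 (p14 _ _ _ _ S) (p24 _ _ _ _ S) (leg _ _ _ _ S) 1 sn X Y s1).
by rewrite mul1n E; ring.
Qed.

(** For a unit [x], [sqc p1 x] is exactly what makes H1H2 principal in K3; the sign is immaterial
    for ideals. *)
Definition sqc (c : nat) (x : algC) : Prop :=
  exists2 g, F g & g * g = c%:R * x \/ g * g = - (c%:R * x).

Lemma sqcM c c' (l : algC) x : F l -> l != 0 -> l * l * c%:R = c'%:R -> sqc c x -> sqc c' x.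
Proof.
move=> Fl l0 e [g Fg gg]; exists (l * g); first by sf_mem sfF.
by rewrite mulrACA -e; case: gg => ->; [left|right]; ring.
Qed.

(** In F both 2 and p1 p2 are squares, so the divisors of 2 p1 p2 fall into the classes of 1 and
    p1. *)
Lemma sqc_dvd (q : nat) x : (q %| 2 * m)%N -> sqc q x -> sqc 1 x \/ sqc p1 x.
Proof.
have P1 : p1%:R != 0 :> algC by rewrite pnatr_eq0; have := prime_gt0 pp1; lia.
have P2 : p2%:R != 0 :> algC by rewrite pnatr_eq0; have := prime_gt0 pp2; lia.
have H2 : 2 != 0 :> algC by rewrite pnatr_eq0.
have half c y : sqc (2 * c) y -> sqc c y.
  apply: (sqcM _ _ r2^-1); first by apply: (sfV _ sfF); exact: F_r2.
    by rewrite invr_eq0 r2_neq0.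
  by rewrite -invfM sq_sq natrM mulKf.
have {}half y q' : (q' %| m)%N \/ (exists2 q'', q' = (2 * q'')%N & (q'' %| m)%N) -> sqc q' y ->
    exists2 q'', (q'' %| m)%N & sqc q'' y.
  by case=> [h sy|[q'' -> h] /half sy]; [exists q'|exists q''].
move/(prime_dvd_split 2 m _ isT) => h /(half _ _ h) [{h}{}q h sx].
have mE : rm * rm = p1%:R * p2%:R by rewrite sq_sq natrM.
have [h1|[q' qE h1]] := prime_dvd_split p1 p2 q pp1 h.
  have /primeP[_ /(_ _ h1) /orP[]/eqP qE] := pp2; first by left; rewrite -qE.
  right; rewrite qE in sx; apply: (sqcM _ _ (rm / p2%:R) _ _ _ _ sx).
  - by apply: (sf_div sfF); [exact: F_rm|sf_mem sfF].
  - by rewrite mulf_neq0 ?invr_eq0 ?rm_neq0.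
  - by rewrite mulrACA mE; field.
have /primeP[_ /(_ _ h1) /orP[]/eqP qE'] := pp2; first by right; rewrite qE qE' muln1 in sx.
left; rewrite qE qE' in sx; apply: (sqcM _ _ rm^-1 _ _ _ _ sx).
- by apply: (sfV _ sfF); exact: F_rm.
- by rewrite invr_eq0 rm_neq0.
- by rewrite -invfM mE natrM mulVf // mulf_neq0.
Qed.

Lemma F_coord x : F x -> exists a b c d, [/\ QQ a, QQ b, QQ c, QQ d &
  x = a + b * r2 + c * rm + d * rd].
Proof.
move=> [_ [_ [[a [b [Qa Qb ->]]] [c [d [Qc Qd' ->]]] ->]]].
by exists a, b, c, d; split=> //; ring.
Qed.

(** Clearing squares replaces [r] by ± a square-free q with h^2 = ± q x. Such an h divides its own
    traces, which forces q to divide 2 p1 p2, that is, to be composed of ramified primes; then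
    [sqc_dvd] concludes. *)
Lemma sqc_rat g r x : F g -> g != 0 -> QQ r -> isU F x -> g * g = r * x -> sqc 1 x \/ sqc p1 x.
Proof.
move=> Fg g0 Qr Ux gg; have [Fx Ax x0 Ax'] := Ux.
have [z [g1 [Fg1 g10 gg1]]] : exists z (g1 : algC), [/\ F g1, g1 != 0 & g1 * g1 = z%:~R * x].
  case: Qr => r0 rE; have d0 : (denq r0)%:~R != 0 :> algC by rewrite intr_eq0 denq_neq0.
  exists (numq r0 * denq r0), (g * (denq r0)%:~R); split; first by sf_mem sfF.
    by rewrite mulf_neq0.
  by rewrite mulrACA gg rE intrM /ratr; field.
have z0 : (0 < absz z)%N.
  rewrite absz_gt0; apply: contra_neq g10 => z0; apply/eqP.
  by rewrite -[_ == 0]orbb -mulf_eq0 gg1 z0 mul0r.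
have [q [l [zE l0 q0 sq]]] := nat_square_part _ z0.
have l0' : l%:R != 0 :> algC by rewrite pnatr_eq0; lia.
have q0' : q%:R != 0 :> algC by rewrite pnatr_eq0; lia.
have [h [Fh h0 hh]] : exists h, [/\ F h, h != 0 & h * h = q%:R * x \/ h * h = - (q%:R * x)].
  exists (g1 / l%:R); split; first by sf_mem sfF.
    by rewrite mulf_neq0 ?invr_eq0.
  have e : (absz z)%:R = q%:R * (l%:R * l%:R) :> algC by rewrite zE !natrM.
  have -> : g1 / l%:R * (g1 / l%:R) = (g1 * g1) / (l%:R * l%:R) by field.
  rewrite gg1; case: z e {gg1 z0 zE} => z e; [left|right].
    by rewrite -[z%:~R]/((absz z)%:R) e; field.
  by rewrite NegzE mulrNz -[z.+1%:~R]/((absz (Negz z))%:R) e; field.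
apply: (sqc_dvd q); last by exists h.
have Ah : h \in Aint.
  by apply: Aint_sqrt; case: hh => ->; rewrite ?rpredN rpredM // Aint_Cnat ?natr_nat.
have Aq : q%:R \in Aint by rewrite Aint_Cnat ?natr_nat.
(* Conjugates of [h] are associated to [h]: the square of [nu h / h] is the unit [nu x / x]. *)
have conj (nu : {rmorphism algC -> algC}) : nu h / h \in Aint.
  apply: Aint_sqrt.
  have -> : nu h / h * (nu h / h) = nu x / x.
    have -> : nu h / h * (nu h / h) = nu (h * h) / (h * h) by rewrite rmorphM /=; field.
    by case: hh => ->; rewrite ?rmorphN rmorphM /= rmorph_nat; field; rewrite x0 q0'.
  by rewrite rpredM // Aint_aut.
(* A rational integer [h * w] has square ± q x w^2, so q divides the square and hence the
   integer. *)
have tr (T : int) (w : algC) : w \in Aint -> T%:~R = h * w -> (q%:Z %| T)%Z.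
  move=> Aw TE; apply: sq; apply: dvdz_Aint => //.
  rewrite intrM TE mulrACA.
  have -> : h * h * (w * w) / q%:R = (h * h) / q%:R * (w * w) by ring.
  apply: rpredM; last exact: rpredM.
  by case: hh => ->; rewrite ?mulNr ?rpredN mulrC mulKf.
have trace (d : algC) : d \in Aint -> QQ (h * d + s (h * d) + t (h * d) + sg (h * d)) ->
    exists2 T : int, (q%:Z %| T)%Z & T%:~R = h * d + s (h * d) + t (h * d) + sg (h * d).
  move=> Ad QT; have Adh : h * d \in Aint by rewrite rpredM.
  have [|T TE] := QQ_Aint _ QT; first by rewrite !rpredD // Aint_aut.
  exists T => //; apply: (tr T (d + s h / h * s d + t h / h * t d + sg h / h * sg d)).
    by rewrite !rpredD // rpredM ?conj // Aint_aut.
  by rewrite -TE (rmorphM s) (rmorphM t) (rmorphM sg); field.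
have [a [b [c [d [Qa Qb Qc Qd' hE]]]]] := F_coord _ Fh.
have sE (nu : {rmorphism algC -> algC}) y : QQ y -> nu y = y by apply: fmorph_QQ.
have act (nu : {rmorphism algC -> algC}) : nu h = a + b * nu r2 + c * nu rm + d * (nu r2 * nu rm).
  by rewrite hE !rmorphD !rmorphM /= (sE nu _ Qa) (sE nu _ Qb) (sE nu _ Qc) (sE nu _ Qd').
have e2 := sq_sq 2; have em := sq_sq m.
have hs := s_r2 _ _ _ _ S; have hs' := s_rm _ _ _ _ S.
have ht := t_r2 _ _ _ _ S; have ht' := t_rm _ _ _ _ S.
have val (d0 : algC) v : h * d0 + s (h * d0) + t (h * d0) + sg (h * d0) = v -> QQ v -> d0 \in Aint ->
    exists2 T : int, (q%:Z %| T)%Z & T%:~R = v.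
  by move=> <- Qv Ad; apply: trace.
have [|||T1 d1 E1] := val 1 (4 * a); [|by sf_mem QQ_subfield|exact: Aint1|].
  by rewrite !mulr1 !act hs hs' ht ht' sg_r2 sg_rm hE; ring.
have [|||T2 d2 E2] := val r2 (8 * b); [|by sf_mem QQ_subfield|exact: Aint_sq|].
  rewrite (rmorphM s h) (rmorphM t h) (rmorphM sg h) !act ?s_rd ?t_rd ?sg_rd hs hs' ht ht' sg_r2 sg_rm hE.
  by transitivity (4 * b * (r2 * r2)); [ring|rewrite e2; ring].
have [|||T3 d3 E3] := val rm (4 * m%:R * c); [|by sf_mem QQ_subfield|exact: Aint_sq|].
  rewrite (rmorphM s h) (rmorphM t h) (rmorphM sg h) !act ?s_rd ?t_rd ?sg_rd hs hs' ht ht' sg_r2 sg_rm hE.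
  by transitivity (4 * c * (rm * rm)); [ring|rewrite em; ring].
have [|||T4 d4 E4] := val rd (8 * m%:R * d); [|by sf_mem QQ_subfield|exact: Aint_rd|].
  rewrite (rmorphM s h) (rmorphM t h) (rmorphM sg h) !act ?s_rd ?t_rd ?sg_rd hs hs' ht ht' sg_r2 sg_rm hE.
  by transitivity (4 * d * (r2 * r2 * (rm * rm))); [ring|rewrite em e2; ring].
(* The traces of [h] against 1, [r2], [rm], [rd] are its coordinates up to factors dividing 8m; all
   are divisible by q. *)
have [w Aw wE] : exists2 w, w \in Aint & 8 * m%:R * h = q%:R * w.
  have dv (T : int) : (q%:Z %| T)%Z -> exists2 u, u \in Aint & T%:~R = q%:R * u.
    by move=> /dvdzP[u ->]; exists u%:~R; rewrite ?Aint_int // intrM mulrC.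
  have [u1 A1 f1] := dv _ d1; have [u2 A2 f2] := dv _ d2.
  have [u3 A3 f3] := dv _ d3; have [u4 A4 f4] := dv _ d4.
  have An n : n%:R \in Aint by rewrite Aint_Cnat ?natr_nat.
  exists (2 * m%:R * u1 + m%:R * u2 * r2 + 2 * u3 * rm + u4 * rd).
    by rewrite !rpredD // !rpredM ?An // Aint_sq.
  rewrite hE; transitivity (2 * m%:R * T1%:~R + m%:R * T2%:~R * r2 + 2 * T3%:~R * rm + T4%:~R * rd).
    by rewrite E1 E2 E3 E4; ring.
  by rewrite f1 f2 f3 f4; ring.
(* Squaring 8m h = q w and cancelling h^2 = ± q x leaves q | (8m)^2; square-freeness brings this
   down to 8m and then to 2m. *)
have d64 : (q%:Z %| (8 * m * (8 * m))%:Z)%Z.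
  apply: dvdz_Aint => //; rewrite -[_%:~R]/(_%:R).
  have -> : (8 * m * (8 * m))%:R / q%:R = (8 * m%:R * h) * (8 * m%:R * h) * (q%:R / (h * h)) / (q%:R * q%:R) :> algC.
    by rewrite !natrM; field; rewrite h0 q0'.
  rewrite wE; have -> : q%:R * w * (q%:R * w) * (q%:R / (h * h)) / (q%:R * q%:R) = w * w * (q%:R / (h * h)).
    by field; rewrite h0 q0'.
  apply: rpredM; first exact: rpredM.
  case: hh => ->; rewrite ?invrN ?mulrN ?rpredN.
    by have -> : q%:R / (q%:R * x) = x^-1 by field; rewrite x0 q0'.
  by have -> : q%:R / (q%:R * x) = x^-1 by field; rewrite x0 q0'.
have d8 : (q %| 8 * m)%N by have := sq (8 * m)%:Z; rewrite -PoszM => /(_ d64); rewrite dvdzE.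
have : (q%:Z %| (2 * m)%:Z)%Z; last by rewrite dvdzE.
have d2m : (q %| 2 * m * (2 * m) * (2 * m * (2 * m)))%N.
  by apply: (dvdn_trans d8); apply/dvdnP; exists (2 * m * m * m)%N; ring.
by apply: (sq); apply: (sq); rewrite -PoszM dvdzE.
Qed.

Lemma sqrt_Qd y : F y -> Qd (y * y) -> Qd y \/ Qd (y * r2).
Proof.
move=> Fy Qyy; have := fix_Qd sg _ sg_rd Qyy; rewrite (rmorphM sg) => /sqr_pm [h|h].
  by left; apply: in_Qd.
right; apply: in_Qd; first by apply: (sfM _ sfF) => //; exact: F_r2.
by rewrite (rmorphM sg) h sg_r2 mulrNN.
Qed.

Lemma sqrt_Qm y : F y -> Qm (y * y) -> Qm y \/ Qm (y * r2).
Proof.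
move=> Fy Qyy; have := fix_Qm s _ (s_rm _ _ _ _ S) Qyy; rewrite rmorphM => /sqr_pm [h|h].
  by left; apply: in_Qm.
right; apply: in_Qm; first by apply: (sfM _ sfF) => //; exact: F_r2.
by rewrite rmorphM /= h (s_r2 _ _ _ _ S) mulrNN.
Qed.

Lemma p1_neq0 : p1%:R != 0 :> algC. Proof. by rewrite pnatr_eq0 -lt0n prime_gt0. Qed.
Lemma p2_neq0 : p2%:R != 0 :> algC. Proof. by rewrite pnatr_eq0 -lt0n prime_gt0. Qed.
Lemma two_neq0 : 2 != 0 :> algC. Proof. by rewrite pnatr_eq0. Qed.

(** Multiplying [y] by [rd / (2 * p1)] turns 2 p1 into p2, because rd^2 = 2 p1 p2. *)
Lemma no_sq_2p1 y e : Qd y -> isU Qd e ->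
  y * y = 2 * p1%:R * e \/ y * y = - (2 * p1%:R * e) -> False.
Proof.
move=> Ky Ue yy; apply: (no_sq_d (y * rd / (2 * p1%:R)) e p2) => //.
- have Kd : Qd rd by exact: (adj_gen QQ_subfield).
  by sf_mem sfQd.
- by constructor 3.
have -> : y * rd / (2 * p1%:R) * (y * rd / (2 * p1%:R)) =
    y * y * (rd * rd) / (2 * p1%:R * (2 * p1%:R)).
  by field; rewrite p1_neq0.
rewrite rd_rd !natrM; case: yy => ->; [left|right]; field; exact: p1_neq0.
Qed.

(** * Units of norm -1 in the quadratic subfields *)

(** Take [e] not ± a square. If its norm were 1, then (1 + e)^2 = (Tr e + 2) e, so by [sqc_rat] e or
    p1 e is ± a square in F. Descending to Q(sqrt(2p1p2)), one of e, 2e, p1 e, 2p1 e would be ± a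
    square there, and all four are excluded. *)
Lemma ed_exists : exists2 e, isU Qd e & e * s e = -1.
Proof.
have [e Ue ne] := unit_not_square _ _ s rd_rd rd_gt0 nQ_rd s_rd.
exists e => //; case: (quad_norm _ _ s rd_rd s_rd e Ue) => // n1; exfalso.
have [Ke Ae e0 _] := Ue; have Fe := Qd_F _ Ke.
have [Qtr _] := adj_trace_norm _ _ _ s QQ_subfield Q_rd (fmorph_QQ s) s_rd Ke.
have U1 : isU Qd 1 by apply: isU1 sfQd.
have b0 : 1 + e != 0.
  have [_ h] := ne 1 U1; apply/eqP => h'; apply: h; rewrite mulr1.
  by apply/eqP; rewrite -addr_eq0 addrC h'.
have bb : (1 + e) * (1 + e) = (e + s e + 2) * e.
  by transitivity (1 + 2 * e + e * e); [ring|rewrite -{1}n1; ring].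
have UeF : isU F e := isU_sub _ _ _ Qd_F Ue.
have : sqc 1 e \/ sqc p1 e.
  by apply: (sqc_rat (1 + e) _ _ _ b0 _ UeF bb); [sf_mem sfF|sf_mem QQ_subfield].
case=> -[g Fg gg].
  have gU : isU F (g * g) by rewrite mul1r in gg; case: gg => ->; [|apply: (isUN sfF)].
  have Kgg : Qd (g * g) by rewrite mul1r in gg; case: gg => ->; sf_mem sfQd.
  have [Kg|Kg] := sqrt_Qd _ Fg Kgg.
    have Ug : isU Qd g.
      by apply: isU_sqrt => //; rewrite mul1r in gg; case: gg => ->; [|apply: (isUN sfQd)].
    have [h1 h2] := ne _ Ug; rewrite mul1r in gg.
    by case: gg => h; [apply: h1|apply: h2]; rewrite h ?opprK.
  apply: (no_sq_d _ e 2 Kg Ue); first by constructor.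
  rewrite mulrACA sq_sq; rewrite mul1r in gg.
  by case: gg => ->; [left|right]; ring.
have Kgg : Qd (g * g) by case: gg => ->; sf_mem sfQd.
have [Kg|Kg] := sqrt_Qd _ Fg Kgg.
  by apply: (no_sq_d _ e p1 Kg Ue _ gg); constructor 2.
apply: (no_sq_2p1 _ e Kg Ue); rewrite mulrACA sq_sq.
by case: gg => ->; [left|right]; ring.
Qed.

Lemma norm1_d u : isU Qd u -> u * s u = 1 ->
  exists2 v, isU Qd v & u = v * v \/ u = - (v * v).
Proof.
have [e Ue ne] := ed_exists.
exact: (norm1_square _ _ s rd_rd rd_gt0 nQ_rd s_rd e Ue ne).
Qed.

Lemma norm1_2 u : isU Q2 u -> u * s u = 1 ->
  exists2 v, isU Q2 v & u = v * v \/ u = - (v * v).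
Proof.
have n1 : (1 + r2) * s (1 + r2) = -1.
  rewrite rmorphD rmorph1 /= (s_r2 _ _ _ _ S).
  by transitivity (1 - r2 * r2); [ring|rewrite sq_sq; ring].
have e0 : 1 + r2 != 0 by rewrite gt_eqF // addr_gt0 ?ltr01 ?r2_gt0.
have Ue : isU Q2 (1 + r2).
  have Ae : 1 + r2 \in Aint by rewrite rpredD ?Aint1 ?Aint_sq.
  split=> //.
    by apply: (sfD sfQ2); [exact: (sf1 _ sfQ2)|exact: (adj_gen QQ_subfield)].
  have -> : (1 + r2)^-1 = - s (1 + r2).
    by apply: (mulfI e0); rewrite divff // mulrN n1 opprK.
  by rewrite rpredN Aint_aut.
exact: (norm1_square _ _ s (sq_sq 2) r2_gt0 nQ_r2 (s_r2 _ _ _ _ S) (1 + r2) Ue n1).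
Qed.

(** * Units of K3: roots of unity and the unit index over the real subfield *)

(** In a^2 + n b^2 = 1 with 2a an integer, 2a is 0, ±1 or ±2. The value 0 would make [v] rational
    and ±1 would make (2bv)^2 = 3: the fields Q('i) and Q(sqrt(-3)) are the ones excluded. *)
Lemma imag_unit (v : algC) (n : nat) Y : v * v = n%:R -> cj v = v -> ~ QQ v ->
  (forall q, QQ q -> v * q * (v * q) <> 3) -> adj QQ ('i * v) Y -> Y \in Aint ->
  Y * cj Y = 1 -> Y = 1 \/ Y = -1.
Proof.
move=> vv cv nQ n3 [a [b [Qa Qb YE]]] AY nY.
have cE : cj Y = a - b * ('i * v).
  by rewrite YE rmorphD !rmorphM /= cj_i cv !fmorph_QQ // mulNr mulrN.
have e1 : a * a + b * b * (v * v) = 1.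
  rewrite -[RHS]nY cE YE.
  by transitivity (a * a - ('i * 'i) * (b * b * (v * v))); [rewrite ii|]; ring.
have [||T TE] := QQ_Aint (2 * a).
- by sf_mem QQ_subfield.
- have -> : 2 * a = Y + cj Y by rewrite cE YE; ring.
  by rewrite rpredD // Aint_aut.
have e4 : (4 - T * T)%:~R = 4 * (b * b * (v * v)).
  by rewrite rmorphB /= intrM -TE -[4%:~R]/(4%:R) -[4 * _](addrK (4 * (a * a))) -mulrDr [_ + a * a]addrC e1; ring.
have Tle : 0 <= 4 - T * T.
  rewrite -(ler0z algC) e4 vv; case: Qb => r ->.
  apply: mulr_ge0; first exact: ler0n.
  apply: mulr_ge0; last exact: ler0n.
  by rewrite -rmorphM /= ler0q -expr2 sqr_ge0.
have Tc : [\/ T = 2 \/ T = -2, T = 0 | T = 1 \/ T = -1].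
  have : T = 2 \/ T = -2 \/ T = 0 \/ T = 1 \/ T = -1 by nia.
  by move=> [|[|[|[|]]]] ->; [constructor 1; left|constructor 1; right|constructor 2|constructor 3; left|constructor 3; right].
have aE : a = T%:~R / 2 by rewrite -TE mulrC mulKf ?two_neq0.
have bv : T * T = 4 -> b * v = 0.
  move=> TT; move: e4; rewrite TT subrr => /esym/eqP.
  rewrite mulf_eq0 pnatr_eq0 /= => /eqP e; apply/eqP; rewrite -[_ == 0]orbb -mulf_eq0.
  by rewrite mulrACA e.
case: Tc => [TT|T0|TT].
- have {}bv : b * v = 0 by apply: bv; case: TT => ->.
  have -> : Y = a by rewrite YE mulrCA bv mulr0 addr0.
  have h2 : 2%:~R / 2 = 1 :> algC by rewrite -[2%:~R]/(2%:R) divff ?two_neq0.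
  by rewrite aE; case: TT => ->; [left|right]; rewrite ?mulrNz ?mulNr h2.
- have : (b * v) * (b * v) = 1 * 1.
    by rewrite mulrACA mulr1 -e1 aE T0 mul0r mul0r add0r.
  have b0 : b * v != 0 -> False.
    move=> bv0; have b0 : b != 0 by apply: contraNneq bv0 => ->; rewrite mul0r.
    have : (b * v) * (b * v) = 1 * 1.
      by rewrite mulrACA mulr1 -e1 aE T0 mul0r mul0r add0r.
    case/sqr_pm => E; apply: nQ; have -> : v = b * v / b by rewrite mulrAC divff // mul1r.
      by rewrite E; sf_mem QQ_subfield.
    by rewrite E; sf_mem QQ_subfield.
  case/sqr_pm => E; exfalso; apply: b0; rewrite E ?oppr_eq0; exact: oner_neq0.
- exfalso; apply: (n3 (2 * b)); first by sf_mem QQ_subfield.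
  have -> : v * (2 * b) * (v * (2 * b)) = 4 * (b * b * (v * v)) by ring.
  by rewrite -e4; case: TT => ->.
Qed.

Lemma Qi_unit X : isU Qi X -> X ^+ 4 = 1.
Proof.
move=> UX; have [[a [b [Qa Qb XE]]] AX X0 _] := UX.
have cE : cj X = a - b * 'i by rewrite XE rmorphD rmorphM /= cj_i !fmorph_QQ // mulrN.
have nX : X * cj X = 1.
  have cjQi x : Qi x -> Qi (cj x).
    by apply: (adj_stable QQ_subfield); [exact: Q_stab|right; exact: cj_i].
  have UN := isUM sfQi _ _ UX (isU_aut cj _ cjQi UX).
  have [_ Qn] := adj_trace_norm _ _ _ cj QQ_subfield Q_i (fmorph_QQ cj) cj_i (let: And4 h _ _ _ := UX in h).
  have : isU QQ (X * cj X) by case: UN => *; split.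
  case/isU_QQ => // e; have : 0 <= X * cj X by rewrite cjE -normCK exprn_ge0.
  by rewrite e oppr_ge0 lt_geF ?ltr01.
have e1 : a * a + b * b = 1.
  rewrite -[RHS]nX cE XE.
  by transitivity (a * a - ('i * 'i) * (b * b)); [rewrite ii|]; ring.
have [||A AE] := QQ_Aint (2 * a).
- by sf_mem QQ_subfield.
- have -> : 2 * a = X + cj X by rewrite cE XE; ring.
  by rewrite rpredD // Aint_aut.
have e2 : 2 * b * (2 * b) = (4 - A * A)%:~R.
  rewrite rmorphB /= intrM -AE -[4%:~R]/(4%:R).
  by transitivity (4 * (a * a + b * b) - 2 * a * (2 * a)); [|rewrite e1]; ring.
have [||B BE] := QQ_Aint (2 * b).
- by sf_mem QQ_subfield.
- by apply: Aint_sqrt; rewrite e2 Aint_int.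
have AB : B * B = 4 - A * A by apply/eqP; rewrite -(eqr_int algC) -e2 intrM BE.
have aE : a = A%:~R / 2 by rewrite -AE mulrC mulKf ?two_neq0.
have bE : b = B%:~R / 2 by rewrite -BE mulrC mulKf ?two_neq0.
have i4 : 'i ^+ 4 = 1 :> algC by rewrite (exprM _ 2 2) sqrCi sqrrN expr1n.
have : (A = 0 /\ (B = 2 \/ B = -2)) \/ (B = 0 /\ (A = 2 \/ A = -2)).
  have hA : A = 0 \/ A = 1 \/ A = -1 \/ A = 2 \/ A = -2 by nia.
  have hB : B = 0 \/ B = 1 \/ B = -1 \/ B = 2 \/ B = -2 by nia.
  by move: hA hB AB => [|[|[|[|]]]] -> [|[|[|[|]]]] ->; lia.
have h2 : 2%:~R / 2 = 1 :> algC by rewrite -[2%:~R]/(2%:R) divff ?two_neq0.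
have h2' : (-2)%:~R / 2 = -1 :> algC by rewrite mulrNz mulNr h2.
rewrite XE aE bE; case=> -[-> [] ->]; rewrite ?mul0r ?add0r ?addr0 ?h2 ?h2' ?mul1r ?mulN1r //.
- by rewrite -[4%N]/(2 * 2)%N exprM sqrrN -exprM.
- by rewrite expr1n.
- by rewrite -[4%N]/(2 * 2)%N exprM sqrrN !expr1n.
Qed.

Lemma adj_iv (v : algC) x : QQ (v * v) -> adj Qi v x -> adj (adj QQ ('i * v)) 'i x.
Proof.
move=> Qv; have Qid : QQ ('i * v * ('i * v)).
  by rewrite mulrACA ii; sf_mem QQ_subfield.
have sA := adj_subfield QQ_subfield _ Qid.
have sM : subfield (adj (adj QQ ('i * v)) 'i).
  by apply: (adj_subfield sA); apply: (QQ_sub _ _ sA Q_i).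
have Mi : adj (adj QQ ('i * v)) 'i 'i by apply: (adj_gen sA).
apply: (adj_min _ _ _ sM).
  by move=> y; apply: (adj_min _ _ _ sM) => // z; apply: QQ_sub sM.
have E : v = ('i * v) / 'i by rewrite [RHS]mulrC mulKf ?i_neq0.
rewrite [X in adj _ _ X]E.
by apply: (sf_div sM) => //; apply: (adjS sA); exact: (adj_gen QQ_subfield).
Qed.

(** In a biquadratic field A^2 is the product of the relative norms of A to Q('i) and Q('i v),
    divided by a conjugate of [A * cj A] = 1. The first is a fourth root of unity, the second is
    ±1. *)
Lemma unit8 (v : algC) (n : nat) (tau : {rmorphism algC -> algC}) A :
  v * v = n%:R -> cj v = v -> ~ QQ v -> (forall q, QQ q -> v * q * (v * q) <> 3) ->
  tau v = - v -> tau 'i = 'i -> isU (adj Qi v) A -> cj (tau A) = tau (cj A) ->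
  A * cj A = 1 -> A ^+ 8 = 1.
Proof.
move=> vv cv nQ n3 tv ti UA cA nA; have [KA AA A0 AA'] := UA.
have Qv : QQ (v * v) by rewrite vv; sf_mem QQ_subfield.
have tA : tau A * cj (tau A) = 1 by rewrite cA -rmorphM /= nA rmorph1.
have X4 : (A * tau A) ^+ 4 = 1.
  apply: Qi_unit.
  have Qiv : Qi (v * v) by apply: (adjS QQ_subfield).
  have [_ QX] := adj_trace_norm _ _ _ tau sfQi Qiv (fun y => fix_Qi tau y ti) tv KA.
  by split=> //; rewrite ?mulf_neq0 ?fmorph_eq0 ?invfM -?fmorphV ?rpredM ?Aint_aut.
pose nu : {rmorphism algC -> algC} := cj \o tau.
have Y1 : A * cj (tau A) = 1 \/ A * cj (tau A) = -1.
  have Qid : QQ ('i * v * ('i * v)) by rewrite mulrACA ii; sf_mem QQ_subfield.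
  have sA := adj_subfield QQ_subfield _ Qid.
  have nuiv : nu ('i * v) = 'i * v.
    by rewrite /nu /= !rmorphM /= ti tv rmorphN /= cv cj_i mulrNN.
  have [_ QY] := adj_trace_norm _ _ _ nu sA (QQ_sub _ _ sA Q_i)
    (fun y => fix_QQ nu _ y nuiv) (etrans (congr1 cj ti) cj_i) (adj_iv v A Qv KA).
  apply: (imag_unit v n) => //; first by rewrite rpredM ?Aint_aut.
  by rewrite rmorphM /= (@conjCK _ (tau A)) mulrACA nA mulrC mulrC mul1r mulrC.
have -> : A ^+ 8 = (A * tau A) ^+ 4 * (A * cj (tau A)) ^+ 4 / (tau A * cj (tau A)) ^+ 4.
  have y0 : cj (tau A) != 0 by rewrite !fmorph_eq0.
  have x0 : tau A != 0 by rewrite fmorph_eq0.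
  by move: (cj (tau A)) (tau A) y0 x0 => y x y0 x0; field; rewrite x0 y0.
by rewrite X4 tA; case: Y1 => ->; rewrite ?expr1n ?divr1 ?mul1r // -[4%N]/(2*2)%N exprM sqrrN !expr1n.
Qed.

Lemma r2_no3 q : QQ q -> r2 * q * (r2 * q) <> 3.
Proof.
move=> Qq e; apply: (nQQ_2 (r2 * r2 * q) 3) => //.
  transitivity (r2 * r2 * (r2 * q * (r2 * q))); first by ring.
  by rewrite e sq_sq natrM.
by rewrite sq_sq; sf_mem QQ_subfield.
Qed.

Lemma rd_no3 q : QQ q -> rd * q * (rd * q) <> 3.
Proof.
move=> Qq e; apply: (nQQ_2 (rd * rd * q) (m * 3)).
- transitivity (rd * rd * (rd * q * (rd * q))); first by ring.
  by rewrite e rd_rd !natrM; ring.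
- by rewrite oddM odd_m.
- by rewrite rd_rd; sf_mem QQ_subfield.
Qed.

Lemma rm_no3 q : QQ q -> rm * q * (rm * q) <> 3.
Proof.
move=> Qq e; apply: (nQQ_p1 _ _ pp1 pp2 (p12 _ _ _ _ S) (rm * rm * q) 3).
- transitivity (rm * rm * (rm * q * (rm * q))); first by ring.
  by rewrite e sq_sq !natrM; ring.
- rewrite dvdn_prime2 //; have := p14 _ _ _ _ S.
  by apply: contra_eqN => /eqP ->.
- by rewrite sq_sq; sf_mem QQ_subfield.
Qed.

Lemma isU_in (K M : algC -> Prop) x : isU K x -> M x -> isU M x.
Proof. by case. Qed.

Lemma cj_sg x : L x -> cj (sg x) = sg (cj x).
Proof. by move=> Lx; rewrite !sgE cj_s ?cj_t //; apply: L_t. Qed.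

(** The same device one level up: w^2 times a conjugate of [w * sg w] equals
    [(w * t w) * (w * s w)], and each relative norm lies in a biquadratic field where [unit8]
    applies. *)
Lemma EL_norm1 w : isU L w -> w * cj w = 1 -> w ^+ 16 = 1.
Proof.
move=> Uw nw; have [Lw _ w0 _] := Uw.
have Lt := L_t _ Lw; have Ls := L_s _ Lw; have Lsg := L_sg _ Lw.
have Ut : isU L (t w) := isU_aut t _ L_t Uw.
have Us : isU L (s w) := isU_aut s _ L_s Uw.
have Usg : isU L (sg w) := isU_aut sg _ L_sg Uw.
have nrm (nu : {rmorphism algC -> algC}) : cj (nu w) = nu (cj w) -> w * nu w * cj (w * nu w) = 1.
  by move=> c; rewrite rmorphM /= -/(cj _) -[(nu w)^*]/(cj (nu w)) c mulrACA nw -rmorphM nw rmorph1 mulr1.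
have A8 : (w * t w) ^+ 8 = 1.
  have LA : L (w * t w) by apply: (sfM _ sfL).
  apply: (unit8 r2 2 s _ (sq_sq 2) cj_r2 nQ_r2 r2_no3 (s_r2 _ _ _ _ S) (s_i _ _ _ _ S)).
  - apply: (isU_in _ _ _ (isUM sfL _ _ Uw Ut)); apply: in_B2 => //.
    by rewrite rmorphM /= tt // mulrC.
  - exact: cj_s.
  - by apply: nrm; apply: cj_t.
have B8 : (w * s w) ^+ 8 = 1.
  have LA : L (w * s w) by apply: (sfM _ sfL).
  apply: (unit8 rm m t _ (sq_sq m) cj_rm nQ_rm rm_no3 (t_rm _ _ _ _ S) (t_i _ _ _ _ S)).
  - apply: (isU_in _ _ _ (isUM sfL _ _ Uw Us)); apply: in_Bm => //.
    by rewrite rmorphM /= ss // mulrC.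
  - exact: cj_t.
  - by apply: nrm; apply: cj_s.
have C8 : (w * sg w) ^+ 8 = 1.
  have LA : L (w * sg w) by apply: (sfM _ sfL).
  apply: (unit8 rd (2 * m) s _ rd_rd cj_rd nQ_rd rd_no3 s_rd (s_i _ _ _ _ S)).
  - apply: (isU_in _ _ _ (isUM sfL _ _ Uw Usg)); apply: in_k => //.
    by rewrite (rmorphM sg) sgsg // mulrC.
  - exact: cj_s.
  - by apply: nrm; apply: cj_sg.
have E : w ^+ 2 * s (w * sg w) = w * t w * (w * s w).
  by rewrite rmorphM /= ss //; ring.
have sC8 : s (w * sg w) ^+ 8 = 1 by rewrite -rmorphXn C8 rmorph1.
have : w ^+ 16 * s (w * sg w) ^+ 8 = (w * t w) ^+ 8 * (w * s w) ^+ 8.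
  by rewrite -[RHS]exprMn -E exprMn -exprM.
by rewrite sC8 A8 B8 !mulr1.
Qed.

(** There is no primitive 16th root of unity w in L. With y = w^2 one has s y = ± y: if s y = y,
    then y + 1/y is ± sqrt 2 yet fixed by [s]; if s y = - y, then s w = ± 'i w and s would not be an
    involution on w. *)
Lemma EL_norm1_8 w : isU L w -> w * cj w = 1 -> w ^+ 8 = 1.
Proof.
move=> Uw nw; have w16 := EL_norm1 _ Uw nw; have [Lw _ w0 _] := Uw.
have [//|w8] : w ^+ 8 = 1 \/ w ^+ 8 = -1.
  by apply: sqr_pm; rewrite mulr1 -expr2 -exprM.
exfalso; pose y := w * w.
have y0 : y != 0 by rewrite mulf_neq0.
have yy : y * y = 'i \/ y * y = - 'i.
  by apply: sqr_pm; rewrite ii -w8 /y; ring.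
have syy : s (y * y) = y * y by case: yy => ->; rewrite ?rmorphN /= (s_i _ _ _ _ S).
have : s y = y \/ s y = - y by apply: sqr_pm; rewrite -rmorphM.
case=> sy.
  have : (y + y^-1) * (y + y^-1) = r2 * r2.
    have -> : (y + y^-1) * (y + y^-1) = y * y + 2 + (y * y)^-1 by field.
    rewrite sq_sq; have -> : (y * y)^-1 = - (y * y).
      apply: (mulfI (mulf_neq0 y0 y0)); rewrite divff ?mulf_neq0 // mulrN.
      by case: yy => ->; rewrite ?mulrNN ii opprK.
    by ring.
  have r20 : r2 = - r2 -> False.
    move=> /eqP; rewrite -subr_eq0 opprK -mulr2n mulrn_eq0 /= => /eqP h.
    by have := r2_neq0; rewrite h eqxx.
  have st : s (y + y^-1) = y + y^-1 by rewrite rmorphD fmorphV /= sy.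
  case/sqr_pm => h; rewrite h ?rmorphN /= (s_r2 _ _ _ _ S) in st; first exact: r20 (esym st).
  by apply: r20; rewrite -[LHS]opprK st.
have : s w * s w = ('i * w) * ('i * w) by rewrite -rmorphM /= -/y sy mulrACA ii mulN1r.
have nw0 : w = - w -> False.
  move=> /eqP; rewrite -subr_eq0 opprK -mulr2n mulrn_eq0 /= => /eqP h.
  by rewrite h eqxx in w0.
case/sqr_pm => h; apply: nw0; rewrite -{1}(ss w Lw) h ?rmorphN rmorphM /= (s_i _ _ _ _ S) h.
  by rewrite mulrA ii mulN1r.
by rewrite mulrN opprK mulrA ii mulN1r.
Qed.

Definition zeta : algC := (1 + 'i) / r2.

Lemma zeta_sq : zeta * zeta = 'i.
Proof.
have -> : zeta * zeta = (1 + 2 * 'i + 'i * 'i) / (r2 * r2) by rewrite /zeta; field; exact: r2_neq0.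
by rewrite ii sq_sq addrAC subrr add0r mulrC mulKf ?two_neq0.
Qed.

Lemma zeta_neq0 : zeta != 0.
Proof. by apply/eqP => h; have := zeta_sq; rewrite h mulr0 => /esym/eqP; rewrite (negPf i_neq0). Qed.

Lemma L_zeta : L zeta.
Proof.
have := L_i; have := L_r2 => Lr Li; rewrite /zeta; sf_mem sfL.
Qed.

Lemma isU_i (K : algC -> Prop) : subfield K -> K 'i -> isU K 'i.
Proof.
move=> sK Ki; split=> //; [exact: Aint_i|exact: i_neq0|].
have -> : 'i^-1 = - 'i :> algC by apply: (mulfI i_neq0); rewrite divff ?i_neq0 // mulrN ii opprK.
by rewrite rpredN Aint_i.
Qed.

Lemma isU_zeta : isU L zeta.
Proof.
by apply: isU_sqrt L_zeta _; rewrite zeta_sq; apply: isU_i; [exact: sfL|exact: L_i].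
Qed.

Lemma s_zeta : s zeta = - zeta.
Proof. by rewrite /zeta rmorphM fmorphV rmorphD rmorph1 /= (s_i _ _ _ _ S) (s_r2 _ _ _ _ S) invrN mulrN. Qed.
Lemma t_zeta : t zeta = zeta.
Proof. by rewrite /zeta rmorphM fmorphV rmorphD rmorph1 /= (t_i _ _ _ _ S) (t_r2 _ _ _ _ S). Qed.
Lemma sg_zeta : sg zeta = - zeta. Proof. by rewrite sgE t_zeta s_zeta. Qed.
Lemma cj_zeta : cj zeta = zeta^-1.
Proof.
apply: (mulfI zeta_neq0); rewrite divff ?zeta_neq0 //.
rewrite {2}/zeta (rmorphM cj) (fmorphV cj) (rmorphD cj) (rmorph1 cj) cj_i cj_r2 /zeta.
have -> : (1 + 'i) / r2 * ((1 - 'i) / r2) = (1 - 'i * 'i) / (r2 * r2) by field; exact: r2_neq0.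
by rewrite ii sq_sq opprK divff ?two_neq0.
Qed.

Lemma mu4 (x : algC) : x ^+ 4 = 1 -> exists l : nat, x = 'i ^+ l.
Proof.
move=> x4; have : x * x = 1 * 1 \/ x * x = 'i * 'i.
  by rewrite ii mulr1; apply: sqr_pm; rewrite mulr1 -x4; ring.
case=> /sqr_pm [] ->.
- by exists 0%N.
- by exists 2%N; rewrite sqrCi.
- by exists 1%N.
- by exists 3%N; rewrite exprS sqrCi mulrN1.
Qed.

Lemma mu8 (x : algC) : x ^+ 8 = 1 -> exists l : nat, x = 'i ^+ l \/ x = zeta * 'i ^+ l.
Proof.
move=> x8; have : x ^+ 4 = 1 \/ x ^+ 4 = -1.
  by apply: sqr_pm; rewrite mulr1 -x8; ring.
case=> [/mu4 [l ->]|x4]; first by exists l; left.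
have [|l e] := mu4 (x / zeta).
  rewrite exprMn x4 exprVn; have -> : zeta ^+ 4 = (zeta * zeta) * (zeta * zeta) by ring.
  by rewrite zeta_sq ii invrN1 mulrNN mulr1.
by exists l; right; rewrite -e mulrC divfK ?zeta_neq0.
Qed.

Lemma QQ_sqr_N1 q : QQ q -> q * q <> -1.
Proof.
move=> [r ->] h; apply: (nQQ_neg (ratr r)); first by rewrite h oppr_lt0 ltr01.
by exists r.
Qed.

(** The norm C of u to k satisfies C = - 'i conj(C), so r = C / (1 - 'i) is real and 2 r^2 = 'i C^2
    is a unit of Q(sqrt(2p1p2)). It has norm 1, hence is ± a square v^2, and (2r)^2 = ± 2 v^2
    contradicts [no_sq_d]. *)
Lemma no_zeta_unit u : isU L u -> u <> zeta * cj u.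
Proof.
move=> Uu ue; have [Lu _ u0 _] := Uu; pose C := u * sg u.
have UC : isU L C by apply: (isUM sfL) => //; apply: (isU_aut sg _ L_sg Uu).
have LC : L C by case: UC.
have C0 : C != 0 by case: UC.
have kC : k C by apply: in_k => //; rewrite /C (rmorphM sg) sgsg // mulrC.
have CE : C = - 'i * cj C.
  have e1 : sg u = - zeta * sg (cj u) by rewrite {1}ue (rmorphM sg) sg_zeta.
  rewrite /C (rmorphM cj) cj_sg // -zeta_sq.
  by transitivity (zeta * cj u * (- zeta * sg (cj u))); [congr (_ * _)|ring].
have ki := k_i; pose r := C / (1 - 'i).
have i1 : 1 - 'i != 0 :> algC.
  apply/eqP => h; have := ii; have -> : 'i = 1 :> algC by apply/eqP; rewrite eq_sym -subr_eq0 h.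
  by rewrite mulr1 => /eqP; rewrite -subr_eq0 opprK -mulr2n pnatr_eq0.
have i2 : 1 + 'i != 0 :> algC.
  apply/eqP => h; have := ii; have -> : 'i = -1 :> algC by apply/eqP; rewrite -addr_eq0 addrC h.
  by rewrite mulrNN mulr1 => /eqP; rewrite -subr_eq0 opprK -mulr2n pnatr_eq0.
have kr : k r by rewrite /r; sf_mem sfk.
have cr : cj r = r.
  rewrite /r (rmorphM cj) (fmorphV cj) (rmorphB cj) (rmorph1 cj) cj_i opprK.
  rewrite [in RHS]CE; have -> : - 'i * cj C / (1 - 'i) = cj C / (1 + 'i) * ((- 'i - 'i * 'i) / (1 - 'i)).
    by field; rewrite i1 i2.
  by rewrite ii opprK [- 'i + 1]addrC divff // mulr1.
have Qr : Qd r.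
  apply: in_Qd; last by apply: (fix_k _ _ sg_rd sg_i).
  by apply: in_F => //; apply: k_L.
have yE : 2 * (r * r) = C * C * 'i.
  have -> : 2 * (r * r) = C * C * (2 / ((1 - 'i) * (1 - 'i))) by rewrite /r; field.
  congr (_ * _); have -> : (1 - 'i) * (1 - 'i) = 1 - 2 * 'i + 'i * 'i :> algC by ring.
  rewrite ii; have -> : 1 - 2 * 'i + -1 = - (2 * 'i) :> algC by ring.
  apply: (mulfI (_ : - (2 * 'i) != 0)); first by rewrite oppr_eq0 mulf_neq0 ?two_neq0 ?i_neq0.
  rewrite mulrC divfK ?oppr_eq0 ?mulf_neq0 ?two_neq0 ?i_neq0 //.
  by rewrite mulNr -mulrA ii mulrN1 opprK.
have Uy : isU Qd (2 * (r * r)).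
  apply: (isU_in L); last by sf_mem sfQd.
  rewrite yE; do 2?[apply: (isUM sfL) => //].
  by apply: isU_i; [exact: sfL|exact: L_i].
have ny : 2 * (r * r) * s (2 * (r * r)) = 1.
  have [_ Qn] := adj_trace_norm _ _ _ s QQ_subfield Q_rd (fmorph_QQ s) s_rd Qr.
  case: (quad_norm _ _ s rd_rd s_rd _ Uy) => // h; exfalso.
  apply: (QQ_sqr_N1 (2 * (r * s r))); first by sf_mem QQ_subfield.
  by rewrite -h !rmorphM /= rmorph_nat; ring.
have [v Uv vE] := norm1_d _ Uy ny.
apply: (no_sq_d (2 * r) (v * v) 2); [by sf_mem sfQd|exact: (isUM sfQd)|by constructor|].
have -> : 2 * r * (2 * r) = 2 * (2 * (r * r)) by ring.
by case: vE => ->; [left|right]; ring.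
Qed.

(** The quotient of u by its conjugate is an eighth root of unity. When it is a power of 'i, a power
    of [zeta] makes u real; the other coset is excluded by [no_zeta_unit]. *)
Lemma EL u : isU L u -> exists l v, isU F v /\ u = zeta ^+ l * v.
Proof.
move=> Uu; have [Lu _ u0 _] := Uu.
have Uc : isU L (cj u) := isU_aut cj _ L_cj Uu.
have c0 : cj u != 0 by case: Uc.
have nw : u / cj u * cj (u / cj u) = 1.
  have cc : cj (cj u) = u := conjCK u.
  by rewrite (rmorphM cj) (fmorphV cj) cc; field; rewrite u0 c0.
have [l hl] := mu8 _ (EL_norm1_8 _ (isU_div sfL _ _ Uu Uc) nw).
have Uv : isU L (u / zeta ^+ l) by apply: (isU_div sfL) => //; apply: (isUX sfL); exact: isU_zeta.
have zl0 : zeta ^+ l != 0 by rewrite expf_neq0 ?zeta_neq0.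
have cv : cj (u / zeta ^+ l) = cj u * zeta ^+ l.
  by rewrite (rmorphM cj) (fmorphV cj) (rmorphXn cj) cj_zeta exprVn invrK.
have il : 'i ^+ l = zeta ^+ l * zeta ^+ l by rewrite -exprMn zeta_sq.
case: hl => /(canRL (divfK c0)) uE.
  exists l, (u / zeta ^+ l); split; last by rewrite mulrC divfK.
  apply: (isU_in L) => //; apply: in_F; first by case: Uv.
  by rewrite cv [in RHS]uE il; field.
case: (no_zeta_unit _ Uv); rewrite cv [in LHS]uE il; by field.
Qed.

(** * Units of F of relative norm 1 *)

Lemma t_Qd x : Qd x -> t x = s x.
Proof. by apply: (adj_id _ _ t s); [move=> y; apply: QQ_id|rewrite s_rd t_rd]. Qed.
Lemma t_Q2 x : Q2 x -> t x = x. Proof. exact: (fix_Q2 t _ (t_r2 _ _ _ _ S)). Qed.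
Lemma s_Qm x : Qm x -> s x = x. Proof. exact: (fix_Qm s _ (s_rm _ _ _ _ S)). Qed.
Lemma sg_Q2 x : Q2 x -> sg x = s x. Proof. by move=> h; rewrite sgE t_Q2. Qed.
Lemma sg_Qm x : Qm x -> sg x = t x. Proof. by move=> h; rewrite sgE s_Qm //; apply: Qm_t. Qed.
Lemma sg_Qd x : Qd x -> sg x = x. Proof. exact: (fix_Qd sg _ sg_rd). Qed.

Lemma norm_Q2 a : isU Q2 a -> a * s a = 1 \/ a * s a = -1.
Proof. exact: (quad_norm 2 r2 s (sq_sq 2) (s_r2 _ _ _ _ S)). Qed.
Lemma norm_Qm a : isU Qm a -> a * t a = 1 \/ a * t a = -1.
Proof. exact: (quad_norm m rm t (sq_sq m) (t_rm _ _ _ _ S)). Qed.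
Lemma norm_Qd a : isU Qd a -> a * s a = 1 \/ a * s a = -1.
Proof. exact: (quad_norm (2 * m) rd s rd_rd s_rd). Qed.

Lemma N1_neq1 : -1 <> 1 :> algC.
Proof. by apply/eqP; rewrite lt_eqF // (lt_trans (ltrN10 _)) ?ltr01. Qed.

Lemma pm_inv (x y : algC) : x * y = -1 -> y = - x^-1.
Proof.
move=> h; have x0 : x != 0.
  apply/eqP => x0; move: h; rewrite x0 mul0r => /eqP; rewrite eq_sym oppr_eq0 oner_eq0 //.
by apply: (mulfI x0); rewrite h mulrN divff.
Qed.

(** Otherwise [y * r2] would lie in Q(sqrt(p1p2)) with square 2 times a unit, against [no_sq_m]. *)
Lemma sqrt_Qm_unit y : isU F y -> Qm (y * y) -> isU Qm y.
Proof.
move=> Uy Qyy; have [Fy _ _ _] := Uy.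
have UyF := isUM sfF _ _ Uy Uy; have Uyy := isU_in _ _ _ UyF Qyy.
have [Qy|Qy] := sqrt_Qm y Fy Qyy; first exact: isU_in Uy Qy.
exfalso; apply: (no_sq_m _ (y * y) Qy Uyy); left.
by rewrite mulrACA sq_sq mulrC.
Qed.

Lemma sqc_norm1_m v : isU Qm v -> v * t v = 1 -> sqc 1 v \/ sqc p1 v.
Proof.
move=> Uv nv; have [Kv _ v0 _] := Uv; have Fv := Qm_F _ Kv.
(* Hilbert 90 uses 1 + v, whose square is (Tr v + 2) v; this degenerates at v = -1. *)
have [->|v1] := eqVneq v (-1).
  by left; exists 1; [exact: (sf1 _ sfF)|right; ring].
have [Qtr _] := adj_trace_norm _ _ _ t QQ_subfield Q_rm (fmorph_QQ t) (t_rm _ _ _ _ S) Kv.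
apply: (sqc_rat (1 + v) (v + t v + 2)); [by sf_mem sfF| |by sf_mem QQ_subfield| |].
- by apply: contra_neq v1 => /eqP; rewrite addrC addr_eq0 => /eqP.
- exact: isU_sub Qm_F Uv.
- by transitivity (1 + 2 * v + v * v); [ring|rewrite -{1}nv; ring].
Qed.

(** For x = a v e the conjugates of x are v^2/x, a^2/x and e^2/x, so a sum of conjugates of sqrt x,
    with signs, is sqrt x times an element of F. Its square is rational, and [sqc_rat] applies as
    soon as it is nonzero. *)
Lemma sqc_norm_N1 a v e : isU Q2 a -> isU Qm v -> isU Qd e ->
  a * s a = -1 -> v * t v = -1 -> e * s e = -1 ->
  sqc 1 (a * v * e) \/ sqc p1 (a * v * e).
Proof.
move=> Ua Uv Ue na nv ne.
have [Ka _ a0 _] := Ua; have [Kv _ v0 _] := Uv; have [Ke _ e0 _] := Ue.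
have Fa := Q2_F _ Ka; have Fv := Qm_F _ Kv; have Fe := Qd_F _ Ke.
set x := a * v * e.
have Ux : isU F x.
  by apply: (isUM sfF); [apply: (isUM sfF)|]; [exact: isU_sub Q2_F Ua|exact: isU_sub Qm_F Uv|exact: isU_sub Qd_F Ue].
have [Fx _ x0 _] := Ux.
have [Ta _] := adj_trace_norm _ _ _ s QQ_subfield Q_r2 (fmorph_QQ s) (s_r2 _ _ _ _ S) Ka.
have [Tv _] := adj_trace_norm _ _ _ t QQ_subfield Q_rm (fmorph_QQ t) (t_rm _ _ _ _ S) Kv.
have [Te _] := adj_trace_norm _ _ _ s QQ_subfield Q_rd (fmorph_QQ s) s_rd Ke.
have Tx : QQ (a * v * e + v * s a * s e + a * t v * s e + e * s a * t v).
  have [a1 [a2 [Q1 Q1' aE]]] := Ka; have [v1 [v2 [Q2' Q2'' vE]]] := Kv.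
  have [e1 [e2 [Q3 Q3' eE]]] := Ke.
  have -> : a * v * e + v * s a * s e + a * t v * s e + e * s a * t v =
     4 * (a1 * v1 * e1) + 4 * (a2 * v2 * e2) * (rd * rd).
    rewrite aE vE eE (rmorphD s) (rmorphM s a2) (s_r2 _ _ _ _ S) (rmorphD t) (rmorphM t v2) (t_rm _ _ _ _ S).
    rewrite (rmorphD s e1) (rmorphM s e2 rd) s_rd !fmorph_QQ //; ring.
  by rewrite rd_rd; sf_mem QQ_subfield.
have sa := pm_inv _ _ na; have tv := pm_inv _ _ nv; have se := pm_inv _ _ ne.
(* [T l1 l2] is that sum divided by sqrt x; the sign of the last term makes [x * T^2] rational. *)
pose T (l1 l2 : algC) := 1 + l1 * (v / x) + l2 * (a / x) - l1 * l2 * (e / x).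
have key l1 l2 : l1 = 1 \/ l1 = -1 -> l2 = 1 \/ l2 = -1 -> QQ (x * (T l1 l2 * T l1 l2)).
  move=> h1 h2.
  have -> : x * (T l1 l2 * T l1 l2) =
      (a * v * e + v * s a * s e + a * t v * s e + e * s a * t v) +
      2 * (l1 * (v + t v) + l2 * (a + s a) - l1 * l2 * (e + s e)).
    rewrite sa tv se /T /x; case: h1 => ->; case: h2 => ->; field; by rewrite a0 v0 e0.
  have Q1 : QQ l1 by case: h1 => ->; sf_mem QQ_subfield.
  have Q2 : QQ l2 by case: h2 => ->; sf_mem QQ_subfield.
  by sf_mem QQ_subfield.
have fin l1 l2 : l1 = 1 \/ l1 = -1 -> l2 = 1 \/ l2 = -1 -> T l1 l2 != 0 ->
    sqc 1 x \/ sqc p1 x.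
  move=> h1 h2 T0; apply: (sqc_rat (T l1 l2 * x) _ _ _ _ (key _ _ h1 h2) Ux).
  - rewrite /T; have F1 : F l1 by case: h1 => ->; sf_mem sfF.
    have F2 : F l2 by case: h2 => ->; sf_mem sfF.
    by sf_mem sfF.
  - by rewrite mulf_neq0.
  - by ring.
(* The four sign choices add up to 4, so one of them is nonzero. *)
have sum4 : T 1 1 + T 1 (-1) + T (-1) 1 + T (-1) (-1) = 4 by rewrite /T; ring.
have [T1|/fin] := eqVneq (T 1 1) 0; last by apply; left.
have [T2|/fin] := eqVneq (T 1 (-1)) 0; last by apply; auto.
have [T3|/fin] := eqVneq (T (-1) 1) 0; last by apply; auto.
have [T4|/fin] := eqVneq (T (-1) (-1)) 0; last by apply; auto.
by move/eqP: sum4; rewrite T1 T2 T3 T4 !addr0 eq_sym pnatr_eq0.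
Qed.

(** The unit [v * t v] of Q(sqrt 2) has norm 1, so it is ± a^2, and v = a w with w a unit of
    Q(sqrt(p1p2)) whose norm equals that of a. If both norms are 1 take x = v; if both are -1 take x
    = a w e with e of norm -1 in Q(sqrt(2p1p2)). *)
Lemma sqc_v v : isU F v -> v * sg v = 1 ->
  exists2 x, isU F x & (sqc 1 x \/ sqc p1 x) /\ x = v * v * sg x.
Proof.
move=> Uv nv; have [Fv _ v0 _] := Uv; have Lv := F_L _ Fv.
have Ut : isU F (t v) := isU_aut t _ F_t Uv.
have Us : isU F (s v) := isU_aut s _ F_s Uv.
have ts1 : t v * s v = 1.
  by rewrite -[s v](tt _ (L_s _ Lv)) ts // -sgE -rmorphM /= nv rmorph1.
have Ua : isU Q2 (v * t v).
  apply: (isU_in F); first exact: (isUM sfF).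
  apply: in_Q2; first by apply: (sfM _ sfF) => //; apply: F_t.
  by rewrite rmorphM /= tt // mulrC.
have na : v * t v * s (v * t v) = 1.
  by rewrite rmorphM /= -sgE mulrACA [t v * sg v]mulrC mulrACA nv mul1r mulrC.
have [a Ua' aE] := norm1_2 _ Ua na; have [Ka _ a0 _] := Ua'.
have UaF : isU F a := isU_sub _ _ _ Q2_F Ua'.
pose w := v / a; have Uw : isU F w by apply: (isU_div sfF).
have ww : w * w = v * s v \/ w * w = - (v * s v).
  have tE : t v = (s v)^-1.
    have [_ _ s0 _] := Us.
    by apply: (mulIf s0); rewrite ts1 mulVf.
  have -> : w * w = v * v / (a * a) by rewrite /w; field.
  have [_ _ s0 _] := Us.
  case: aE => /esym aE; [left|right].
    by rewrite aE tE; field; rewrite v0 s0.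
  by rewrite -[a * a]opprK aE tE; field; rewrite v0 s0.
have Qww : Qm (w * w).
  have Qs : Qm (v * s v).
    apply: in_Qm; first by apply: (sfM _ sfF) => //; apply: F_s.
    by rewrite rmorphM /= ss // mulrC.
  by case: ww => ->; sf_mem sfQm.
have Uwm := sqrt_Qm_unit _ Uw Qww; have [Kw _ w0 _] := Uwm.
have vE : v = a * w by rewrite /w mulrC divfK.
clearbody w.
have nn : (a * s a) * (w * t w) = 1.
  by rewrite -[RHS]nv vE (rmorphM sg) sg_Q2 // sg_Qm //; ring.
have [na'|na'] := norm_Q2 _ Ua'.
  have nw : w * t w = 1 by rewrite -nn na' mul1r.
  exists v => //; split; last by rewrite -mulrA nv mulr1.
  have [b Ub bE] := norm1_2 _ Ua' na'; have [Kb _ b0 _] := Ub; have Fb := Q2_F _ Kb.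
  have aux c : sqc c w -> sqc c v.
    case=> g Fg gg; exists (b * g); first by sf_mem sfF.
    rewrite vE mulrACA; case: bE => ->; case: gg => ->; [left|right|right|left]; ring.
  by case: (sqc_norm1_m _ Uwm nw) => /aux; [left|right].
have nw : w * t w = -1 by apply: oppr_inj; rewrite opprK -nn na' mulN1r.
have [e Ue ne] := ed_exists; have [Ke _ e0 _] := Ue.
exists (a * w * e).
  by apply: (isUM sfF); [rewrite -vE|exact: isU_sub Qd_F Ue].
split; first exact: sqc_norm_N1.
rewrite !(rmorphM sg) (sg_Q2 a) // (sg_Qm w) // (sg_Qd e) // (pm_inv _ _ na') (pm_inv _ _ nw) vE.
by field; rewrite a0 w0.
Qed.

(** Explicit Hilbert 90 for [sg] up to sign: x = v^2 sg(x) is taken to square roots, keeping g^2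
    equal to a unit or p1 times a unit. *)
Lemma core v : isU F v -> v * sg v = 1 -> exists c g x, [/\ c = 1%N \/ c = p1, F g, isU F x,
   g * g = c%:R * x \/ g * g = - (c%:R * x) & g = v * sg g \/ g = - (v * sg g)].
Proof.
move=> Uv nv; have [x Ux [sx xE]] := sqc_v _ Uv nv.
have th c : c = 1%N \/ c = p1 -> sqc c x -> exists c g x, [/\ c = 1%N \/ c = p1, F g, isU F x,
   g * g = c%:R * x \/ g * g = - (c%:R * x) & g = v * sg g \/ g = - (v * sg g)].
  move=> hc [g Fg gg]; exists c, g, x; split=> //; apply: sqr_pm.
  have -> : v * sg g * (v * sg g) = v * v * sg (g * g) by rewrite (rmorphM sg); ring.
  have cc : sg c%:R = c%:R by rewrite rmorph_nat.
  by case: gg => ->; rewrite ?(rmorphN sg) (rmorphM sg c%:R x) cc {1}xE; ring.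
by case: sx; apply: th; auto.
Qed.

(** * The unit index and p1 times a unit being a square *)

(** The subgroup of the units of F whose index is q. *)
Definition Hdec (x : algC) : Prop := exists a b c, [/\ isU Q2 a, isU Qm b, isU Qd c & x = a * b * c].

(** Start from a unit e of Q(sqrt(p1p2)) that is not ± a square. If its norm is 1, only the p1
    alternative survives. If it is -1, use x = (1 + sqrt 2) e d with d of norm -1: were x = ± g^2,
    decomposing g = a1 b1 c1 and taking norms to Q(sqrt 2) would give 1 + sqrt 2 = ± a1^2, against
    its norm -1. *)
Lemma q1_sqc : (forall x, isU F x -> Hdec x) -> exists2 x, isU F x & sqc p1 x.
Proof.
move=> all; have [e Ue ne] := unit_not_square _ _ t (sq_sq m) rm_gt0 nQ_rm (t_rm _ _ _ _ S).
have UeF := isU_sub _ _ _ Qm_F Ue; have [Ke _ e0 _] := Ue.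
have [n1|n1] := norm_Qm _ Ue.
  case: (sqc_norm1_m _ Ue n1); last by exists e.
  case=> g Fg; rewrite mul1r => gg; exfalso.
  have Ug : isU F g by apply: (isU_sqrt _ Fg); case: gg => ->; [|apply: (isUN sfF)].
  have Ugm : isU Qm g by apply: sqrt_Qm_unit => //; case: gg => ->; sf_mem sfQm.
  have [h1 h2] := ne _ Ugm; case: gg => h; [exact: h1|apply: h2].
  by rewrite h opprK.
have [d Ud nd] := ed_exists.
pose a := 1 + r2.
have na : a * s a = -1.
  rewrite /a rmorphD rmorph1 /= (s_r2 _ _ _ _ S).
  by transitivity (1 - r2 * r2); [ring|rewrite sq_sq; ring].
have a0 : a != 0 by rewrite gt_eqF // addr_gt0 ?ltr01 ?r2_gt0.
have Ua : isU Q2 a.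
  have Ae : a \in Aint by rewrite rpredD ?Aint1 ?Aint_sq.
  split=> //.
    by apply: (sfD sfQ2); [exact: (sf1 _ sfQ2)|exact: (adj_gen QQ_subfield)].
  have -> : a^-1 = - s a by rewrite (pm_inv _ _ na) opprK.
  by rewrite rpredN Aint_aut.
have [Ka _ _ _] := Ua; have [Kd _ _ _] := Ud.
have Ux : isU F (a * e * d).
  by apply: (isUM sfF); [apply: (isUM sfF) => //|]; [exact: isU_sub Q2_F Ua|exact: isU_sub Qd_F Ud].
case: (sqc_norm_N1 _ _ _ Ua Ue Ud na n1 nd); last by exists (a * e * d).
case=> g Fg; rewrite mul1r => gg; exfalso.
have Ug : isU F g by apply: (isU_sqrt _ Fg); case: gg => ->; [|apply: (isUN sfF)].
have [a1 [b1 [c1 [Ua1 Ub1 Uc1 gE]]]] := all _ Ug.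
have [Ka1 _ _ _] := Ua1; have [Kb1 _ _ _] := Ub1; have [Kc1 _ _ _] := Uc1.
have e1 : (g * t g) * (g * t g) = (a * a) * (e * t e) * (d * s d).
  have -> : g * t g * (g * t g) = (g * g) * t (g * g) by rewrite rmorphM /=; ring.
  by case: gg => ->; rewrite ?rmorphN !rmorphM /= (t_Q2 a) // (t_Qd d) //; ring.
have e2 : g * t g = a1 * a1 * (b1 * t b1) * (c1 * s c1).
  by rewrite gE !rmorphM /= (t_Q2 a1) // (t_Qd c1) //; ring.
have e3 : (a1 * a1) * (a1 * a1) = a * a.
  rewrite n1 nd mulrN1 mulrN1 opprK in e1; rewrite -e1 e2.
  by case: (norm_Qm _ Ub1) => ->; case: (norm_Qd _ Uc1) => ->; ring.
apply: N1_neq1; rewrite -na.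
have sq1 : (a1 * s a1) * (a1 * s a1) = 1 by case: (norm_Q2 _ Ua1) => ->; ring.
by rewrite -sq1; case: (sqr_pm _ _ e3) => /esym; [|move/(canRL (@opprK _))]; move=> ->; rewrite ?rmorphN rmorphM /=; ring.
Qed.

Lemma real_sq x : F x -> x * x <> -1.
Proof.
move=> /cj_F cx h; have : 0 <= x * x by rewrite -{2}cx cjE -normCK exprn_ge0.
by rewrite h oppr_ge0 lt_geF ?ltr01.
Qed.

Lemma s_mul_sg x : L x -> s (x * sg x) = s x * t x.
Proof. by move=> Lx; rewrite (rmorphM s) sgE (ss _ (L_t _ Lx)). Qed.

Lemma unit_sq_dec x : isU F x ->
  [/\ isU Q2 (x * t x), isU Qm (x * s x), isU Qd (x * sg x) &
    x * x * s (x * sg x) = (x * t x) * (x * s x)].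
Proof.
move=> Ux; have [Fx _ _ _] := Ux; have Lx := F_L _ Fx.
split; last by rewrite s_mul_sg //; ring.
- apply: (isU_in F); first by apply: (isUM sfF) => //; apply: isU_aut F_t Ux.
  by apply: in_Q2; [apply: (sfM _ sfF) => //; apply: F_t|rewrite rmorphM /= tt // mulrC].
- apply: (isU_in F); first by apply: (isUM sfF) => //; apply: isU_aut F_s Ux.
  by apply: in_Qm; [apply: (sfM _ sfF) => //; apply: F_s|rewrite rmorphM /= ss // mulrC].
- apply: (isU_in F); first by apply: (isUM sfF) => //; apply: (isU_aut sg _ F_sg Ux).
  by apply: in_Qd; [apply: (sfM _ sfF) => //; apply: F_sg|rewrite (rmorphM sg) sgsg // mulrC].
Qed.

(** In the identity of [unit_sq_dec] the factors from Q(sqrt 2) and Q(sqrt(2p1p2)) have norm 1, so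
    they are ± squares a^2 and c^2; then x c / a has its square in Q(sqrt(p1p2)) and lies there by
    [sqrt_Qm_unit]. *)
Lemma Hdec_norm1 x : isU F x -> x * t x * s (x * t x) = 1 -> Hdec x.
Proof.
move=> Ux n1; have [Fx _ x0 _] := Ux; have Lx := F_L _ Fx.
have [Ut Us Usg E] := unit_sq_dec _ Ux.
have [Kt _ _ _] := Ut; have [Ks _ _ _] := Us.
have [a Ua aE] := norm1_2 _ Ut n1; have [Ka _ a0 _] := Ua.
have nsg : s (x * sg x) * s (s (x * sg x)) = 1.
  by rewrite s_mul_sg // (rmorphM s (s x)) ss // -n1 (rmorphM s x); ring.
have [c Uc cE] := norm1_d _ (isU_aut s _ Qd_s Usg) nsg; have [Kc _ c0 _] := Uc.
have UaF := isU_sub _ _ _ Q2_F Ua; have UcF := isU_sub _ _ _ Qd_F Uc.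
pose y := x * c / a.
have Uy : isU F y by apply: (isU_div sfF) => //; apply: (isUM sfF).
have Qyy : Qm (y * y).
  have -> : y * y = (x * x) * (c * c) / (a * a) by rewrite /y; field.
  have t0 : x * t x != 0 by case: Ut.
  have Q' : x * x * s (x * sg x) / (x * t x) = x * s x by rewrite E mulrAC divff // mul1r.
  have : Qm (x * x * s (x * sg x) / (x * t x)) by rewrite Q'.
  case: cE => ->; case: aE => -> // h; have := sfN sfQm _ h;
   by rewrite ?mulrN ?invrN ?mulNr ?mulrN ?opprK // in h *.
have Uym := sqrt_Qm_unit _ Uy Qyy.
exists a, y, c^-1; split=> //; first exact: (isUV sfQd).
by rewrite /y; field; rewrite a0 c0.
Qed.

Lemma p1_not_sq z : F z -> z * z = p1%:R \/ z * z = - p1%:R -> False.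
Proof.
move=> Fz zz; have Qzz : QQ (z * z) by case: zz => ->; sf_mem QQ_subfield.
have nQ (c p : nat) x : x * x = z * z * c%:R -> prime p -> (p %| p1 * c)%N ->
    ~~ (p * p %| p1 * c)%N -> ~ QQ x.
  move=> xx pp d nd; have [w [xw aw]] : exists w : int, x * x = w%:~R /\ absz w = (p1 * c)%N.
    case: zz xx => -> ->; [exists (p1 * c)%:Z|exists (- (p1 * c)%:Z)]; split; rewrite ?abszN //.
      by rewrite -[RHS]/((p1 * c)%:R) natrM.
    by rewrite rmorphN /= -[_%:~R]/((p1 * c)%:R) natrM mulNr.
  by apply: (nQQ_prime _ w p xw pp); rewrite dvdzE /= aw.
have g1 := prime_gt1 pp1; have g2 := prime_gt1 pp2; have neq := p12 _ _ _ _ S.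
have ev n : odd n -> ~~ (2 * 2 %| n * 2)%N by rewrite dvdn_pmul2r // dvdn2 negbK.
have o1 : odd p1 by have := p14 _ _ _ _ S; lia.
have o2 : odd p2 by have := p24 _ _ _ _ S; lia.
have np : ~~ (p2 %| p1)%N by rewrite dvdn_prime2 // eq_sym.
have h1 : ~ QQ z.
  apply: (nQ 1%N p1) => //; rewrite ?mulr1 ?muln1 //.
  by rewrite -[X in (_ %| X)%N]muln1 dvdn_pmul2l ?(ltnW g1) // dvdn1 neq_ltn g1 orbT.
have h2 : ~ QQ (z * rm).
  apply: (nQ m p2 _ _ pp2).
  - by rewrite mulrACA sq_sq.
  - by rewrite mulnA; apply: dvdn_mull.
  - by rewrite mulnA dvdn_pmul2r ?(ltnW g2) // Euclid_dvdM // (negPf np).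
have h3 : ~ QQ (z * r2).
  apply: (nQ 2%N 2%N) => //; [by rewrite mulrACA sq_sq|exact: dvdn_mull|exact: ev].
have h4 : ~ QQ (z * r2 * rm).
  apply: (nQ (m * 2)%N 2%N) => //.
  - by rewrite mulrACA [z * r2 * _]mulrACA !sq_sq [(m * 2)%:R]natrM; ring.
  - by rewrite mulnA; apply: dvdn_mull.
  - by rewrite mulnA; apply: ev; rewrite oddM o1 odd_m.
have Qzm : Qm (z * z) by apply: QQ_sub sfQm _.
have [Kz|Kz] := sqrt_Qm z Fz Qzm.
  by case: (QQ_sqrt_adj _ _ Qzz Q_rm Kz).
have Q2' : QQ (z * r2 * (z * r2)) by rewrite (mulrACA z) sq_sq; sf_mem QQ_subfield.
by case: (QQ_sqrt_adj _ _ Q2' Q_rm Kz).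
Qed.

(** By [Hdec_norm1] an indecomposable y has norm -1 over Q, so its three relative norms all have
    norm -1. From g^2 = ± p1 x it follows that x is decomposable; up to dividing by y^2 its factors
    have norm 1, hence are ± squares, and ± p1 becomes a square in F. *)
Lemma q2_not_sqc y x : isU F y -> ~ Hdec y -> isU F x -> sqc p1 x -> False.
Proof.
move=> Uy nH Ux [g Fg gg].
have [Yt Ys Ysg yE] := unit_sq_dec _ Uy.
have [Fy _ y0 _] := Uy; have Ly := F_L _ Fy.
have N1 : y * t y * s (y * t y) = -1.
  by case: (norm_Q2 _ Yt) => // /(Hdec_norm1 _ Uy).
have N2 : y * s y * t (y * s y) = -1.
  by rewrite -N1 (rmorphM t) (rmorphM s y) (ts _ Ly); ring.
have Ysg' := isU_aut s _ Qd_s Ysg.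
have N3 : s (y * sg y) * s (s (y * sg y)) = -1.
  by rewrite s_mul_sg // (rmorphM s (s y)) ss // -N1 (rmorphM s y); ring.
(* The case where all three factors have norm 1: dividing g' by their square roots leaves a square
   root of ± p1. *)
have red x' g' a b c : isU Q2 a -> isU Qm b -> isU Qd c -> x' = a * b * c -> F g' ->
   g' * g' = p1%:R * x' \/ g' * g' = - (p1%:R * x') -> a * s a = 1 -> b * t b = 1 -> c * s c = 1 -> False.
  move=> Ua Ub Uc xE Fg' gg' na nb nc.
  have [a1 Ua1 aE] := norm1_2 _ Ua na; have [c1 Uc1 cE] := norm1_d _ Uc nc.
  have [b1 Ub1 bE] := norm1_square _ _ t (sq_sq m) rm_gt0 nQ_rm (t_rm _ _ _ _ S) _ Ys N2 _ Ub nb.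
  have [Ka1 _ a10 _] := Ua1; have [Kb1 _ b10 _] := Ub1; have [Kc1 _ c10 _] := Uc1.
  have Fa1 := Q2_F _ Ka1; have Fb1 := Qm_F _ Kb1; have Fc1 := Qd_F _ Kc1.
  apply: (p1_not_sq (g' / (a1 * b1 * c1))); first by sf_mem sfF.
  have -> : g' / (a1 * b1 * c1) * (g' / (a1 * b1 * c1)) = g' * g' / (a1 * a1 * (b1 * b1) * (c1 * c1)).
    by field; rewrite a10 b10 c10.
  have h : g' * g' = p1%:R * (a1 * a1 * (b1 * b1) * (c1 * c1)) \/
           g' * g' = - (p1%:R * (a1 * a1 * (b1 * b1) * (c1 * c1))).
    case: gg' => ->; rewrite xE; case: aE => ->; case: bE => ->; case: cE => ->;
     solve [left; ring | right; ring].
  by case: h => ->; [left|right]; field; rewrite a10 b10 c10.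
have [Fx _ x0 _] := Ux; have Lx := F_L _ Fx; have P0 := p1_neq0.
have [Xt Xs Xsg xE] := unit_sq_dec _ Ux.
have sqn (nu : {rmorphism algC -> algC}) : g * nu g / p1%:R * (g * nu g / p1%:R) = x * nu x.
  have -> : g * nu g / p1%:R * (g * nu g / p1%:R) = (g * g) * nu (g * g) / (p1%:R * p1%:R).
    by rewrite rmorphM /=; field.
  have cc : nu p1%:R = p1%:R by rewrite rmorph_nat.
  by case: gg => ->; rewrite ?rmorphN (rmorphM nu p1%:R x) cc; field.
pose gt := g * t g / p1%:R; pose gs := g * s g / p1%:R; pose gst := g * sg g / p1%:R.
have Lg := F_L _ Fg.
have Ut : isU Q2 gt.
  apply: isU_sqrt; last by rewrite sqn.
  have Ftg := F_t _ Fg; apply: in_Q2; first by rewrite /gt; sf_mem sfF.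
  by rewrite /gt (rmorphM t) (fmorphV t) (rmorphM t) tt // (rmorph_nat t) [t g * g]mulrC.
have Us : isU Qm gs.
  apply: isU_sqrt; last by rewrite sqn.
  have Fsg := F_s _ Fg; apply: in_Qm; first by rewrite /gs; sf_mem sfF.
  by rewrite /gs (rmorphM s) (fmorphV s) (rmorphM s) ss // (rmorph_nat s) [s g * g]mulrC.
have Usg : isU Qd gst.
  apply: isU_sqrt; last by rewrite sqn.
  have Fsg := F_sg _ Fg; apply: in_Qd; first by rewrite /gst; sf_mem sfF.
  by rewrite /gst (rmorphM sg) (fmorphV sg) (rmorphM sg) sgsg // (rmorph_nat sg) [sg g * g]mulrC.
have Usg' := isU_aut s _ Qd_s Usg.
have [K1 _ t0 _] := Ut; have [K2 _ s0 _] := Us; have [K3 _ sg0 _] := Usg'.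
have qt : gt * gt = x * t x := sqn t; have qs : gs * gs = x * s x := sqn s.
have qst : gst * gst = x * sg x := sqn sg.
clearbody gt gs gst.
(* Relative norms of g divided by p1 are units whose squares are the relative norms of x, which
   exhibits x up to sign as a product from the three fields. *)
have xx : x * x = (gt * gs / s gst) * (gt * gs / s gst).
  have -> : gt * gs / s gst * (gt * gs / s gst) = (gt * gt) * (gs * gs) / s (gst * gst).
    by rewrite (rmorphM s); field.
  rewrite qt qs qst -xE mulfK //; by case: Xsg => _ _ h _; rewrite fmorph_eq0.
have [a [b [c [Ua Ub Uc xabc]]]] : Hdec x.
  case: (sqr_pm _ _ xx) => ->.
    by exists gt, gs, (s gst)^-1; split=> //; apply: (isUV sfQd).
  exists (- gt), gs, (s gst)^-1; split=> //; [exact: (isUN sfQ2)|exact: (isUV sfQd)|by ring].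
have [Ka _ a0 _] := Ua; have [Kb _ b0 _] := Ub; have [Kc _ c0 _] := Uc.
have Fa := Q2_F _ Ka; have Fb := Qm_F _ Kb; have Fc := Qd_F _ Kc.
have F1 := Q2_F _ K1; have F2 := Qm_F _ K2.
(* The three factors have equal norms: otherwise a relative norm of x, which is a square, would also
   be minus a square in the real field F. *)
have r1 : (b * t b) * (c * s c) <> -1.
  move=> h; apply: (real_sq (gt / a)); first by sf_mem sfF.
  have -> : gt / a * (gt / a) = (gt * gt) / (a * a) by field.
  rewrite qt xabc !(rmorphM t) (t_Q2 a) // (t_Qd c) //.
  by rewrite -h; field.
have r3 : (a * s a) * (c * s c) <> -1.
  move=> h; apply: (real_sq (gs / b)); first by sf_mem sfF.
  have -> : gs / b * (gs / b) = (gs * gs) / (b * b) by field.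
  rewrite qs xabc !(rmorphM s) (s_Qm b) //.
  by rewrite -h; field.
have [nc|nc] := norm_Qd _ Uc.
  have na : a * s a = 1 by case: (norm_Q2 _ Ua) => // h; case: r3; rewrite nc h mulr1.
  have nb : b * t b = 1 by case: (norm_Qm _ Ub) => // h; case: r1; rewrite nc h mulr1.
  exact: (red x g a b c).
have na : a * s a = -1 by case: (norm_Q2 _ Ua) => // h; case: r3; rewrite nc h mul1r.
have nb : b * t b = -1 by case: (norm_Qm _ Ub) => // h; case: r1; rewrite nc h mul1r.
have yt0 : y * t y != 0 by case: Yt.
have ys0 : y * s y != 0 by case: Ys.
have ysg0 : s (y * sg y) != 0 by case: Ysg'.
have E2 : y * y = (y * t y) * (y * s y) / s (y * sg y) by rewrite -yE mulfK.
(* When all norms are -1, dividing x by y^2 changes each factor by a relative norm of y of norm -1,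
   so all norms become 1. *)
apply: (red (x / (y * y)) (g / y) (a / (y * t y)) (b / (y * s y)) (c * s (y * sg y))).
- exact: (isU_div sfQ2).
- exact: (isU_div sfQm).
- exact: (isUM sfQd).
- rewrite E2 xabc; move: (y * t y) (y * s y) (s (y * sg y)) yt0 ys0 ysg0 => z1 z2 z3 *.
  by field; apply/and3P.
- by sf_mem sfF.
- have -> : g / y * (g / y) = g * g / (y * y) by field.
  by case: gg => ->; [left|right]; rewrite ?mulNr mulrA.
- rewrite (rmorphM s) (fmorphV s) mulrACA -invfM N1 na invrN1 mulrNN mulr1 //.
- rewrite (rmorphM t) (fmorphV t) mulrACA -invfM N2 nb invrN1 mulrNN mulr1 //.
- rewrite (rmorphM s c) mulrACA N3 nc mulrNN mulr1 //.
Qed.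

(** * The shape of a generator of a capitulating ideal *)

Lemma i_sq_pm (h : nat) : ('i : algC) ^+ (h + h) = 1 \/ ('i : algC) ^+ (h + h) = -1.
Proof.
have -> : 'i ^+ (h + h) = (-1) ^+ h :> algC by rewrite addnn -mul2n exprM sqrCi.
by elim: h => [|h [IH|IH]]; [by left; rewrite expr0|right|left]; rewrite exprS IH mulN1r ?opprK.
Qed.

Lemma zeta1_neq0 : 1 + zeta != 0.
Proof.
apply/eqP => h; have z : zeta = -1 by apply/eqP; rewrite -addr_eq0 addrC h.
have := zeta_sq; rewrite z mulrNN mulr1 => h1.
by have := ii; rewrite -h1 mulr1 => /esym; exact: N1_neq1.
Qed.

Lemma zeta1_sq : (1 + zeta) * (1 + zeta) = (1 + 'i) * (1 + r2).
Proof.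
have zr : zeta * r2 = 1 + 'i by rewrite /zeta divfK ?r2_neq0.
rewrite -zr; transitivity (1 + zeta * zeta + 2 * zeta); first by ring.
rewrite zeta_sq -zr; transitivity (zeta * r2 + 2 * zeta); first by ring.
by rewrite -[2 in LHS](sq_sq 2); ring.
Qed.

Lemma isU_1r2 : isU Q2 (1 + r2) /\ (1 + r2) * s (1 + r2) = -1.
Proof.
have na : (1 + r2) * s (1 + r2) = -1.
  rewrite rmorphD rmorph1 /= (s_r2 _ _ _ _ S).
  by transitivity (1 - r2 * r2); [ring|rewrite sq_sq; ring].
split=> //; split.
- by apply: (sfD sfQ2); [exact: (sf1 _ sfQ2)|exact: (adj_gen QQ_subfield)].
- by rewrite rpredD ?Aint1 ?Aint_sq.
- by rewrite gt_eqF // addr_gt0 ?ltr01 ?r2_gt0.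
- by rewrite -[_^-1]opprK -(pm_inv _ _ na) rpredN Aint_aut rpredD ?Aint1 ?Aint_sq.
Qed.

(* [1 + zeta] generates the extension of [H0]; it accounts for the units of
   relative norm [-1]. *)
Lemma sg_zeta1 : 1 + zeta = 'i * (1 + r2) * sg (1 + zeta).
Proof.
rewrite (rmorphD sg) (rmorph1 sg) sg_zeta.
have e1 : (1 - zeta) * (1 + zeta) = 1 - 'i by rewrite -zeta_sq; ring.
apply: (mulIf zeta1_neq0); rewrite zeta1_sq -[RHS]mulrA e1.
transitivity (('i - 'i * 'i) * (1 + r2)); last by ring.
by rewrite ii; ring.
Qed.

(** Both a and g satisfy the same relation up to sign, so sg(a/g) = ± a/g. In the minus case
    dividing by [zeta], which [sg] negates, lands in k. *)
Lemma alpha_core a v : L a -> a != 0 -> isU F v -> v * sg v = 1 ->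
  a = v * sg a \/ a = - (v * sg a) ->
  exists c g x y w, [/\ c = 1%N \/ c = p1, F g /\ g != 0, isU F x,
   g * g = c%:R * x \/ g * g = - (c%:R * x) & [/\ k y, isU L w & a = y * g * w]].
Proof.
move=> La a0 Uv nv av.
have [c [g [x [hc Fg Ux gg gv]]]] := core _ Uv nv.
have c0 : c%:R != 0 :> algC by case: hc => ->; rewrite ?oner_neq0 ?p1_neq0.
have g0 : g != 0.
  apply/eqP => g0; have [_ _ x0 _] := Ux; have := mulf_neq0 c0 x0.
  by case: gg; rewrite g0 mul0r; [move=> <-|move/eqP; rewrite eq_sym oppr_eq0 => ->]; rewrite ?eqxx.
have [Fv _ v0 _] := Uv; have Lg := F_L _ Fg.
have sg0 : sg g != 0 by rewrite fmorph_eq0.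
have sa0 : sg a != 0 by rewrite fmorph_eq0.
have Lz := L_zeta; have z0 := zeta_neq0.
have pm : sg (a / g) = a / g \/ sg (a / g) = - (a / g).
  rewrite (rmorphM sg) (fmorphV sg).
  have e1 : a / g = sg a / sg g \/ a / g = - (sg a / sg g).
    by move: (sg a) (sg g) sg0 av gv => a' g' g0' [->|->] [->|->];
      [left|right|right|left]; field; rewrite v0 g0'.
  by case: e1 => ->; [left|right; rewrite opprK].
case: pm => e.
  exists c, g, x, (a / g), 1; split=> //; split; last by rewrite mulr1 divfK.
    by apply: in_k => //; sf_mem sfL.
  exact: (isU1 sfL).
exists c, g, x, (a / g / zeta), zeta; split=> //; split; last by field; rewrite g0 z0.
  apply: in_k; first by sf_mem sfL.
  by rewrite (rmorphM sg) (fmorphV sg) sg_zeta e invrN mulrNN.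
exact: isU_zeta.
Qed.

Lemma alpha_red a : L a -> a != 0 -> isU L (a / sg a) ->
  exists l c g x y w, [/\ l = 0%N \/ l = 1%N, c = 1%N \/ c = p1, F g /\ g != 0,
   isU F x /\ (g * g = c%:R * x \/ g * g = - (c%:R * x)) &
   [/\ k y, isU L w & a * (1 + zeta) ^+ l = y * g * w]].
Proof.
move=> La a0 Uu; have sa0 : sg a != 0 by rewrite fmorph_eq0.
have [j [v [Uv uE]]] := EL _ Uu; have [Fv _ v0 _] := Uv.
have nu : (a / sg a) * sg (a / sg a) = 1.
  by rewrite (rmorphM sg) (fmorphV sg) sgsg //; field; rewrite a0 sa0.
pose n := v * sg v.
have Fn : F n by apply: (sfM _ sfF) => //; apply: F_sg.
have nE : (- 'i) ^+ j * n = 1.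
  rewrite -nu uE (rmorphM sg) (rmorphXn sg) sg_zeta mulrACA -exprMn mulrN zeta_sq //.
(* Complex conjugation fixes [n]; comparing the two relations shows that j is even. *)
have nE' : 'i ^+ j * n = 1.
  have := congr1 cj nE; rewrite (rmorphM cj) (rmorphXn cj) (rmorphN cj) cj_i opprK (cj_F _ Fn).
  by rewrite (rmorph1 cj).
have n0 : n != 0 by apply: contra_eqN nE => /eqP ->; rewrite mulr0 eq_sym oner_eq0.
have ij0 : 'i ^+ j != 0 :> algC by rewrite expf_neq0 ?i_neq0.
have [h jE] : exists h, j = (h + h)%N.
  exists j./2; rewrite addnn -[LHS](odd_double_half j); case oj: (odd j) => //.
  exfalso; apply: N1_neq1; have := nE; rewrite exprNn -signr_odd oj expr1 -mulrA nE' mulr1 //.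
have zj : zeta ^+ j = 'i ^+ h by rewrite jE exprD -exprMn zeta_sq.
have [h' hE] : exists h', h = (h' + h')%N \/ h = (h' + h').+1%N.
  exists h./2; rewrite addnn; move: (odd_double_half h).
  by case: (odd h); rewrite ?add1n ?add0n => /esym; [right|left].
(* Here n = (-1)^h. For h even, 'i^h is ±1 and v has relative norm 1. For h odd, the factors 'i and
   1 + sqrt 2 of [sg_zeta1] repair the root of unity and the norm at once. *)
case: hE => hE.
  have nv : v * sg v = 1.
    have : n = (-1) ^+ h.
      have e := nE'; rewrite jE addnn -mul2n exprM sqrCi in e.
      by rewrite -[n]mul1r -[X in X * n](mulVf (expf_neq0 h (_ : -1 != 0 :> algC))) ?oppr_eq0 ?oner_eq0 // -mulrA e mulr1 -exprVn invrN1.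
    by rewrite hE addnn -mul2n exprM sqrrN !expr1n.
  have av : a = v * sg a \/ a = - (v * sg a).
    have : a = zeta ^+ j * v * sg a by rewrite -uE divfK.
    by rewrite zj hE; move: (sg a) => a'; case: (i_sq_pm h') => -> ->; [left|right]; ring.
  have [c [g [x [y [w [hc hg Ux gg [ky Uw aE]]]]]]] := alpha_core _ _ La a0 Uv nv av.
  by exists 0%N, c, g, x, y, w; split=> //; [left|split=> //; rewrite expr0 mulr1].
have [U1 N1] := isU_1r2; have [K1 _ r0 _] := U1.
have Lz := L_zeta; have z1 := zeta1_neq0.
have nv : (1 + r2) * v * sg ((1 + r2) * v) = 1.
  rewrite (rmorphM sg) (sg_Q2 _ K1) mulrACA N1 -/n.
  have e := nE'; rewrite jE addnn -mul2n exprM sqrCi hE exprS addnn -[h'.*2]mul2n exprM sqrrN !expr1n mulr1 in e.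
  exact: e.
have Uv' : isU F ((1 + r2) * v) by apply: (isUM sfF) => //; exact: isU_sub Q2_F U1.
have av : a * (1 + zeta) = (1 + r2) * v * sg (a * (1 + zeta)) \/
          a * (1 + zeta) = - ((1 + r2) * v * sg (a * (1 + zeta))).
  have e : a = 'i ^+ h * v * sg a by rewrite -zj -uE divfK.
  have e2 : a * (1 + zeta) = 'i ^+ h.+1 * ((1 + r2) * v * sg (a * (1 + zeta))).
    transitivity (('i ^+ h * v * sg a) * ('i * (1 + r2) * sg (1 + zeta))).
      by rewrite -e -sg_zeta1.
    by rewrite (rmorphM sg a) exprS; move: (sg a) (sg (1 + zeta)) => *; ring.
  move: e2; have -> : h.+1 = (h'.+1 + h'.+1)%N by rewrite hE; lia.
  move: (sg (a * (1 + zeta))) => b'; move: (a * (1 + zeta)) => b ->.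
  by case: (i_sq_pm h'.+1) => ->; [left|right]; ring.
have La' : L (a * (1 + zeta)) by sf_mem sfL.
have [c [g [x [y [w [hc hg Ux gg [ky Uw aE]]]]]]] := alpha_core _ _ La' (mulf_neq0 a0 z1) Uv' nv av.
by exists 1%N, c, g, x, y, w; split=> //; right.
Qed.

Lemma k_s x : k x -> k (s x).
Proof. by apply: k_stab; [right; exact: s_rd|left; exact: (s_i _ _ _ _ S)]. Qed.

Lemma k_cj x : k x -> k (cj x).
Proof. by apply: k_stab; [left; exact: cj_rd|right; exact: cj_i]. Qed.

(** * Independence of the classes of H0 and H1H2 in k *)

(** For B odd one gets z in k with z^2 = p1 x. The unit z / conj(z) is a power of 'i, so z, 'i z, (1
    - 'i) z or (1 + 'i) z is real and lies in Q(sqrt(2p1p2)); its square is ± p1 or ± 2 p1 times a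
    unit there, which is excluded. *)
Lemma not_principal_even y x B : k y -> isU k x -> y * y = p1%:R ^+ B * x -> ~~ odd B.
Proof.
move=> ky0 Ux yy0; apply/negP => oB; have [kx Ax x0 Ax'] := Ux.
have P0 := p1_neq0.
pose z := y / p1%:R ^+ B./2.
have kz : k z by rewrite /z; sf_mem sfk.
have zz : z * z = p1%:R * x.
  have -> : z * z = y * y / (p1%:R ^+ (B./2 + B./2)) by rewrite exprD /z; field; rewrite expf_neq0.
  rewrite yy0 addnn -{1}[B]odd_double_half oB exprD expr1; field; by rewrite expf_neq0.
clearbody z; have z0 : z != 0.
  by apply: contra_eqN zz => /eqP ->; rewrite mul0r eq_sym mulf_neq0.
have Lz := k_L _ kz; have c0 : cj z != 0 by rewrite fmorph_eq0.
have Lcz := L_cj _ Lz.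
have Uxc : isU k (cj x) := isU_aut cj _ k_cj Ux.
pose w := z / cj z.
have ww : w * w = x / cj x.
  have -> : w * w = z * z / cj (z * z) by rewrite /w (rmorphM cj); field.
  have cc : cj p1%:R = p1%:R by rewrite rmorph_nat.
  have xc0 : cj x != 0 by rewrite fmorph_eq0.
  by rewrite zz (rmorphM cj p1%:R) cc; field; rewrite xc0 P0.
have Uw : isU L w.
  apply: isU_sqrt; first by apply: (sf_div sfL).
  by rewrite ww; apply: (isU_div sfL); [exact: isU_sub k_L Ux|exact: isU_sub k_L Uxc].
have nw : w * cj w = 1.
  have cc : cj (cj z) = z := conjCK z.
  by rewrite /w (rmorphM cj) (fmorphV cj) cc; field; rewrite z0 c0.
have kw : k w by apply: (sf_div sfk) => //; apply: k_cj.
have fin r : Qd r -> r * r = z * z \/ r * r = - (z * z) -> False.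
  move=> Qr rr; have Qx : Qd x.
    have -> : x = z * z / p1%:R by rewrite zz mulrC mulKf.
    have Qzz : Qd (z * z) by case: rr => e; [rewrite -e|rewrite -[z * z]opprK -e]; sf_mem sfQd.
    by sf_mem sfQd.
  apply: (no_sq_d r x p1 Qr (isU_in _ _ _ Ux Qx)); first by constructor 2.
  by rewrite -zz.
have fin2 r : Qd r -> r * r = 2 * 'i * (z * z) \/ r * r = - (2 * 'i * (z * z)) -> False.
  move=> Qr rr; have Qx : Qd ('i * x).
    have -> : 'i * x = 2 * 'i * (z * z) / (2 * p1%:R) by rewrite zz; field; exact: P0.
    have Qzz : Qd (2 * 'i * (z * z)) by case: rr => [<-|/(congr1 -%R)]; [|rewrite opprK => <-]; sf_mem sfQd.
    by sf_mem sfQd.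
  apply: (no_sq_2p1 r ('i * x)) => //.
    apply: (isU_in k) => //; apply: (isUM sfk) => //; apply: isU_i; [exact: sfk|exact: k_i].
  have -> : 2 * p1%:R * ('i * x) = 2 * 'i * (z * z) by rewrite zz; ring.
  by [].
have inQd r : k r -> cj r = r -> Qd r.
  move=> kr cr; apply: in_Qd; last by apply: (fix_k _ _ sg_rd sg_i).
  by apply: in_F => //; apply: k_L.
have ki := k_i.
have zw : z = w * cj z by rewrite /w divfK.
have [l hl] := mu8 _ (EL_norm1_8 _ Uw nw).
have wi : w = 'i ^+ l.
  case: hl => // wz; exfalso.
  have := fix_k sg _ sg_rd sg_i kw; rewrite wz (rmorphM sg) sg_zeta (rmorphXn sg) sg_i mulNr.
  move=> /eqP; rewrite eq_sym -subr_eq0 opprK -mulr2n mulrn_eq0 /= mulf_eq0.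
  by rewrite (negPf zeta_neq0) (negPf (expf_neq0 _ i_neq0)).
clearbody w; have w4 : w ^+ 4 = 1 by rewrite wi -exprM mulnC exprM (exprM _ 2 2) sqrCi sqrrN !expr1n.
have wc : [\/ w = 1, w = -1, w = 'i | w = - 'i].
  have : w * w = 1 * 1 \/ w * w = 'i * 'i.
    by rewrite ii mulr1; apply: sqr_pm; rewrite mulr1 -w4; ring.
  by case=> /sqr_pm [] ->; [constructor 1|constructor 2|constructor 3|constructor 4].
case: wc => wE; rewrite wE in zw.
- apply: (fin z); last by left.
  by apply: inQd; rewrite // [RHS]zw mul1r.
- apply: (fin ('i * z)); last by right; rewrite mulrACA ii mulN1r.
  apply: inQd; first by sf_mem sfk.
  by rewrite (rmorphM cj) cj_i [in RHS]zw; ring.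
- apply: (fin2 ((1 - 'i) * z)); last first.
    right; transitivity ((1 + 'i * 'i - 2 * 'i) * (z * z)); first by ring.
    by rewrite ii; ring.
  apply: inQd; first by sf_mem sfk.
  rewrite (rmorphM cj) (rmorphB cj) (rmorph1 cj) cj_i [in RHS]zw.
  transitivity (('i - 'i * 'i) * cj z); last by ring.
  by rewrite ii; ring.
- apply: (fin2 ((1 + 'i) * z)); last first.
    left; transitivity ((1 + 'i * 'i + 2 * 'i) * (z * z)); first by ring.
    by rewrite ii; ring.
  apply: inQd; first by sf_mem sfk.
  rewrite (rmorphM cj) (rmorphD cj) (rmorph1 cj) cj_i [in RHS]zw.
  transitivity ((- 'i - 'i * 'i) * cj z); last by ring.
  by rewrite ii; ring.
Qed.

(** Take norms to the imaginary quadratic field Q('i rd), where units of the form N(x) are ±1 and 1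
    + 'i has norm 2. For A odd this makes 2 or -2 a square in Q(sqrt(-2p1p2)). *)
Lemma not_principal_i y x A B : k y -> isU k x ->
  y * y = (1 + 'i) ^+ A * p1%:R ^+ B * x -> ~~ odd A.
Proof.
move=> ky Ux yy; apply/negP => oA; have [kx Ax x0 Ax'] := Ux.
have P0 := p1_neq0; have H0 := two_neq0.
pose nu : {rmorphism algC -> algC} := cj \o s.
have nuE z : nu z = cj (s z) by [].
have nui : nu 'i = - 'i by rewrite nuE (s_i _ _ _ _ S) cj_i.
have nurd : nu rd = - rd by rewrite nuE s_rd (rmorphN cj) cj_rd.
have Qid : QQ ('i * rd * ('i * rd)) by rewrite mulrACA ii rd_rd; sf_mem QQ_subfield.
pose M := adj QQ ('i * rd).
have sM : subfield M := adj_subfield QQ_subfield _ Qid.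
have nuM z : M z -> nu z = z.
  by apply: fix_QQ; rewrite (rmorphM nu) nui nurd mulrNN.
have nrm z : k z -> M (z * nu z).
  by move=> kz; have [_] := adj_trace_norm _ _ _ nu sM (QQ_sub _ _ sM Q_i) nuM nui (k_as_id _ kz).
have knu z : k z -> k (nu z) by move=> kz; apply/k_cj/k_s.
have Un : isU M (x * nu x).
  apply: (isU_in k); last exact: nrm.
  by apply: (isUM sfk) => //; apply: (isU_aut nu _ knu Ux).
have cM z : M z -> M (cj z).
  apply: (adj_stable QQ_subfield); first by move=> t0; exact: Q_stab.
  by right; rewrite (rmorphM cj) cj_i cj_rd mulNr.
have n1 : x * nu x = 1 \/ x * nu x = -1.
  have [Mn An n0 _] := Un.
  apply: (imag_unit rd (2 * m) _ rd_rd cj_rd nQ_rd rd_no3 Mn An).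
  have cid : cj ('i * rd) = - ('i * rd) by rewrite (rmorphM cj) cj_i cj_rd mulNr.
  have [_ Qn] := adj_trace_norm _ _ _ cj QQ_subfield Qid (fmorph_QQ cj) cid Mn.
  have UU := isU_in _ _ _ (isUM sM _ _ Un (isU_aut cj _ cM Un)) Qn.
  case: (isU_QQ _ UU) => // e.
  have : 0 <= x * nu x * cj (x * nu x) by rewrite cjE -normCK exprn_ge0.
  by rewrite e oppr_ge0 lt_geF ?ltr01.
pose z := y * nu y / (2 ^+ A./2 * p1%:R ^+ B).
have Mz : M z.
  have h := nrm _ ky; rewrite /z; move: (y * nu y) h => q h; sf_mem sM.
have zz : z * z = 2 \/ z * z = - 2.
  have nup : nu p1%:R = p1%:R by rewrite rmorph_nat.
  have nyy : (y * nu y) * (y * nu y) = 2 ^+ A * p1%:R ^+ B * p1%:R ^+ B * (x * nu x).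
    transitivity ((y * y) * nu (y * y)); first by rewrite (rmorphM nu); ring.
    rewrite yy (rmorphM nu _ x) (rmorphM nu) !(rmorphXn nu) nup (rmorphD nu) (rmorph1 nu) nui.
    have -> : 2 ^+ A = ((1 + 'i) * (1 - 'i)) ^+ A :> algC.
      by congr (_ ^+ _); transitivity (1 - 'i * 'i : algC); [rewrite ii|]; ring.
    by rewrite exprMn; ring.
  have e2 : 2 ^+ A = 2 * (2 ^+ A./2 * 2 ^+ A./2) :> algC.
    by rewrite -exprD addnn -exprS -[in LHS](odd_double_half A) oA.
  have -> : z * z = (y * nu y) * (y * nu y) / ((2 ^+ A./2 * 2 ^+ A./2) * (p1%:R ^+ B * p1%:R ^+ B)).
    by rewrite /z; field; rewrite !expf_neq0.
  rewrite nyy e2; move: (2 ^+ A./2) (p1%:R ^+ B) (expf_neq0 A./2 H0) (expf_neq0 B P0) => q1 q2 q10 q20.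
  by case: n1 => ->; [left|right]; field; rewrite q10 q20.
clearbody z; have Qzz : QQ (z * z) by case: zz => ->; sf_mem QQ_subfield.
case: (QQ_sqrt_adj _ _ Qzz Qid Mz).
  have [c [cE hc]] : exists c : int, z * z = c%:~R /\ absz c = 2%N.
    case: zz => ->; first by exists 2.
    exists (- 2%:Z); split; last by rewrite abszN.
    by rewrite mulrNz.
  by apply: (nQQ_prime _ c 2 cE isT); rewrite dvdzE hc.
have [c [cE hc]] : exists c : int, z * ('i * rd) * (z * ('i * rd)) = c%:~R /\ absz c = (4 * (p1 * p2))%N.
  have e : z * ('i * rd) * (z * ('i * rd)) = - (z * z) * (2 * m)%:R.
    by rewrite mulrACA (mulrACA 'i) ii rd_rd; ring.
  have e4 : (4 * m)%:R = 2 * (2 * m)%:R :> algC by rewrite -natrM [in RHS]mulnA.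
  rewrite e; case: zz => ->; [exists (- (4 * m)%:Z)|exists (4 * m)%:Z]; split; rewrite ?abszN //.
    by rewrite rmorphN /= -[_%:~R]/((4 * m)%:R) e4 mulNr.
  by rewrite opprK -[RHS]/((4 * m)%:R) e4.
apply: (nQQ_prime _ c p1 cE pp1); rewrite dvdzE hc.
  by rewrite mulnCA; apply: dvdn_mulr.
have g1 := prime_gt1 pp1.
rewrite abszM /= mulnCA dvdn_pmul2l ?(ltnW g1) // Euclid_dvdM // negb_or.
apply/andP; split; last by rewrite dvdn_prime2 ?(p12 _ _ _ _ S).
have e4 : (4 = 2 * 2)%N by [].
rewrite e4 Euclid_dvdM // orbb dvdn_prime2 //.
by apply/negP => /eqP e2; have := p14 _ _ _ _ S; rewrite e2.
Qed.

Lemma not_principal y x A B : k y -> isU k x ->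
  y * y = (1 + 'i) ^+ A * p1%:R ^+ B * x -> ~~ odd A /\ ~~ odd B.
Proof.
move=> ky Ux yy; have eA := not_principal_i _ _ _ _ ky Ux yy; split=> //.
have ki := k_i; have i2 : 1 + 'i != 0 :> algC.
  apply/eqP => h; have := ii; have -> : 'i = -1 :> algC by apply/eqP; rewrite -addr_eq0 addrC h.
  by rewrite mulrNN mulr1 => /eqP; rewrite -subr_eq0 opprK -mulr2n pnatr_eq0.
apply: (not_principal_even (y / (1 + 'i) ^+ A./2) x); [by sf_mem sfk|done|].
have -> : y / (1 + 'i) ^+ A./2 * (y / (1 + 'i) ^+ A./2) = y * y / (1 + 'i) ^+ (A./2 + A./2).
  by rewrite exprD; field; rewrite expf_neq0.
rewrite yy addnn -{1}[A]odd_double_half (negPf eA) add0n.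
by field; rewrite expf_neq0.
Qed.

(** * Classes generated by H0 and H1H2, and their capitulation *)

Section ClassGroup.
Let Ok := OO k.
Let OL := OO L.
Let rk : subring Ok := OO_subring _ sfk.
Let rL : subring OL := OO_subring _ sfL.
Variables H0 H12 : algC -> Prop.
Hypotheses (sH0 : submod Ok H0) (sH12 : submod Ok H12).
Hypotheses (sq0 : idmul Ok H0 H0 = princ Ok (1 + 'i)) (sq12 : idmul Ok H12 H12 = princ Ok p1%:R).

Definition gens_prod (l b : nat) : algC -> Prop := idmul Ok (idexp Ok H0 l) (idexp Ok H12 b).

Lemma Ok_1i : Ok (1 + 'i).
Proof. by split; [have ki := k_i; sf_mem sfk|rewrite rpredD ?Aint1 ?Aint_i]. Qed.
Lemma Ok_p1 : Ok p1%:R.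
Proof. by split; [sf_mem sfk|rewrite Aint_Cnat ?natr_nat]. Qed.
Lemma OkX x n : Ok x -> Ok (x ^+ n).
Proof. by move=> Ox; elim: n => [|n IHn]; rewrite ?expr0 ?exprS; [exact: (sr1 _ rk)|exact: (srM _ rk)]. Qed.
Lemma neq0_1i : 1 + 'i != 0 :> algC.
Proof.
apply/eqP => h; have := ii; have -> : 'i = -1 :> algC by apply/eqP; rewrite -addr_eq0 addrC h.
by rewrite mulrNN mulr1 => /esym; exact: N1_neq1.
Qed.

Lemma gens_submod l b : submod Ok (gens_prod l b).
Proof. by apply: (idmul_submod _ rk); apply: (idexp_submod _ rk). Qed.

Lemma idmulACA A B C D : submod Ok A -> submod Ok B -> submod Ok C -> submod Ok D ->
  idmul Ok (idmul Ok A B) (idmul Ok C D) = idmul Ok (idmul Ok A C) (idmul Ok B D).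
Proof.
move=> sA sB sC sD; have sm X Y := idmul_submod _ rk X Y.
rewrite (idmulA _ rk A B) //; last exact: sm.
rewrite -(idmulA _ rk B C D) // (idmulC _ B C) (idmulA _ rk C B D) //.
by rewrite -(idmulA _ rk A C) //; apply: sm.
Qed.

Lemma idexp_sq H h n : submod Ok H -> Ok h -> idmul Ok H H = princ Ok h ->
  idmul Ok (idexp Ok H n) (idexp Ok H n) = princ Ok (h ^+ n).
Proof.
move=> sH Oh e; elim: n => [|n IHn].
  by rewrite expr0 (princ1 Ok) /= (idmul1 _ rk) //; apply: submod_self.
have sn := idexp_submod _ rk H n sH.
have -> : idexp Ok H n.+1 = idmul Ok H (idexp Ok H n) by [].
by rewrite idmulACA // e IHn princM // ?exprS //; apply: OkX.
Qed.

Lemma gens_sq l b : idmul Ok (gens_prod l b) (gens_prod l b) = princ Ok ((1 + 'i) ^+ l * p1%:R ^+ b).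
Proof.
have s0 := idexp_submod _ rk H0 l sH0; have s1 := idexp_submod _ rk H12 b sH12.
rewrite /gens_prod idmulACA // (idexp_sq _ _ _ sH0 Ok_1i sq0) (idexp_sq _ _ _ sH12 Ok_p1 sq12).
by rewrite princM //; apply: OkX; [exact: Ok_1i|exact: Ok_p1].
Qed.

Lemma gens_sq_neq0 l b : (1 + 'i) ^+ l * p1%:R ^+ b != 0 :> algC.
Proof. by rewrite mulf_neq0 ?expf_neq0 ?neq0_1i ?p1_neq0. Qed.

Lemma OkM_gens l b : Ok ((1 + 'i) ^+ l * p1%:R ^+ b).
Proof. by apply: (srM _ rk); apply: OkX; [exact: Ok_1i|exact: Ok_p1]. Qed.

Lemma extE I J : submod Ok I -> submod Ok J ->
  gen OL (idmul Ok I J) = idmul OL (gen OL I) (gen OL J).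
Proof. exact: (extM k L sfk sfL k_L). Qed.

Lemma ext_princE a : Ok a -> gen OL (princ Ok a) = princ OL a.
Proof. exact: (ext_princ k L sfk sfL k_L). Qed.

Lemma ext_sub I : submod Ok I -> submod OL (gen OL I).
Proof. exact: (ext_submod k L sfL k_L). Qed.

Lemma OL_Aint x : L x -> x \in Aint -> OL x. Proof. by split. Qed.

Lemma OL_zeta1 : OL (1 + zeta).
Proof.
have Lz := L_zeta; split; first by sf_mem sfL.
by have [_ Az _ _] := isU_zeta; rewrite rpredD ?Aint1.
Qed.

(** Both sides have the same square, since (1 + zeta)^2 = (1 + 'i)(1 + sqrt 2) and 1 + sqrt 2 is a
    unit; [princ_sqrt] extracts the root. *)
Lemma ext_H0 : gen OL H0 = princ OL (1 + zeta).
Proof.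
apply: (princ_sqrt L sfL); [exact: ext_sub|by case: OL_zeta1|exact: zeta1_neq0|].
rewrite -extE // sq0 (ext_princE _ Ok_1i) zeta1_sq.
have [U1 _] := isU_1r2; rewrite [RHS]princ_isU //; first exact: sfL.
by apply: isU_sub U1 => x Qx; apply/F_L/Q2_F.
Qed.

Lemma ext_H12 g x : F g -> g != 0 -> isU F x ->
  g * g = p1%:R * x \/ g * g = - (p1%:R * x) -> gen OL H12 = princ OL g.
Proof.
move=> Fg g0 Ux gg; apply: (princ_sqrt L sfL); [exact: ext_sub|exact: F_L|by []|].
rewrite -extE // sq12 (ext_princE _ Ok_p1).
have UL : isU L x := isU_sub _ _ _ F_L Ux.
case: gg => ->; first by rewrite [RHS]princ_isU //; exact: sfL.
by rewrite -mulrN [RHS]princ_isU //; [exact: sfL|exact: (isUN sfL)].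
Qed.

Lemma ext_idexp H h n : submod Ok H -> OL h -> gen OL H = princ OL h ->
  gen OL (idexp Ok H n) = princ OL (h ^+ n).
Proof.
move=> sH Oh e; elim: n => [|n IHn].
  rewrite expr0 (princ1 OL) -[RHS](ext_O k L sfk sfL k_L) //.
have -> : idexp Ok H n.+1 = idmul Ok H (idexp Ok H n) by [].
rewrite extE //; last exact: (idexp_submod _ rk).
rewrite e IHn princM // ?exprS //.
by elim: n {IHn} => [|n IHn]; rewrite ?expr0 ?exprS; [exact: (sr1 _ rL)|exact: (srM _ rL)].
Qed.

(** The ideal [gens_prod l b] has principal square, so it is its own inverse in the class group. *)
Lemma princ_eq_same_class I l b y : submod Ok I -> y != 0 ->
  idmul Ok I (gens_prod l b) = princ Ok y -> same_class Ok I (gens_prod l b).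
Proof.
move=> sI y0 e; have sN := gens_submod l b.
have Oy : Ok y.
  have [h _ _ _] := idmul_submod _ rk _ _ sI sN; apply: h.
  by rewrite e; apply: (princ_self _ rk).
apply/(same_classP _ rk) => //; exists ((1 + 'i) ^+ l * p1%:R ^+ b), y.
split=> //; [exact: OkM_gens|exact: gens_sq_neq0|].
by rewrite -gens_sq idmulC -(idmulA _ rk) // e.
Qed.

Lemma cap_bound I : is_ideal Ok I -> capitulates OL I ->
  exists l b, [/\ (l < 2)%N, (b < 2)%N, same_class Ok I (gens_prod l b) &
    b = 1%N -> exists2 x, isU F x & sqc p1 x].
Proof.
move=> [sI [x0 [x00 Ix0]]] [a /ideal_ext aE].
have a0 : a != 0.
  apply: contra_neq x00 => a0; have : gen OL I x0 by apply: gen_in.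
  by rewrite aE a0 => -[b [_ ->]]; rewrite mul0r.
have [La Ua] := cap_unit k L sg sfL k_L (fun x => fix_k sg x sg_rd sg_i) L_sg sgsg I a sI a0 aE.
have [l [c [g [x [y [w [hl hc [Fg g0] [Ux gg] [ky Uw E]]]]]]]] := alpha_red _ La a0 Ua.
have Oa : OL a.
  have [h _ _ _] := ext_sub _ sI; apply: h; by rewrite aE; apply: (princ_self _ rL).
have zl : OL ((1 + zeta) ^+ l) by case: hl => ->; rewrite ?expr0 ?expr1; [exact: (sr1 _ rL)|exact: OL_zeta1].
have Oal : OL (a * (1 + zeta) ^+ l) by apply: (srM _ rL).
have sN b := gens_submod l b.
have s0 := idexp_submod _ rk H0 l sH0.
have y0 : y != 0.
  have : a * (1 + zeta) ^+ l != 0 by rewrite mulf_neq0 // expf_neq0 // zeta1_neq0.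
  by rewrite E; apply: contraNneq => ->; rewrite !mul0r.
have ctr M z : submod Ok M -> k z -> z != 0 -> gen OL M = princ OL z -> M = princ Ok z.
  exact: (contract k L sg sfk sfL k_L (fun x => fix_k sg x sg_rd sg_i) L_sg sgsg in_k).
have l2 : (l < 2)%N by case: hl => ->.
case: hc => hc; rewrite hc in gg.
  have Ug : isU F g.
    by apply: (isU_sqrt _ Fg); case: gg => ->; rewrite mul1r //; apply: (isUN sfF).
  exists l, 0%N; split=> //; apply: (princ_eq_same_class I l 0 y) => //.
  apply: ctr => //; first exact: (idmul_submod _ rk).
  rewrite extE // /gens_prod extE //; last exact: (submod_self _ rk).
  rewrite aE (ext_idexp _ _ l sH0 OL_zeta1 ext_H0).
  have -> : gen OL (idexp Ok H12 0) = OL by apply: (ext_O k L sfk sfL k_L).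
  rewrite (idmulI1 _ rL); last exact: (princ_submod _ rL _ zl).
  rewrite princM // E -mulrA princ_isU //; first exact: sfL.
  by apply: (isUM sfL) => //; exact: isU_sub F_L Ug.
exists l, 1%N; split=> //; last by move=> _; exists x => //; exists g.
have P0 := p1_neq0; have Lg := F_L _ Fg.
have Og : OL g.
  split=> //; have [_ Ax _ _] := Ux; apply: Aint_sqrt.
  by case: gg => ->; rewrite ?rpredN rpredM // Aint_Cnat ?natr_nat.
(* The extension of H1H2 contributes a second factor g, and g^2 = ± p1 x turns y g into y p1 up to a
   unit. *)
apply: (princ_eq_same_class I l 1 (y * p1%:R)) => //; first by rewrite mulf_neq0.
apply: ctr; [exact: (idmul_submod _ rk)|by sf_mem sfk|by rewrite mulf_neq0|].
have s1 := idexp_submod _ rk H12 1 sH12.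
rewrite extE // /gens_prod extE //.
rewrite aE (ext_idexp _ _ l sH0 OL_zeta1 ext_H0) (ext_idexp _ _ 1 sH12 Og (ext_H12 _ _ Fg g0 Ux gg)).
rewrite expr1 princM // princM //; last exact: (srM _ rL).
rewrite mulrA E.
have UL : isU L x := isU_sub _ _ _ F_L Ux.
case: gg => gg.
  have -> : y * g * w * g = (y * p1%:R) * (x * w) by transitivity (y * (g * g) * w); [ring|rewrite gg; ring].
  by rewrite princ_isU //; [exact: sfL|exact: (isUM sfL)].
have -> : y * g * w * g = (y * p1%:R) * (- (x * w)) by transitivity (y * (g * g) * w); [ring|rewrite gg; ring].
by rewrite princ_isU //; [exact: sfL|apply: (isUN sfL); exact: (isUM sfL)].
Qed.

Lemma capitulates_class I J : submod Ok I -> submod Ok J -> same_class Ok I J ->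
  capitulates OL J -> capitulates OL I.
Proof.
move=> sI sJ /(same_classP _ rk _ _ sI sJ) [a [b [Oa Ob a0 b0 e]]] [d /ideal_ext dE].
have OkL x : Ok x -> OL x by move=> [kx Ax]; split=> //; apply: k_L.
have Od : OL d.
  have [h _ _ _] := ext_sub _ sJ; apply: h; by rewrite dE; apply: (princ_self _ rL).
have E : idmul OL (princ OL a) (gen OL I) = princ OL (b * d).
  rewrite -ext_princE // -extE //; last exact: (princ_submod _ rk).
  rewrite e extE //; last exact: (princ_submod _ rk).
  by rewrite ext_princE // dE princM //; apply: OkL.
have [y _ [_ yE]] := scale_princ _ rL a (b * d) _ (OkL _ Oa) a0 (ext_sub _ sI) E.
by exists y => x; rewrite yE.
Qed.

Lemma capitulates_H0 l : capitulates OL (idexp Ok H0 l).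
Proof. by exists ((1 + zeta) ^+ l) => x; rewrite (ext_idexp _ _ l sH0 OL_zeta1 ext_H0). Qed.

Lemma capitulates_gens l b x : isU F x -> sqc p1 x -> capitulates OL (gens_prod l b).
Proof.
move=> Ux [g Fg gg]; have [_ Ax x0 _] := Ux.
have Og : OL g.
  split; first exact: F_L.
  by apply: Aint_sqrt; case: gg => ->; rewrite ?rpredN rpredM // Aint_Cnat ?natr_nat.
have g0 : g != 0.
  apply/eqP => g0; have := mulf_neq0 p1_neq0 x0.
  by case: gg; rewrite g0 mul0r; [move=> <-|move/eqP; rewrite eq_sym oppr_eq0 => ->]; rewrite ?eqxx.
have s0 := idexp_submod _ rk H0 l sH0; have s1 := idexp_submod _ rk H12 b sH12.
have OX y n : OL y -> OL (y ^+ n).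
  by move=> Oy; elim: n => [|n IHn]; rewrite ?expr0 ?exprS; [exact: (sr1 _ rL)|exact: (srM _ rL)].
exists ((1 + zeta) ^+ l * g ^+ b) => z; rewrite /gens_prod extE //.
rewrite (ext_idexp _ _ l sH0 OL_zeta1 ext_H0) (ext_idexp _ _ b sH12 Og (ext_H12 _ _ Fg g0 Ux gg)).
by rewrite princM //; apply: OX => //; exact: OL_zeta1.
Qed.

(** If two products share a class, their product is some (y), and y^2 is a unit times (1 + 'i)^(l +
    l') p1^(b + b'); by [not_principal] both exponents are even. *)
Lemma gens_distinct l b l' b' : (l < 2)%N -> (b < 2)%N -> (l' < 2)%N -> (b' < 2)%N ->
  same_class Ok (gens_prod l b) (gens_prod l' b') -> l = l' /\ b = b'.
Proof.
move=> h1 h2 h3 h4; have sN := gens_submod l b; have sN' := gens_submod l' b'.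
move/(same_classP _ rk _ _ sN sN') => [a [c [Oa Oc a0 c0 e]]].
set N := gens_prod l b in sN e; set N' := gens_prod l' b' in sN' e.
have sP := idmul_submod _ rk _ _ sN sN'.
have sPa := princ_submod _ rk a Oa; have sPc := princ_submod _ rk c Oc.
have E : idmul Ok (princ Ok a) (idmul Ok N N') = princ Ok (c * ((1 + 'i) ^+ l' * p1%:R ^+ b')).
  rewrite -(idmulA _ rk) // e (idmulA _ rk) // gens_sq princM //; exact: OkM_gens.
have [y Py [_ yE]] := scale_princ _ rk a _ _ Oa a0 sP E.
have Oy : Ok y by case: sP => h _ _ _; apply: h.
pose n : algC := (1 + 'i) ^+ l * p1%:R ^+ b * ((1 + 'i) ^+ l' * p1%:R ^+ b').
have yy : princ Ok (y * y) = princ Ok n.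
  rewrite -princM // -yE idmulACA // !gens_sq princM //; exact: OkM_gens.
have n0 : n != 0 by rewrite mulf_neq0 ?gens_sq_neq0.
have [u [Ou uE]] : princ Ok n (y * y) by rewrite -yy; apply: (princ_self _ rk).
have [v [Ov vE]] : princ Ok (y * y) n by rewrite yy; apply: (princ_self _ rk).
have uv : u * v = 1 by apply: (mulfI n0); rewrite mulr1 mulrA -uE -vE.
have u0 : u != 0 by apply: contra_eqN uv => /eqP ->; rewrite mul0r eq_sym oner_eq0.
have Uu : isU k u.
  have vI : u^-1 = v by apply: (mulfI u0); rewrite divff.
  by case: Ou Ov => ? ? [? ?]; split; rewrite ?vI.
have [] := not_principal y u (l + l') (b + b') (let: conj h _ := Oy in h) Uu _.
  by rewrite uE /n !exprD; ring.
move: h1 h2 h3 h4 => h1 h2 h3 h4.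
by rewrite !oddD; case: l l' b b' h1 h2 h3 h4 {N N' sN sN' e sP E yE Py yy n n0 uE vE} => [|[|]] // [|[|]] // [|[|]] // [|[|]].
Qed.

End ClassGroup.

End Fields.

(** * Matching explicit bases with towers of fields, and the case of equal primes *)

Lemma inField_quad n x : inField (fld_quad n) x <-> adj QQ (sq n) x.
Proof.
split=> [[c ->]|[_ [_ [[a ->] [b ->] ->]]]].
  rewrite !big_ord_recl big_ord0 /= addr0 mulr1.
  by exists (ratr (c ord0)), (ratr (c (lift ord0 ord0))); split=> //; eexists.
exists (fun j => nth 0 [:: a; b] j).
by rewrite !big_ord_recl big_ord0 /= addr0 mulr1.
Qed.

Lemma inField_K3p p1 p2 x :
  inField (fld_K3p p1 p2) x <-> adj (adj QQ (sq 2)) (sq (p1 * p2)) x.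
Proof.
split=> [[c ->]|[_ [_ [[_ [_ [[a ->] [b ->] ->]]] [_ [_ [[a' ->] [b' ->] ->]]] ->]]]].
  rewrite !big_ord_recl big_ord0 /=.
  set c0 := c _; set c1 := c _; set c2 := c _; set c3 := c _.
  exists (ratr c0 + ratr c1 * sq 2), (ratr c2 + ratr c3 * sq 2); split; last by ring.
    by exists (ratr c0), (ratr c1); split=> //; eexists.
  by exists (ratr c2), (ratr c3); split=> //; eexists.
exists (fun j => nth 0 [:: a; b; a'; b'] j).
by rewrite !big_ord_recl big_ord0 /=; ring.
Qed.

Lemma inField_K3 p1 p2 x :
  inField (fld_K3 p1 p2) x <-> adj (adj (adj QQ (sq 2)) (sq (p1 * p2))) 'i x.
Proof.
split=> [[c ->]|[_ [_ [[_ [_ [[_ [_ [[a ->] [b ->] ->]]] [_ [_ [[a' ->] [b' ->] ->]]] ->]]]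
  [_ [_ [[_ [_ [[d ->] [e ->] ->]]] [_ [_ [[d' ->] [e' ->] ->]]] ->]]] ->]]]].
  rewrite !big_ord_recl big_ord0 /=.
  set c0 := c _; set c1 := c _; set c2 := c _; set c3 := c _.
  set c4 := c _; set c5 := c _; set c6 := c _; set c7 := c _.
  have Q4 (u0 u1 u2 u3 : rat) : adj (adj QQ (sq 2)) (sq (p1 * p2))
      ((ratr u0 + ratr u1 * sq 2) + (ratr u2 + ratr u3 * sq 2) * sq (p1 * p2)).
    exists (ratr u0 + ratr u1 * sq 2), (ratr u2 + ratr u3 * sq 2); split=> //.
      by exists (ratr u0), (ratr u1); split=> //; eexists.
    by exists (ratr u2), (ratr u3); split=> //; eexists.
  exists ((ratr c0 + ratr c1 * sq 2) + (ratr c2 + ratr c3 * sq 2) * sq (p1 * p2)).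
  exists ((ratr c4 + ratr c5 * sq 2) + (ratr c6 + ratr c7 * sq 2) * sq (p1 * p2)).
  by split; [exact: Q4|exact: Q4|ring].
exists (fun j => nth 0 [:: a; b; a'; b'; d; e; d'; e'] j).
by rewrite !big_ord_recl big_ord0 /=; ring.
Qed.

Lemma inField_k p1 p2 x :
  inField (fld_k p1 p2) x <-> adj (adj QQ 'i) (sq 2 * sq (p1 * p2)) x.
Proof.
rewrite -sqM mulnA; split=> [[c ->]|[_ [_ [[_ [_ [[a ->] [b ->] ->]]] [_ [_ [[a' ->] [b' ->] ->]]] ->]]]].
  rewrite !big_ord_recl big_ord0 /=.
  set c0 := c _; set c1 := c _; set c2 := c _; set c3 := c _.
  exists (ratr c0 + ratr c1 * 'i), (ratr c2 + ratr c3 * 'i); split; last by ring.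
    by exists (ratr c0), (ratr c1); split=> //; eexists.
  by exists (ratr c2), (ratr c3); split=> //; eexists.
exists (fun j => nth 0 [:: a; b; a'; b'] j).
by rewrite !big_ord_recl big_ord0 /=; ring.
Qed.

Lemma OintE B K : (forall x, inField B x <-> K x) -> Oint B = OO K.
Proof. by move=> e; apply: ideal_ext => x; split=> -[h A]; split=> //; apply/e. Qed.

Lemma UnitsE B K x : (forall x, inField B x <-> K x) -> subfield K -> Units B x <-> isU K x.
Proof.
move=> e sK; rewrite /Units (OintE B K e); split; first by case=> -[Kx Ax] [x0 [Kv Av]]; split.
by case=> Kx Ax x0 Av; split=> //; split=> //; split=> //; apply: (sfV _ sK).
Qed.

(* When [p1 = p2 = p], [k] is the field of 8th roots of unity, in which [p] is
   unramified. *)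
Lemma unramified_zeta8 (p : nat) (J : algC -> Prop) : prime p -> odd p ->
  let O := OO (adj (adj QQ 'i) (sq 2 * sq (p * p))) in
  submod O J -> idmul O J J = princ O p%:R -> False.
Proof.
move=> pp op O [JO J0 JD JM] e.
have P0 : p%:R != 0 :> algC by rewrite pnatr_eq0 -lt0n prime_gt0.
have sqp : sq (p * p) = p%:R by rewrite /sq natrM -expr2 sqrCK ?ler0n.
have Qi : QQ ('i * 'i) by rewrite ii; sf_mem QQ_subfield.
have Q2 : QQ (sq 2 * sq 2) by rewrite sq_sq; sf_mem QQ_subfield.
have sfi := adj_subfield QQ_subfield _ Qi.
have nr2 : ~ QQ (sq 2) by apply: (nQQ_2 _ 1) => //; rewrite sq_sq muln1.
have [|s [s2 si _]] := quad_conj (sq 2) 'i 'i Q2 Qi Qi.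
  have n2 : ~ QQ (sq 2 * 'i).
    by apply: nQQ_neg; rewrite mulrACA ii sq_sq mulrN1 oppr_lt0 ltr0n.
  apply: notin_biquad => //; rewrite -mulrA ii mulrN1 => h; apply: nr2.
  by rewrite -[sq 2]opprK; apply: (sfN QQ_subfield).
have Jp (nu mu : {rmorphism algC -> algC}) x : J x -> nu x * mu x / p%:R \in Aint.
  move=> Jx; have : idmul O J J (x * x) by apply: idmul_in.
  rewrite e => -[b [[_ Ab] xx]]; apply: Aint_sqrt.
  have -> : nu x * mu x / p%:R * (nu x * mu x / p%:R) = nu (x * x) * mu (x * x) / (p%:R * p%:R).
    by rewrite !rmorphM /=; field.
  have -> : nu (x * x) * mu (x * x) / (p%:R * p%:R) = nu b * mu b.
    rewrite xx !rmorphM /= !rmorph_nat; field; exact: P0.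
  by rewrite rpredM // Aint_aut.
have A2 : sq 2 \in Aint by apply: Aint_sqrt; rewrite sq_sq Aint_Cnat ?natr_nat.
have Ai : ('i : algC) \in Aint by apply: Aint_sqrt; rewrite ii rpredN Aint1.
pose cs : {rmorphism algC -> algC} := cj \o s.
have csi : cs 'i = - 'i by rewrite /cs /= si conjCi.
have cs2 : cs (sq 2) = - sq 2 by rewrite /cs /= s2 rmorphN /= cj_sq.
have dv (x d0 : algC) v : J x -> d0 \in Aint -> QQ v ->
    x * d0 + s (x * d0) + cj (x * d0) + cs (x * d0) = v ->
    exists2 u, u \in Aint & v = p%:R * u.
  move=> Jx Ad Qv vE; have Ax : x \in Aint by case: (JO _ Jx).
  have [|T TE] := QQ_Aint _ Qv.
    by rewrite -vE !rpredD ?Aint_aut // rpredM.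
  have : (p%:Z %| T * T)%Z.
    apply: dvdz_Aint; first exact: prime_gt0.
    rewrite intrM -TE -vE.
    pose i0 : {rmorphism algC -> algC} := idfun.
    have st (nu mu : {rmorphism algC -> algC}) : nu (x * d0) * mu (x * d0) / p%:R \in Aint.
      rewrite (rmorphM nu) (rmorphM mu).
      have -> : nu x * nu d0 * (mu x * mu d0) / p%:R = nu x * mu x / p%:R * (nu d0 * mu d0) by ring.
      by rewrite rpredM ?Jp // rpredM // Aint_aut.
    have expand (a b c d : algC) : (a + b + c + d) * (a + b + c + d) / p%:R =
      a * a / p%:R + a * b / p%:R + a * c / p%:R + a * d / p%:R +
      (b * a / p%:R + b * b / p%:R + b * c / p%:R + b * d / p%:R) +
      (c * a / p%:R + c * b / p%:R + c * c / p%:R + c * d / p%:R) +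
      (d * a / p%:R + d * b / p%:R + d * c / p%:R + d * d / p%:R) by ring.
    rewrite -[x * d0]/(i0 (x * d0)).
    rewrite expand.
    by rewrite !rpredD // st.
  move=> /(sqfree_prime _ pp) /dvdzP [u uE]; exists u%:~R; first exact: Aint_int.
  by rewrite TE uE intrM mulrC.
(* Traces of x against 1, 'i, sqrt 2 and their product recover the coordinates of 8x, all divisible
   by p; so J^2 = (p) would put 64 p in p^2 times the algebraic integers. *)
have key x : J x -> exists2 w, w \in Aint & 8 * x = p%:R * w.
  move=> Jx; have [[_ [_ [[a [b [Qa Qb ->]]] [c [d [Qc Qd ->]]] xE]]] Ax] := JO _ Jx.
  rewrite sqp in xE.
  have fx (nu : {rmorphism algC -> algC}) : nu x = a + b * nu 'i + (c + d * nu 'i) * (nu (sq 2) * p%:R).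
    by rewrite xE !(rmorphM, rmorphD) /= !(fmorph_QQ nu a, fmorph_QQ nu b, fmorph_QQ nu c, fmorph_QQ nu d) // rmorph_nat.
  have ic := conjCi algC; have c2 := cj_sq 2.
  have ie := ii; have e2 := sq_sq 2.
  have [||u1 B1 E1] := dv x 1 (4 * a) Jx (Aint1); first by sf_mem QQ_subfield.
    by rewrite !mulr1 !fx csi cs2 cj_i c2 si s2 xE; ring.
  have [||u2 B2 E2] := dv x 'i (- (4 * b)) Jx Ai; first by sf_mem QQ_subfield.
    rewrite !rmorphM !fx csi cs2 cj_i c2 si s2 xE.
    by transitivity (4 * b * ('i * 'i)); [ring|rewrite ii; ring].
  have [||u3 B3 E3] := dv x (sq 2) (8 * c * p%:R) Jx A2; first by sf_mem QQ_subfield.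
    rewrite !rmorphM !fx csi cs2 cj_i c2 si s2 xE.
    by transitivity (4 * c * p%:R * (sq 2 * sq 2)); [ring|rewrite e2; ring].
  have [||u4 B4 E4] := dv x (sq 2 * 'i) (- (8 * d * p%:R)) Jx (rpredM A2 Ai); first by sf_mem QQ_subfield.
    rewrite !(rmorphM _ x) !(rmorphM _ (sq 2)) !fx csi cs2 cj_i c2 si s2 xE.
    by transitivity (4 * d * p%:R * (sq 2 * sq 2) * ('i * 'i)); [ring|rewrite e2 ii; ring].
  exists (2 * u1 - 2 * u2 * 'i + u3 * sq 2 - u4 * 'i * sq 2).
    by rewrite !rpredD ?rpredN ?rpredM // Aint_Cnat ?natr_nat.
  transitivity (2 * (4 * a) - 2 * (- (4 * b)) * 'i + 8 * c * p%:R * sq 2 - (- (8 * d * p%:R)) * 'i * sq 2).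
    by rewrite xE; ring.
  by rewrite E1 E2 E3 E4; ring.
have sfk := adj_subfield sfi (sq 2 * sq (p * p)).
have sO : subring O.
  apply/OO_subring/sfk; rewrite sqp mulrACA sq_sq; sf_mem sfi.
have sK : submod O (fun z => O z /\ exists2 w, w \in Aint & 64 * z = p%:R * p%:R * w).
  split.
  - by move=> x [].
  - by split; [exact: (sr0 _ sO)|exists 0; rewrite ?mulr0 // Aint0].
  - move=> x y [Ox [w Aw E]] [Oy [w' Aw' E']]; split; first exact: (srD _ sO).
    by exists (w + w'); rewrite ?rpredD // !mulrDr E E'.
  - move=> a x [ka Aa] [Ox [w Aw E]]; split; first exact: (srM _ sO).
    by exists (a * w); rewrite ?rpredM // mulrCA E; ring.
have [_ [w Aw E]] : O p%:R /\ exists2 w, w \in Aint & 64 * p%:R = p%:R * p%:R * w.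
  apply: (idmul_min O J J _ _ sK); last by rewrite e; apply: (princ_self _ sO).
  move=> x y Jx Jy; split; first by apply: (srM _ sO); apply: JO.
  have [w Aw E] := key _ Jx; have [w' Aw' E'] := key _ Jy.
  exists (w * w'); first exact: rpredM.
  by transitivity ((8 * x) * (8 * y)); [ring|rewrite E E'; ring].
have : (p%:Z %| 64)%Z.
  apply: dvdz_Aint; first exact: prime_gt0.
  have -> : 64%:~R / p%:R = w :> algC; last by [].
  apply: (mulfI (mulf_neq0 P0 P0)); rewrite -E -[64%:~R]/(64%:R); field; exact: P0.
rewrite dvdzE /= => h; have : (p %| 2 ^ 6)%N by [].
by rewrite Euclid_dvdX // => /andP[]; rewrite dvdn_prime2 // => /eqP p2; rewrite p2 in op.
Qed.

Lemma unit_index1 p1 p2 s t : setting p1 p2 s t -> unit_index_K3p p1 p2 1 ->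
  forall x, isU (adj (adj QQ (sq 2)) (sq (p1 * p2))) x -> Hdec p1 p2 x.
Proof.
move=> S [r [_ _ cover]] x Ux.
have sF := sfF p1 p2; have s2 := sfQ2; have sm := sfQm p1 p2; have sd := sfQd p1 p2.
have E2 : sq (2 * p1 * p2) = sq 2 * sq (p1 * p2) by rewrite -mulnA sqM.
have dec z : isU (adj (adj QQ (sq 2)) (sq (p1 * p2))) z -> exists a b c,
    [/\ isU (adj QQ (sq 2)) a, isU (adj QQ (sq (p1 * p2))) b,
        isU (adj QQ (sq 2 * sq (p1 * p2))) c & z / r ord0 = a * b * c].
  move=> Uz; have [j [a [b [c [Ua Ub Uc E]]]]] :=
    cover _ ((UnitsE _ _ z (inField_K3p p1 p2) sF).2 Uz).
  exists a, b, c; rewrite (ord1 j) in E; split=> //.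
  - exact: (UnitsE _ _ a (inField_quad 2) s2).1.
  - exact: (UnitsE _ _ b (inField_quad _) sm).1.
  - by rewrite -E2; apply: (UnitsE _ _ c (inField_quad _) _).1; rewrite // E2.
have [a [b [c [Ua Ub Uc E]]]] := dec _ Ux.
(* The single coset representative need not be 1, so the decomposition of x is divided by that of
   1. *)
have [a' [b' [c' [Ua' Ub' Uc' E']]]] := dec _ (isU1 sF).
exists (a / a'), (b / b'), (c / c'); split; [exact: (isU_div s2)|exact: (isU_div sm)|exact: (isU_div sd)|].
have [_ _ a0 _] := Ua'; have [_ _ b0 _] := Ub'; have [_ _ c0 _] := Uc'.
have r0 : r ord0 != 0.
  apply/eqP => r0; move: E'; rewrite r0 invr0 mulr0 => /esym/eqP.
  by rewrite !mulf_eq0 (negPf a0) (negPf b0) (negPf c0).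
have -> : x = (x / r ord0) / (1 / r ord0) by field; rewrite ?r0.
by rewrite E E'; field; rewrite a0 b0 c0.
Qed.

Lemma unit_index2 p1 p2 : unit_index_K3p p1 p2 2 ->
  exists2 y, isU (adj (adj QQ (sq 2)) (sq (p1 * p2))) y & ~ Hdec p1 p2 y.
Proof.
move=> [r [rU inj _]]; have sF := sfF p1 p2.
have U j : isU (adj (adj QQ (sq 2)) (sq (p1 * p2))) (r j).
  exact: (UnitsE _ _ _ (inField_K3p p1 p2) sF).1 (rU j).
exists (r ord0 / r (lift ord0 ord0)); first exact: (isU_div sF).
move=> [a [b [c [Ua Ub Uc E]]]]; suff : (ord0 : 'I_2) = lift ord0 ord0 by [].
apply: inj; exists a, b, c; split=> //.
- exact: (UnitsE _ _ a (inField_quad 2) sfQ2).2.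
- exact: (UnitsE _ _ b (inField_quad _) (sfQm p1 p2)).2.
- have E2 : sq (2 * p1 * p2) = sq 2 * sq (p1 * p2) by rewrite -mulnA sqM.
  by apply: (UnitsE _ _ c (inField_quad _) _).2; rewrite E2 //; exact: (sfQd p1 p2).
Qed.

(** * The capitulation kernel in the two cases *)

Theorem theorem44 (p1 p2 : nat) (e f : int)
  (H0 H1 H2 : algC -> Prop) :
  prime p1 -> prime p2 -> (p1 %% 4 = 1)%N -> (p2 %% 4 = 1)%N ->
  (let A := legendre p1 p2 == -1 in
   let B := legendre 2 p1 == -1 in
   let C := legendre 2 p2 == -1 in [|| A && B, A && C | B && C]) ->
  p1%:Z = e ^+ 2 + 4 * f ^+ 2 ->
  let Ok := Oint (fld_k p1 p2) in
  let OK3 := Oint (fld_K3 p1 p2) in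
  let pi1 : algC := e%:~R + 2 * 'i * f%:~R in
  let pi2 : algC := e%:~R - 2 * 'i * f%:~R in
  is_ideal Ok H0 -> is_ideal Ok H1 -> is_ideal Ok H2 ->
  ideal_eq (idmul Ok H0 H0) (princ Ok (1 + 'i)) ->
  ideal_eq (idmul Ok H1 H1) (princ Ok pi1) ->
  ideal_eq (idmul Ok H2 H2) (princ Ok pi2) ->
  let H12 := idmul Ok H1 H2 in
  (* (1) *)
  (unit_index_K3p p1 p2 1 ->
     (* ker J_K3 = < [H0], [H1 H2] > *)
     (forall I, is_ideal Ok I ->
        capitulates OK3 I <->
        exists a b : nat, same_class Ok I (idmul Ok (idexp Ok H0 a) (idexp Ok H12 b)))
     /\
     (* exactly four classes capitulate *)
     (exists Is : 'I_4 -> (algC -> Prop),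
        [/\ forall j, is_ideal Ok (Is j) /\ capitulates OK3 (Is j),
            forall j j', same_class Ok (Is j) (Is j') -> j = j'
          & forall I, is_ideal Ok I -> capitulates OK3 I ->
              exists j, same_class Ok I (Is j)]))
  /\
  (* (2) *)
  (unit_index_K3p p1 p2 2 ->
     forall I, is_ideal Ok I ->
       capitulates OK3 I <-> exists a : nat, same_class Ok I (idexp Ok H0 a)).
Proof.
move=> pp1 pp2 p14 p24 leg p1E Ok OK3 pi1 pi2 [sH0 _] [sH1 _] [sH2 _].
move=> /ideal_ext sq0 /ideal_ext sq1 /ideal_ext sq2 H12.
have OkE : Ok = OO (adj (adj QQ 'i) (sq 2 * sq (p1 * p2))) := OintE _ _ (inField_k p1 p2).
have OLE : OK3 = OO (adj (adj (adj QQ (sq 2)) (sq (p1 * p2))) 'i) := OintE _ _ (inField_K3 p1 p2).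
have sk := sfk p1 p2; have rk := OO_subring _ sk; rewrite -OkE in rk.
have ki : adj (adj QQ 'i) (sq 2 * sq (p1 * p2)) 'i := k_i p1 p2.
have Ai2 : 2 * 'i * f%:~R \in Aint.
  by rewrite !rpredM ?Aint_int ?Aint_i // Aint_Cnat ?natr_nat.
have Ok1 : Ok pi1.
  by rewrite OkE; split; [rewrite /pi1; sf_mem sk|rewrite rpredD ?Aint_int].
have Ok2 : Ok pi2.
  by rewrite OkE; split; [rewrite /pi2; sf_mem sk|rewrite rpredB ?Aint_int].
have pp : pi1 * pi2 = p1%:R.
  have -> : pi1 * pi2 = e%:~R ^+ 2 - ('i * 'i) * (4 * f%:~R ^+ 2) by rewrite /pi1 /pi2; ring.
  by rewrite ii -[RHS]/((p1%:Z)%:~R) p1E rmorphD /= intrM !rmorphXn /= -[4%:~R]/(4%:R); ring.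
have sH12 : submod Ok H12 by apply: (idmul_submod _ rk).
have sq12 : idmul Ok H12 H12 = princ Ok p1%:R.
  have := idmulACA p1 p2 H1 H2 H1 H2; rewrite -OkE => E; rewrite /H12 E //.
  by rewrite sq1 sq2 (princM _ rk) // pp.
(* If p1 = p2 then k is the field of eighth roots of unity, where p1 is unramified and cannot be the
   square of H1H2. *)
have [p12|p12] := eqVneq p1 p2.
  exfalso; rewrite -p12 in OkE; rewrite OkE in sH12 sq12.
  by apply: (unramified_zeta8 p1 H12 pp1 _ sH12 sq12); lia.
have [s [t S]] := setting_exists _ _ pp1 pp2 p14 p24 p12 leg.
have gensE a b : idmul Ok (idexp Ok H0 a) (idexp Ok H12 b) = gens_prod p1 p2 H0 H12 a b.
  by rewrite /gens_prod -OkE.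
have gens0 a : idexp Ok H0 a = gens_prod p1 p2 H0 H12 a 0.
  by rewrite -gensE (idmulI1 _ rk) //; apply: (idexp_submod _ rk).
move: Ok OK3 OkE OLE rk Ok1 Ok2 sH0 sH1 sH2 sq0 sq1 sq2 H12 sH12 sq12 gensE gens0 =>
  Ok OK3 -> -> rk Ok1 Ok2 sH0 sH1 sH2 sq0 sq1 sq2 H12 sH12 sq12 gensE gens0.
have bound := cap_bound _ _ _ _ S _ _ sH0 sH12 sq0 sq12.
have subm := gens_submod _ _ _ _ sH0 sH12.
split=> [/(unit_index1 _ _ _ _ S)/(q1_sqc _ _ _ _ S) [x Ux sx]|idx I idI]; last first.
  have [sI _] := idI; have [y Uy ny] := unit_index2 _ _ idx; split.
    move=> /(bound _ idI) [l [b [_ b2 sc hb]]]; exists l.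
    case: b b2 sc hb => [|[|]] // _ sc; first by rewrite gens0.
    by case/(_ erefl) => x Ux /(q2_not_sqc _ _ _ _ S _ _ Uy ny Ux).
  move=> [a sc]; apply: (capitulates_class p1 p2 _ _ sI _ sc).
    exact: (idexp_submod _ rk).
  exact: (capitulates_H0 _ _ _ _ S _ sH0 sq0).
have cap a b := capitulates_gens _ _ _ _ S _ _ sH0 sH12 sq0 sq12 a b x Ux sx.
split=> [I idI|].
  have [sI _] := idI; split.
    by move=> /(bound _ idI) [l [b [_ _ sc _]]]; exists l, b; rewrite gensE.
  by move=> [a [b sc]]; rewrite gensE in sc; apply: (capitulates_class p1 p2 _ _ sI _ sc).
(* The binary digits of j are the exponents of H0 and H1H2. *)
exists (fun j : 'I_4 => gens_prod p1 p2 H0 H12 (j %% 2) (j %/ 2)); split.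
- move=> j; split; last exact: cap.
  split; first exact: subm.
  exists ((1 + 'i) ^+ (j %% 2) * p1%:R ^+ (j %/ 2)); split; first exact: (gens_sq_neq0 _ _ _ _ S).
  have [_ _ _ h] := subm (j %% 2)%N (j %/ 2)%N.
  (* The generator of the square of the ideal is a nonzero element of the ideal itself. *)
  have : princ (OO (adj (adj QQ 'i) (sq 2 * sq (p1 * p2))))
      ((1 + 'i) ^+ (j %% 2) * p1%:R ^+ (j %/ 2)) ((1 + 'i) ^+ (j %% 2) * p1%:R ^+ (j %/ 2)).
    exact: (princ_self _ rk).
  rewrite -(gens_sq _ _ _ _ sH0 sH12 sq0 sq12).
  by apply: idmul_min => // u v Nu Nv; apply: h => //; case: (subm (j %% 2)%N (j %/ 2)%N) => h' _ _ _; apply: h'.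
- move=> j j' sc.
  have [e1 e2] : (j %% 2 = j' %% 2 /\ j %/ 2 = j' %/ 2)%N.
    apply: (gens_distinct _ _ _ _ S _ _ sH0 sH12 sq0 sq12) sc; rewrite ?ltn_mod ?ltn_divLR //.
  by apply: val_inj; rewrite /= (divn_eq j 2) (divn_eq j' 2) e1 e2.
move=> I idI /(bound _ idI) [l [b [l2 b2 sc _]]].
have lt : (b * 2 + l < 4)%N by lia.
exists (Ordinal lt); rewrite /= modnMDl modn_small // divnMDl // divn_small // addn0.
exact: sc.
Qed.
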